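(* The patterns $312$ and $231$ are shape-$\star$-Wilf-equivalent. Consequently, for any $m\ge 3$ and any permutation $X=x_4\cdots x_m$ of the set $\{4,5,\dots,m\}$, the two patterns $312X$ (i.e. $3,1,2,x_4,\dots,x_m$) and $231X$ (i.e. $2,3,1,x_4,\dots,x_m$) are strongly $\star$-Wilf-equivalent.
   Context: Ferrers diagrams: for a non-increasing sequence $\lambda_1\ge\dots\ge\lambda_c\ge 0$, the Ferrers diagram of shape $\lambda$ is a bottom-justified array of cells with $c$ columns, the $j$-th column from the left having $\lambda_j$ cells (columns of height zero are allowed). Rows are numbered from bottom (row 1) to top, columns from left to right; cell $(i,j)$ is in row $i$, column $j$. A partial filling of a Ferrers diagram $D$ is a pair consisting of a set $H$ of columns of $D$ (the $\diamond$-columns; the others are standard columns) and an assignment to every cell of a symbol: cells in $\diamond$-columns get $\diamond$, cells in standard columns get $0$ or $1$. It is a partial transversal if every row and every standard column contains exactly one 1-cell, and sparse if every row and every standard column contains at most one 1-cell. A non-partial filling is one with $H=\emptyset$. A permutation $p\in S_\ell$ is identified with its permutation matrix, the $\ell\times\ell$ 01-matrix with a 1 in cell $(i,j)$ iff $p_j=i$. A non-partial sparse filling $F$ contains a permutation matrix $P$ of size $\ell$ if there are rows $r_1<\dots<r_\ell$ and columns $c_1<\dots<c_\ell$ such that all cells $(r_a,c_b)$ belong to the diagram and the values in these cells form $P$. Substitution into a $\diamond$-column $j$ of height $h$ of a partial filling with $m$ columns: choose $1\le i\le h+1$, insert a new row between rows $i-1$ and $i$ whose length is at most that of row $i-1$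 (or exactly $m$ if $i=1$), at least that of row $i$, and which contains a cell of column $j$; fill column $j$ with $0$ except a $1$ in the new row, make column $j$ standard, and fill the other cells of the new row with $0$ in standard columns and $\diamond$ in $\diamond$-columns. An extension of a partial filling with $k$ $\diamond$-columns is any non-partial filling obtained by $k$ successive substitutions. A partial filling avoids $P$ if all its extensions avoid $P$. Permutations $P,Q$ are shape-$\star$-Wilf-equivalent if for every Ferrers diagram $D$ and every set $H$ of its columns, the number of $P$-avoiding partial transversals of $D$ with $\diamond$-column set $H$ equals the number of $Q$-avoiding ones (equivalently there is a bijection between them preserving the $\diamond$-columns). Partial permutations: $S_n^k$ is the set of sequences $\pi_1\cdots\pi_n$ in which each of $1,\dots,n-k$ appears once and the other $k$ entries are the hole $\diamond$; $S_n^H$ ($H\subseteq[n]$) those with holes exactly at positions in $H$. A permutation $\sigma$ of $[n]$ is an extension of $\pi$ if the standardization (order-preserving relabeling to $1,2,\dots$) of $\sigma$ restricted to the non-hole positions of $\pi$ equals $\pi$ restricted to those positions; $\pi$ avoids a pattern $p$ if every extension of $\pi$ avoids $p$ in the classical sense. $s_n^H(p)$ is the number of $p$-avoiding elements of $S_n^H$; $p,q$ are strongly $\star$-Wilf-equivalent if $s_n^H(p)=s_n^H(q)$ for all $n$ and all $H\subseteq[n]$. *)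

(* Defs.v *)
(* MathComp; boolp is used only for `[< _ >], which turns a Prop into a bool. *)
From mathcomp Require Import all_boot perm.
From mathcomp Require Import boolp.

Set Implicit Arguments.
Unset Strict Implicit.
Unset Printing Implicit Defensive.

(** A pattern is a word [p : seq nat] that permutes 1, ..., size p. Rows, columns
    and positions are numbered from 0, the values in words from 1. *)

(** * Fillings of Ferrers diagrams *)

(** A Ferrers diagram with [c] columns is given by its column heights. *)
Definition ferrers (c : nat) (lam : 'I_c -> nat) : Prop :=
  forall a b : 'I_c, a <= b -> lam b <= lam a.

(** [None] is the diamond, [Some false] and [Some true] are 0 and 1. *)
Notation symbol := (option bool).

(** [col F j] lists the symbols of column [j] from bottom to top. Since a column
    may be empty, the set of diamond columns cannot be read off from [col]. *)
Record prefilling (c : nat) := Prefilling {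
  dcols : {set 'I_c};
  col : 'I_c -> seq symbol
}.

Definition height c (F : prefilling c) (j : 'I_c) : nat := size (col F j).

Definition entry c (F : prefilling c) (i : nat) (j : 'I_c) : symbol :=
  nth (Some false) (col F j) i.

Definition row_length c (F : prefilling c) (i : nat) : nat :=
  #|[set j | i < height F j]|.

Definition partial_filling c (F : prefilling c) : Prop :=
  ferrers (height F) /\
  forall (j : 'I_c) (x : symbol),
    x \in col F j -> (x == None) = (j \in dcols F).

(** A row exists exactly when it has positive length. *)
Definition partial_transversal c (F : prefilling c) : Prop :=
  [/\ partial_filling F,
      forall i : nat, 0 < row_length F i ->
        #|[set j | (i < height F j) && (entry F i j == Some true)]| = 1
    & forall j : 'I_c, j \notin dcols F -> count_mem (Some true) (col F j) = 1].

(** The matrix of [p] has a 1 in row [a], column [b] iff the [b]-th letter of [p]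
    is [a.+1]. *)
Definition contains c (F : prefilling c) (p : seq nat) : Prop :=
  exists (r : 'I_(size p) -> nat) (k : 'I_(size p) -> 'I_c),
    [/\ forall a b : 'I_(size p), a < b -> r a < r b,
        forall a b : 'I_(size p), a < b -> k a < k b
      & forall a b : 'I_(size p),
          r a < height F (k b) /\
          entry F (r a) (k b) = Some (nth 0 p b == a.+1)].

Definition insert (T : Type) (i : nat) (x : T) (s : seq T) : seq T :=
  take i s ++ x :: drop i s.

(** [substitute F j i L] substitutes into column [j]: the new row has index [i] and
    consists of the [L] leftmost columns. *)
Definition substitute c (F : prefilling c) (j : 'I_c) (i L : nat)
    : prefilling c :=
  Prefilling (dcols F :\ j)
    (fun b => if b == j
              then insert i (Some true) (nseq (height F j) (Some false))
              else if b < L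
              then insert i (if b \in dcols F then None else Some false)
                          (col F b)
              else col F b).

(** When [i = i'.+1], row [i'] lies just below the new row and the old row [i]
    (of length 0 if there is none) just above it. *)
Definition can_substitute c (F : prefilling c) (j : 'I_c) (i L : nat) : Prop :=
  [/\ j \in dcols F, i <= height F j, j < L, row_length F i <= L
    & if i is i'.+1 then L <= row_length F i' else L = c].

Inductive substitutions c : nat -> prefilling c -> prefilling c -> Prop :=
| Substitutions0 F : substitutions 0 F F
| SubstitutionsS k F j i L G :
    can_substitute F j i L -> substitutions k (substitute F j i L) G ->
    substitutions k.+1 F G.

Definition extension c (F G : prefilling c) : Prop :=
  substitutions #|dcols F| F G /\ dcols G = set0.

Definition avoids c (F : prefilling c) (p : seq nat) : Prop :=
  forall G : prefilling c, extension F G -> ~ contains G p.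

(** An element of the dependent function type is an arbitrary assignment of symbols
    to the cells of the diagram of shape [lam]. *)
Definition num_avoiding_transversals c (lam : 'I_c -> nat) (H : {set 'I_c})
    (p : seq nat) : nat :=
  #|[set f : {dffun forall j : 'I_c, (lam j).-tuple symbol} |
      `[< partial_transversal (Prefilling H (fun j => f j : seq symbol)) /\
          avoids (Prefilling H (fun j => f j : seq symbol)) p >] ]|.

Definition shape_star_Wilf_equivalent (p q : seq nat) : Prop :=
  forall (c : nat) (lam : 'I_c -> nat) (H : {set 'I_c}), ferrers lam ->
    num_avoiding_transversals lam H p = num_avoiding_transversals lam H q.

(** * Partial permutations *)

(** The order-preserving relabelling of a word with distinct letters to 1, 2, ... *)
Definition standardization (s : seq nat) : seq nat :=
  [seq count (fun y => y <= x) s | x <- s].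

Definition classically_contains (s p : seq nat) : Prop :=
  exists2 t : seq nat, subseq t s & standardization t = p.

(** Values are letters 1, ..., n of ['I_n.+1]; [partial_perm] excludes 0. *)
Definition nonholes n (pi : n.-tuple (option 'I_n.+1)) : seq nat :=
  [seq nat_of_ord v | v <- pmap id pi].

Definition holes n (pi : n.-tuple (option 'I_n.+1)) : {set 'I_n} :=
  [set j | tnth pi j == None].

Definition partial_perm n (pi : n.-tuple (option 'I_n.+1)) : bool :=
  perm_eq (nonholes pi) (iota 1 (n - #|holes pi|)).

Definition perm_word n (s : 'S_n) : seq nat := [seq (s j).+1 | j <- enum 'I_n].

Definition perm_extension n (pi : n.-tuple (option 'I_n.+1)) (s : 'S_n) : Prop :=
  standardization [seq (s j).+1 | j <- enum 'I_n & j \notin holes pi]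
  = nonholes pi.

Definition partial_perm_avoids n (pi : n.-tuple (option 'I_n.+1)) (p : seq nat)
    : Prop :=
  forall s : 'S_n, perm_extension pi s -> ~ classically_contains (perm_word s) p.

Definition num_avoiding_partial_perms n (H : {set 'I_n}) (p : seq nat) : nat :=
  #|[set pi : n.-tuple (option 'I_n.+1) |
      [&& partial_perm pi, holes pi == H & `[< partial_perm_avoids pi p >] ] ]|.

Definition strongly_star_Wilf_equivalent (p q : seq nat) : Prop :=
  forall (n : nat) (H : {set 'I_n}),
    num_avoiding_partial_perms H p = num_avoiding_partial_perms H q.

(* Main.v *)
(** The two patterns are compared through the words [c] that list, from the top row
    to the bottom row, the column of the 1 of each row. In such a word 312 reads
    as 132 and 231 as 213, the bound being that the largest column lies in the
    topmost of the three rows.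

    Travel along the border of the diagram from its top left to its bottom right
    corner, keeping the subword [q] of [c] formed by the columns already met and the
    rows not yet left. A horizontal step inserts the new (largest) column in [q], a
    vertical step deletes the first letter of [q]. The number of ways to go on
    depends on [q] only through a word of bits: for 132 the right-to-left maxima
    of [q], for 213 its ascents. In both cases the insertions split as [A + B], where
    [A] adds a bit 1, and, for a suitable operator [P], the deletion [S] satisfies
    [S A = 1], [S B = P], [P A = A + B], [P B = B P] and [P] fixes the empty word.
    These relations let both families of walks be evaluated by one free model, so
    they have the same number of members ending in a word of bits all equal to 1.

    A diamond column forces [q] to have all its bits equal to 1 when it is met, and
    it makes every later insertion forced; a second one requires that no row extends
    beyond it, and three of them are always an occurrence. Hence equality for partial
    transversals.

    For the patterns [312X] and [231X], the cells with an occurrence of [X] above and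
    to the right of them form a Ferrers diagram, which is unchanged when the letters
    inside it are rearranged. Partial permutations with the same diagram and the same
    letters outside of it are compared by the previous argument. *)

Require Import Defs.
From mathcomp Require Import all_boot perm.
From mathcomp Require Import zify boolp.

Set Implicit Arguments.
Unset Strict Implicit.
Unset Printing Implicit Defensive.

(** * Counting walks on words of bits *)

(** Avoidance quantifies over all extensions, an obstacle common to both halves. It is removed by
    showing that some extension contains the pattern exactly when the cells outside the diamond
    columns already form the corresponding part of it, a letter of the pattern in a diamond column
    being unconstrained: a suitable row, or value, can always be supplied afterwards. Both halves
    then become instances of one statement, [class_card_eq], on placements of 1's on a Ferrers board
    with some columns left free. The border is followed in this direction because rows get shorter
    upwards: at each moment every column of [q] meets every remaining row, so the bound on the
    largest column holds by itself and the condition concerns [q] alone. No bijection between the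
    two kinds of words of bits is built. The relations suffice to compute every walk: a deletion
    that hits a [B] leaves a [P], which travels through the word until an [A] or the empty word
    absorbs it. *)

Section Walks.
Variable g : nat -> nat.

(* The state [None] is the empty [q]; [Some u] is a [q] with one more letter than
   [u] has bits, as the last letter of [q] would always have the same bit. *)
Definition final (s : option (seq bool)) : nat :=
  if s is Some u then all id u * g (size u).+1 else g 0.

Fixpoint walks (B : seq bool -> seq (seq bool)) (w : seq bool)
    (s : option (seq bool)) : nat :=
  match w with
  | [::] => final s
  | true :: w' =>
    if s is Some u
    then walks B w' (Some (true :: u)) + \sum_(v <- B u) walks B w' (Some v)
    else walks B w' (Some [::])
  | false :: w' =>
    match s with
    | None => 0
    | Some [::] => walks B w' None
    | Some (_ :: u) => walks B w' (Some u)
    end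
  end.

(* In the free model a word stands for a product of [A]'s (true) and [B]'s (false)
   applied to the empty word; [free_shift] moves [P] through it by means of
   [P A = A + B] and [P B = B P]. *)
Fixpoint free_shift (x : seq bool) : seq (seq bool) :=
  match x with
  | [::] => [:: [::]]
  | true :: x' => [:: true :: x'; false :: x']
  | false :: x' => map (cons false) (free_shift x')
  end.

Fixpoint free_walks (w : seq bool) (s : option (seq bool)) : nat :=
  match w with
  | [::] => final s
  | true :: w' =>
    if s is Some x
    then free_walks w' (Some (true :: x)) + free_walks w' (Some (false :: x))
    else free_walks w' (Some [::])
  | false :: w' =>
    match s with
    | None => 0
    | Some [::] => free_walks w' None
    | Some (true :: x) => free_walks w' (Some x)
    | Some (false :: x) => \sum_(x' <- free_shift x) free_walks w' (Some x')
    end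
  end.

Section Evaluation.
Variables B P : seq bool -> seq (seq bool).
(** An operator sends a word to a list of words. Identities between operators are tested against an
    arbitrary weight [h], so they are equalities of multisets. [B_not_all] ensures that among the
    free words only the products of [A]'s contribute at the end of a walk. *)
Hypothesis size_B : forall u v, v \in B u -> size v = (size u).+1.
Hypothesis B_not_all : forall u v, v \in B u -> all id v = false.
Hypothesis behead_B : forall (h : seq bool -> nat) u,
  \sum_(v <- B u) h (behead v) = \sum_(v <- P u) h v.
Hypothesis P_cons : forall (h : seq bool -> nat) u,
  \sum_(v <- P (true :: u)) h v = h (true :: u) + \sum_(v <- B u) h v.
Hypothesis P_B : forall (h : seq bool -> nat) u,
  \sum_(v <- B u) \sum_(v' <- P v) h v' = \sum_(v <- P u) \sum_(v' <- B v) h v'.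
Hypothesis P_nil : P [::] = [:: [::]].

Fixpoint evaluation (x : seq bool) : seq (seq bool) :=
  match x with
  | [::] => [:: [::]]
  | true :: x' => map (cons true) (evaluation x')
  | false :: x' => flatten (map B (evaluation x'))
  end.

Lemma size_evaluation x u : u \in evaluation x -> size u = size x.
Proof.
elim: x u => [|[] x IH] u /=; first by rewrite inE => /eqP ->.
  by case/mapP=> v /IH <- ->.
by case/flatten_mapP=> v /IH <- /size_B.
Qed.

Lemma sum_evaluation_all x : \sum_(u <- evaluation x) all id u = all id x.
Proof.
elim: x => [|[] x IH] /=; first by rewrite big_seq1.
  by rewrite big_map /= IH.
by rewrite big_flatten /= big_map; apply: big1 => u _; rewrite big1_seq // => v /andP[_ /B_not_all->].
Qed.

Lemma evaluation_shift (h : seq bool -> nat) x :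
  \sum_(u <- evaluation x) \sum_(v <- P u) h v
  = \sum_(x' <- free_shift x) \sum_(u <- evaluation x') h u.
Proof.
elim: x h => [|[] x IH] h /=.
- by rewrite !big_seq1 P_nil big_seq1.
- rewrite big_map big_cons big_seq1 /= big_map big_flatten big_map -big_split /=.
  by apply: eq_bigr => u _; rewrite P_cons.
rewrite big_flatten !big_map /=.
under eq_bigr do rewrite P_B.
rewrite IH; apply: eq_bigr => x' _ /=.
by rewrite big_flatten big_map.
Qed.

(** A [B] turns one word of bits into several, so the invariant is a sum over all the words that a
    free word represents; the relations govern this total. *)
Lemma walks_free w :
  walks B w None = free_walks w None /\
  forall x, \sum_(u <- evaluation x) walks B w (Some u) = free_walks w (Some x).
Proof.
elim: w => [|[] w [IH0 IH]] /=.
- split=> // x; rewrite -sum_evaluation_all big_distrl /= big_seq [RHS]big_seq.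
  by apply: eq_bigr => u /size_evaluation ->.
- split; first by rewrite -IH big_seq1.
  move=> x; rewrite big_split /= -!IH /=; congr (_ + _).
    by rewrite big_map.
  by rewrite big_flatten big_map.
split=> // -[|[] x] /=; first by rewrite big_seq1.
  by rewrite big_map -IH.
rewrite big_flatten big_map.
transitivity (\sum_(u <- evaluation x) \sum_(v <- P u) walks B w (Some v)).
  apply: eq_bigr => u _; rewrite -behead_B big_seq [RHS]big_seq.
  by apply: eq_bigr => -[|b v] // /size_B.
by rewrite evaluation_shift; apply: eq_bigr => x' _; rewrite IH.
Qed.
End Evaluation.

(** Clears one bit of the initial run of 1's, in every possible way. For 213 this run is the initial
    ascending run of [q]: a new maximum can only have ascending letters before it. *)
Fixpoint clear_leading (u : seq bool) : seq (seq bool) :=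
  if u is true :: v then (false :: v) :: map (cons true) (clear_leading v)
  else [::].

(** For 132, a new maximum may stand right behind a letter only if that letter is a right-to-left
    maximum. It then clears the bits of all letters before it, gets bit 1 itself and leaves the
    later bits alone. The word of 0's is the insertion at the end, where the new letter has no
    recorded bit. *)
Fixpoint clear_above (z : seq bool) : seq (seq bool) :=
  match z with
  | [::] => [:: [:: false]]
  | b :: z' => (if b then [:: false :: true :: z'] else [::])
               ++ map (cons false) (clear_above z')
  end.

Definition leading (u : seq bool) := clear_leading (true :: u).

Lemma walks_eq w : walks clear_above w None = walks leading w None.
Proof.
have sT u v : v \in clear_leading u -> size v = size u /\ all id v = false.
  elim: u v => [|[] u IH] v //=; rewrite inE => /orP[/eqP-> //|/mapP[v' /IH[<- <-] ->] //].
have sG u v : v \in clear_above u -> size v = (size u).+1 /\ all id v = false.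
  elim: u v => [|b u IH] v /=; first by rewrite inE => /eqP->.
  rewrite mem_cat => /orP[|/mapP[v' /IH[<- _] ->]//].
  by case: b => //; rewrite inE => /eqP->.
(* The operator [P] is forced by [behead_B]: it is [clear_above] with the first bit of each result
   dropped. *)
have [] := @walks_free clear_above
  (fun z => if z is b :: z' then (if b then [:: true :: z'] else [::]) ++ clear_above z' else [:: [::]])
  (fun u v h => (sG u v h).1) (fun u v h => (sG u v h).2) _ _ _ _ w => //.
- move=> h [|b u] /=; first by rewrite !big_seq1.
  by rewrite !big_cat big_map; case: b; rewrite ?big_seq1 ?big_nil.
- by move=> h u /=; rewrite big_cons.
- move=> h [|b u] /=; first by rewrite !big_seq1 /=.
  by rewrite !big_cat !big_map /=; case: b; rewrite ?big_seq1 ?big_nil.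
move=> -> _.
(* Dropping the first bit of [leading u] leaves [u] itself and the words of [clear_leading u], so
   [P] is the identity plus [clear_leading]. *)
have [] := @walks_free leading (fun u => u :: clear_leading u)
  (fun u v h => (sT _ v h).1) (fun u v h => (sT _ v h).2) _ _ _ _ w => //.
- by move=> h u; rewrite /leading /= !big_cons big_map.
- by move=> h u; rewrite big_cons.
move=> h u; rewrite big_cons.
(* Since [P] is the identity plus [clear_leading], [P_B] amounts to [leading] and [clear_leading]
   commuting. *)
have TD k : \sum_(v <- leading u) \sum_(v' <- clear_leading v) k v' =
            \sum_(v <- clear_leading u) \sum_(v' <- leading v) k v'.
  elim: u k => [|[] u IH] k; rewrite /leading /= ?big_cons ?big_map ?big_nil //.
by rewrite -TD -big_split /=; apply: eq_bigr => v _; rewrite big_cons.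
Qed.
End Walks.

(** * Insertions and placements *)

Fixpoint insertions (t : nat) (q : seq nat) : seq (seq nat) :=
  if q is x :: q' then (t :: q) :: map (cons x) (insertions t q')
  else [:: [:: t]].

Lemma mem_insertions t q s : t \notin q -> uniq s ->
  (s \in insertions t q) = (t \in s) && (filter (predC1 t) s == q).
Proof.
elim: q s => [|x q IH] s /=.
  move=> _; case: s => [//|y s] /= /andP[ys us].
  rewrite inE eqseq_cons inE; case: (eqVneq y t) => /= [yt|] .
    rewrite (eq_in_filter (a2 := predT)) ?filter_predT //=.
    by move=> z zs; apply/eqP => zt; move: ys; rewrite yt -zt zs.
  by rewrite andbF.
rewrite inE => /norP[tx tq]; case: s => [|y s] /=.
  by move=> _; apply/negbTE/negP => /mapP[].
case/andP=> ys us; rewrite inE eqseq_cons inE.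
case: (eqVneq y t) => [yt|yt] /=.
  rewrite yt (@eq_in_filter _ (predC1 t) predT) ?filter_predT; last first.
    by move=> z zs /=; apply/eqP => zt; move: ys; rewrite yt -zt zs.
  rewrite orbC; case: mapP => //= -[z _ [tx']].
  by rewrite tx' eqxx in tx.
rewrite eqseq_cons.
case: (eqVneq y x) => [->|xy] /=.
  by rewrite -IH // mem_map // => ? ? [].
by rewrite andbF; apply/negbTE/negP => /mapP[z _ [/eqP]]; rewrite (negPf xy).
Qed.

Lemma uniq_insertions t q : t \notin q -> uniq (insertions t q).
Proof.
elim: q => [|x q IH] //=; rewrite inE => /norP[tx /IH uq].
rewrite map_inj_uniq ?uq ?andbT; last by move=> ? ? [].
by apply/negP => /mapP[z _ [/eqP]]; rewrite (negPf tx).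
Qed.

Lemma perm_insertions t q s : s \in insertions t q -> perm_eq s (t :: q).
Proof.
elim: q s => [|x q IH] s /=; first by rewrite inE => /eqP->.
rewrite inE => /orP[/eqP->//|/mapP[s' /IH ps' ->]].
by rewrite -(perm_cons x) in ps'; rewrite (perm_trans ps') // (perm_catCA [:: x] [:: t]).
Qed.

Lemma count_cons_perm (T : eqType) (P : pred (seq T)) x s :
  (forall c, perm_eq c (x :: s) -> P c -> ohead c = Some x) ->
  count P (permutations (x :: s)) = count (fun c => P (x :: c)) (permutations s).
Proof.
move=> hP; rewrite -!size_filter -[RHS](size_map (cons x)).
apply/perm_size/uniq_perm.
- by rewrite filter_uniq ?permutations_uniq.
- by rewrite map_inj_uniq ?filter_uniq ?permutations_uniq // => ? ? [].
move=> c; rewrite mem_filter mem_permutations; apply/andP/mapP => [[Pc pc]|[c' + ->]].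
  move: (hP _ pc Pc); case: c Pc pc => //= y c Pc pc [yx]; subst y.
  by exists c => //; rewrite mem_filter Pc mem_permutations -(perm_cons x).
by rewrite mem_filter mem_permutations perm_cons => /andP[].
Qed.

Section Placements.
Variable top : nat -> nat -> seq nat -> bool.

Fixpoint good (ls c : seq nat) : bool :=
  match ls, c with
  | [::], [::] => true
  | l :: ls', x :: c' =>
    [&& x < l, top x l [seq y <- c' | y < l] & good ls' c']
  | _, _ => false
  end.

(* [q] lists the columns already met, in the order imposed on them, and [L] the
   columns still to come; [ls] gives the lengths of the remaining rows. *)
Definition placements (q L ls : seq nat) : nat :=
  count (fun c => (filter (mem q) c == q) && good ls c) (permutations (q ++ L)).

(** The words are classified by the order they impose on [t :: q]. *)
Lemma placements_insert t q L ls : uniq (q ++ t :: L) ->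
  placements q (t :: L) ls = \sum_(q' <- insertions t q) placements q' L ls.
Proof.
move=> u; have tq : t \notin q.
  by move: u; rewrite cat_uniq => /and3P[_ /norP[]].
have uq : uniq q by move: u; rewrite cat_uniq => /and3P[].
transitivity (\sum_(q' <- insertions t q)
   count (fun c => (filter (mem (t :: q)) c == q') && good ls c)
     (permutations (q ++ t :: L))); last first.
  rewrite big_seq [RHS]big_seq; apply: eq_bigr => q' /perm_insertions pq.
  rewrite /placements.
  have -> : count (fun c => (filter (mem q') c == q') && good ls c) (permutations (q' ++ L))
      = count (fun c => (filter (mem q') c == q') && good ls c) (permutations (q ++ t :: L)).
    apply/seq.permP/perm_permutations.
    apply: (perm_trans (y := (t :: q) ++ L)); first by rewrite perm_cat2r.
    by rewrite -[t :: L]cat1s perm_sym perm_catCA.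
  apply: eq_count => c; congr ((_ == _) && _); apply: eq_filter => y /=.
  by rewrite (perm_mem pq).
rewrite /placements.
rewrite -sum1_count big_mkcond.
under [RHS]eq_bigr do rewrite -sum1_count big_mkcond.
rewrite exchange_big /= big_seq [RHS]big_seq; apply: eq_bigr => c.
rewrite mem_permutations => pc.
case: (good ls c); last by rewrite andbF big1 // => ? _; rewrite andbF.
rewrite andbT; under eq_bigr do rewrite andbT.
rewrite -big_mkcond /= sum1_count.
have uc : uniq c by rewrite (perm_uniq pc).
rewrite (eq_count (a2 := pred1 (filter (mem (t :: q)) c))); last by move=> z /=; rewrite eq_sym.
rewrite count_uniq_mem ?uniq_insertions // mem_insertions ?filter_uniq //.
rewrite mem_filter /= inE eqxx (perm_mem pc) mem_cat inE eqxx orbT /=.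
rewrite -filter_predI; have -> : filter (predI (predC1 t) (mem (t :: q))) c = filter (mem q) c.
  by apply: eq_filter => z /=; rewrite inE; case: eqVneq => //= ->; rewrite (negPf tq).
by case: eqP.
Qed.

(** The top row reaches no column of [L], so its 1 lies in a column of [x :: q]; being the first
    letter of the whole word it is also the first of that subword, namely [x]. The letters below [l]
    that remain are exactly [q]. *)
Lemma placements_pop x q L l ls : uniq (x :: q ++ L) ->
  all (fun y => y < l) (x :: q) -> all (fun y => l <= y) L ->
  placements (x :: q) L (l :: ls) = top x l q * placements q L ls.
Proof.
move=> /= /andP[xqL u] /andP[xl ql] Ll; rewrite /placements /= count_cons_perm.
  rewrite -sum1_count big_mkcond -sum1_count [in RHS]big_mkcond big_distrr /=.
  rewrite big_seq [RHS]big_seq; apply: eq_bigr => c; rewrite mem_permutations => pc.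
  rewrite inE eqxx /= xl eqseq_cons eqxx /=.
  rewrite (@eq_in_filter _ _ (mem q)); last first.
    move=> y yc /=; rewrite inE; case: eqVneq => //= yx; move: xqL.
    by rewrite -yx -(perm_mem pc) yc.
  have [<-|] /= := eqVneq (filter (mem q) c) q; last by rewrite muln0.
  have -> : [seq y <- c | y < l] = filter (mem q) c.
    apply: eq_in_filter => y; rewrite (perm_mem pc) mem_cat /=.
    have [yq|_] /= := boolP (y \in q); first by rewrite (allP ql).
    by move/(allP Ll); rewrite leqNgt => /negPf.
  by case: top; case: good.
case=> [|y c] /=; first by move/perm_size.
move=> pc /andP[/eqP h /and3P[yl _ _]].
have : y \in x :: q ++ L by rewrite -(perm_mem pc) inE eqxx.
rewrite -cat_cons mem_cat => /orP[yq|/(allP Ll)]; last by rewrite leqNgt yl.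
by move: h; rewrite yq => -[->].
Qed.

End Placements.

Lemma subseq_filter2 (T : eqType) (a b : pred T) s :
  (forall x, x \in s -> a x -> b x) -> subseq (filter a s) (filter b s).
Proof.
move=> h; rewrite -(@eq_in_filter _ (predI a b)) ?filter_predI ?filter_subseq //.
by move=> x xs /=; case ax: (a x) => //=; rewrite h.
Qed.

(** * Walks up to the first diamond column and forced insertions beyond it *)

Section Phases.
Variable top : nat -> nat -> seq nat -> bool.

Fixpoint all_tails (tok : nat -> seq nat -> bool) (q : seq nat) : bool :=
  if q is x :: q' then tok x q' && all_tails tok q' else true.

(** Every letter of [q] is smaller than every remaining row length, so the truncations [y < l] made
    by [good] remove none of them and the condition is inherited by the subword. *)
Lemma good_all_tails (tok : nat -> seq nat -> bool) q ls c :
  (forall x (s s' : seq nat), subseq s' s -> tok x s -> tok x s') ->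
  (forall x l s, l \in ls -> top x l s -> tok x s) ->
  (forall l, l \in ls -> all (fun y => y < l) q) ->
  good top ls c -> all_tails tok (filter (mem q) c).
Proof.
move=> mono ht; elim: ls c ht => [|l ls IH] [|x c] //= ht hq /and3P[xl tx gc].
have IHc : all_tails tok (filter (mem q) c).
  apply: IH => //; first by move=> ? ? ? h; apply: ht; rewrite inE h orbT.
  by move=> ? h; apply: hq; rewrite inE h orbT.
case: ifP => //= xq; rewrite IHc andbT.
apply: mono (ht _ _ _ (mem_head _ _) tx).
apply: subseq_filter2 => y _ yq.
by have /allP/(_ _ yq) := hq _ (mem_head _ _).
Qed.

Lemma placements_not_all_tails (tok : nat -> seq nat -> bool) q L ls :
  (forall x (s s' : seq nat), subseq s' s -> tok x s -> tok x s') ->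
  (forall x l s, l \in ls -> top x l s -> tok x s) ->
  (forall l, l \in ls -> all (fun y => y < l) q) ->
  ~~ all_tails tok q -> placements top q L ls = 0.
Proof.
move=> mono ht hq ncq; rewrite /placements (eq_count (a2 := pred0)) ?count_pred0 //.
move=> c /=; apply/negbTE/negP => /andP[/eqP cq gc].
by move: (good_all_tails mono ht hq gc); rewrite cq (negPf ncq).
Qed.

Lemma placements_no_row q L : placements top q L [::] = nilp (q ++ L).
Proof.
rewrite /placements; case E: (q ++ L) => [|x s].
  by move: E; case: q => //= ->.
rewrite -[RHS]/0 -[RHS](count_pred0 (permutations (x :: s))).
apply: eq_in_count => c; rewrite mem_permutations => /perm_size.
by case: c => //= y c _; rewrite andbF.
Qed.

Lemma placements_empty L l ls : all (fun y => l <= y) L ->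
  placements top [::] L (l :: ls) = 0.
Proof.
move=> Ll; rewrite /placements /= -(count_pred0 (permutations L)).
apply: eq_in_count => c; rewrite mem_permutations => pc /=.
case: c pc => [//|y c] pc /=.
have /(allP Ll) : y \in L by rewrite -(perm_mem pc) inE eqxx.
by rewrite leqNgt => /negPf->; rewrite andbF.
Qed.

(** Two nested fixpoints, because a step consumes an element of only one of the two lists. *)
Fixpoint board_path (ls : seq nat) : seq nat -> seq bool :=
  fix board_path_ls L :=
  match ls, L with
  | [::], [::] => [::]
  | [::], _ :: L' => true :: board_path_ls L'
  | l :: ls', [::] => false :: board_path ls' [::]
  | l :: ls', t :: L' => if t < l then true :: board_path_ls L' else false :: board_path ls' L
  end.

(* The number of completions when all insertions are forced: [m] columns are
   pending, and a row of length [l] may be filled only if [ct l]. *)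
Fixpoint forced (ct : nat -> bool) (ls : seq nat) : seq nat -> nat -> bool :=
  fix forced_ls L m :=
  match ls, L with
  | [::], _ => nilp L && (m == 0)
  | l :: ls', [::] => [&& m > 0, ct l & forced ct ls' [::] m.-1]
  | l :: ls', t :: L' =>
    if t < l then forced_ls L' m.+1 else [&& m > 0, ct l & forced ct ls' L m.-1]
  end.

Section Before.
Variables (tok : nat -> seq nat -> bool) (o : nat) (Lb lsb : seq nat).
Variables (B : seq bool -> seq (seq bool)) (st : seq nat -> option (seq bool)).
Variable g : nat -> nat.
Hypothesis tok_mono : forall x (s s' : seq nat), subseq s' s -> tok x s -> tok x s'.
Hypothesis top_tok : forall x l s, top x l s -> tok x s.
Hypothesis top_before : forall x l q, l <= o -> x < l -> uniq (x :: q) ->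
  all (fun y => y < l) q -> tok x q -> top x l q.
Hypothesis st_insert : forall (F : option (seq bool) -> nat) t q,
  all (fun y => y < t) q -> uniq q -> all_tails tok q ->
  \sum_(q' <- insertions t q | all_tails tok q') F (st q') =
  if st q is Some u then F (Some (true :: u)) + \sum_(v <- B u) F (Some v)
  else F (Some [::]).
Hypothesis st_nil : st [::] = None.
Hypothesis st_pop : forall x q, all_tails tok (x :: q) -> uniq (x :: q) ->
  match st (x :: q) with
  | None => False
  | Some [::] => st q = None
  | Some (_ :: u) => st q = Some u
  end.
Hypothesis lsb_gt : all (fun l => o < l) lsb.
Hypothesis Lb_gt : all (fun y => o < y) Lb.
Hypothesis last_phase : forall q, all (fun y => y < o) q -> uniq (q ++ Lb) ->
  all_tails tok q -> placements top q Lb lsb = final g (st q).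

(** The rows [ls] end at or before the diamond column [o], so [top] reduces to [tok] on them. What
    happens beyond [o], with columns [Lb] and rows [lsb], enters only through [last_phase], as the
    weight [g] of the state reached. *)
Lemma placements_walks ls L q :
  sorted leq ls -> sorted ltn L -> all (fun l => l <= o) ls ->
  all (fun y => y < o) L -> uniq (q ++ L ++ Lb) -> all_tails tok q ->
  all (fun y => y < o) q ->
  (forall l, l \in ls -> all (fun y => y < l) q) ->
  (forall t, t \in L -> all (fun y => y < t) q) ->
  placements top q (L ++ Lb) (ls ++ lsb) = walks g B (board_path ls L) (st q).
Proof.
have insert t q0 L0 ls0 w :
    t < o -> all (fun y => y < t) q0 -> uniq (q0 ++ t :: L0) -> all_tails tok q0 ->
    (forall l, l \in ls0 -> all (fun y => y < l) (t :: q0)) ->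
    (forall q', perm_eq q' (t :: q0) -> all_tails tok q' ->
       placements top q' L0 ls0 = walks g B w (st q')) ->
    placements top q0 (t :: L0) ls0 = walks g B (true :: w) (st q0).
  move=> to qt u cq hl IH; rewrite placements_insert // (bigID (all_tails tok)) /=.
  rewrite addnC big1_seq ?add0n; last first.
    move=> q' /andP[nc /perm_insertions pq].
    apply: placements_not_all_tails nc => //; first by move=> ? ? ? _; apply: top_tok.
    by move=> l /hl; rewrite (perm_all _ pq).
  have uq : uniq q0 by move: u; rewrite cat_uniq => /and3P[].
  rewrite [RHS]/= -(st_insert (walks g B w) qt uq cq).
  rewrite big_seq_cond [RHS]big_seq_cond; apply: eq_bigr => q' /andP[/perm_insertions pq cq'].
  exact: IH.
have sub t L0 : sorted ltn (t :: L0) -> all (fun y => t < y) L0.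
  by move=> /= /order_path_min; apply; apply: ltn_trans.
have lsbt t : t < o -> forall l, l \in lsb -> t < l.
  by move=> to l /(allP lsb_gt); apply: ltn_trans.
elim: ls L q => [|l ls IHls].
  elim=> [|t L IH] q _ sL _ oL u cq oq _ qL.
    by rewrite /=; apply: last_phase.
  have /andP[to oL'] : (t < o) && all (fun y => y < o) L := oL.
  have qt := qL _ (mem_head _ _).
  rewrite cat_cons (_ : board_path _ _ = true :: board_path [::] L) //; apply: insert => //.
    move=> l /= ll; rewrite lsbt //=; apply/allP => y yq.
    by apply: lsbt ll; apply: (allP oq).
  move=> q' pq cq'; apply: IH => //.
  - exact: path_sorted sL.
  - by rewrite -(perm_uniq (_ : perm_eq (q ++ (t :: L) ++ Lb) _)) // cat_cons -cat1s perm_catCA catA perm_cat2r perm_sym.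
  - by rewrite (perm_all _ pq) /= to.
  move=> t' t'L; rewrite (perm_all _ pq) /= (allP (sub _ _ sL)) //=.
  by apply: qL; rewrite inE t'L orbT.
have pop q L : sorted leq (l :: ls) -> sorted ltn L -> all (fun l => l <= o) (l :: ls) ->
  all (fun y => y < o) L -> uniq (q ++ L ++ Lb) -> all_tails tok q ->
  all (fun y => y < o) q ->
  (forall l', l' \in l :: ls -> all (fun y => y < l') q) ->
  (forall t, t \in L -> all (fun y => y < t) q) ->
  all (fun y => l <= y) L ->
  placements top q (L ++ Lb) ((l :: ls) ++ lsb) = walks g B (false :: board_path ls L) (st q).
  move=> sls sL /= /andP[lo ols] oL u cq oq hls hL lL.
  have lLb : all (fun y => l <= y) (L ++ Lb).
    rewrite all_cat lL /=; apply: sub_all Lb_gt => y oy; exact: leq_trans lo (ltnW oy).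
  case: q u cq oq hls hL => [|x q] u cq oq hls hL.
    by rewrite placements_empty // st_nil.
  have [xl ql] : x < l /\ all (fun y => y < l) q by apply/andP/(hls l); rewrite inE eqxx.
  have uxq : uniq (x :: q) by move: u; rewrite cat_uniq => /andP[].
  rewrite placements_pop //; last by rewrite /= xl.
  move: (cq) => /= /andP[tx cq'].
  rewrite top_before // mul1n IHls //.
  - by move: (st_pop cq uxq); case: (st (x :: q)) => [[|b u']|] //= ->.
  - exact: path_sorted sls.
  - by move: u => /andP[].
  - by move: oq => /andP[].
  - by move=> l' l'ls; move: (hls l'); rewrite inE l'ls orbT => /(_ isT)/andP[].
  - by move=> t /hL/andP[].
elim=> [|t L IH] q sls sL ols oL u cq oq hls hL; first exact: pop.
rewrite (_ : board_path _ _ = if t < l then true :: board_path (l :: ls) L else false :: board_path ls (t :: L)) //.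
case: ltnP => [tl|lt]; last first.
  apply: pop => //=; rewrite lt /=.
  by apply: sub_all (sub _ _ sL) => y /ltnW; apply: leq_trans.
have /andP[to oL'] : (t < o) && all (fun y => y < o) L := oL.
have qt := hL _ (mem_head _ _).
have tls l' : l' \in l :: ls -> t < l'.
  rewrite inE => /orP[/eqP->//|l'ls]; apply: leq_trans tl _.
  by have /allP := order_path_min leq_trans sls; apply.
rewrite cat_cons; apply: insert => //.
  move=> l'; rewrite mem_cat => /orP[ll|ll] /=.
    by rewrite tls //=; apply: hls.
  by rewrite lsbt //=; apply/allP => y yq; apply: lsbt ll; apply: (allP oq).
move=> q' pq cq'; apply: IH => //.
- exact: path_sorted sL.
- by rewrite -(perm_uniq (_ : perm_eq (q ++ (t :: L) ++ Lb) _)) // cat_cons -cat1s perm_catCA catA perm_cat2r perm_sym.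
- by rewrite (perm_all _ pq) /= to.
- by move=> l' l'ls; rewrite (perm_all _ pq) /= tls //; apply: hls.
move=> t' t'L; rewrite (perm_all _ pq) /= (allP (sub _ _ sL)) //=.
by apply: hL; rewrite inE t'L orbT.
Qed.
End Before.

Section After.
Variables (tok : nat -> seq nat -> bool) (o : nat) (H : seq nat) (ct : nat -> bool).
Hypothesis tok_mono : forall x (s s' : seq nat), subseq s' s -> tok x s -> tok x s'.
Hypothesis top_after : forall x l q, o < l -> x < l -> uniq (x :: q) -> x \notin H ->
  all (fun y => (y < l) && (y \notin H)) q -> all_tails tok q -> top x l q = tok x q && ct l.
Hypothesis forced_insertion : forall t q, o < t -> all (fun y => (y < t) && (y \notin H)) q ->
  uniq q -> count (all_tails tok) (insertions t q) = all_tails tok q.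

(** By [forced_insertion] an admissible [q] has exactly one admissible insertion and an inadmissible
    one has none. The sum over insertions thus collapses, and of [q] only its admissibility and its
    size matter. *)
Lemma placements_forced ls L q :
  sorted leq ls -> sorted ltn L -> all (fun l => o < l) ls ->
  all (fun y => (o < y) && (y \notin H)) L -> uniq (q ++ L) -> all (fun y => y \notin H) q ->
  (forall l, l \in ls -> all (fun y => y < l) q) ->
  (forall t, t \in L -> all (fun y => y < t) q) ->
  placements top q L ls = all_tails tok q * forced ct ls L (size q).
Proof.
have sub t L0 : sorted ltn (t :: L0) -> all (fun y => t < y) L0.
  by move=> /= /order_path_min; apply; apply: ltn_trans.
elim: ls L q => [|l ls IHls].
  by move=> [|t L] [|x q] *; rewrite placements_no_row //= ?muln0 ?muln1.
have pop q L : sorted leq (l :: ls) -> sorted ltn L -> all (fun l => o < l) (l :: ls) ->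
  all (fun y => (o < y) && (y \notin H)) L -> uniq (q ++ L) -> all (fun y => y \notin H) q ->
  (forall l', l' \in l :: ls -> all (fun y => y < l') q) ->
  (forall t, t \in L -> all (fun y => y < t) q) ->
  all (fun y => l <= y) L ->
  placements top q L (l :: ls)
  = all_tails tok q * [&& size q > 0, ct l & forced ct ls L (size q).-1].
  move=> sls sL /= /andP[lo ols] oL u oq hls hL lL.
  case: q u oq hls hL => [|x q] u oq hls hL.
    by rewrite placements_empty.
  have [xl ql] : x < l /\ all (fun y => y < l) q by apply/andP/(hls l); rewrite inE eqxx.
  have uxq : uniq (x :: q) by move: u; rewrite cat_uniq => /andP[].
  have /andP[xo qo] : (x \notin H) && all (fun y => y \notin H) q := oq.
  rewrite placements_pop //; last by rewrite /= xl.
  rewrite IHls //.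
  - have [cq|] := boolP (all_tails tok q); last by rewrite /= => /negPf->; rewrite andbF muln0.
    rewrite top_after //; last by apply/allP => y yq; rewrite (allP ql) ?(allP qo).
    by rewrite /= cq; case: tok; case: ct => //=; rewrite ?mul1n.
  - exact: path_sorted sls.
  - by move: u => /andP[].
  - by move=> l' l'ls; move: (hls l'); rewrite inE l'ls orbT => /(_ isT)/andP[].
  - by move=> t /hL/andP[].
elim=> [|t L IH] q sls sL ols oL u oq hls hL; first exact: pop.
rewrite (_ : forced _ _ _ _ = if t < l then forced ct (l :: ls) L (size q).+1 else
   [&& size q > 0, ct l & forced ct ls (t :: L) (size q).-1]) //.
case: ltnP => [tl|lt]; last first.
  apply: pop => //=; rewrite lt /=.
  by apply: sub_all (sub _ _ sL) => y /ltnW; apply: leq_trans.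
have /andP[/andP[to tH] oL'] := oL.
have qt := hL _ (mem_head _ _).
have tls l' : l' \in l :: ls -> t < l'.
  rewrite inE => /orP[/eqP->//|l'ls]; apply: leq_trans tl _.
  by have /allP := order_path_min leq_trans sls; apply.
have uq : uniq q by move: u; rewrite cat_uniq => /andP[].
rewrite placements_insert // -(@forced_insertion t) //; last first.
  by apply/allP => y yq; rewrite (allP qt) ?(allP oq).
rewrite -sum1_count [in RHS]big_mkcond big_distrl big_seq [RHS]big_seq.
apply: eq_bigr => q' /perm_insertions pq; rewrite IH //.
- by rewrite (perm_size pq); case: all_tails.
- exact: path_sorted sL.
- by rewrite -(perm_uniq (_ : perm_eq (q ++ (t :: L)) _)) // -cat1s perm_catCA catA perm_cat2r perm_sym.
- by rewrite (perm_all _ pq) /= tH.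
- by move=> l' l'ls; rewrite (perm_all _ pq) /= tls //; apply: hls.
move=> t' t'L; rewrite (perm_all _ pq) /= (allP (sub _ _ sL)) //=.
by apply: hL; rewrite inE t'L orbT.
Qed.
End After.
End Phases.

(** * The two local conditions *)

(** Two diamonds and a single 1 form any pattern of length three, whatever the order of their
    columns, as soon as all these columns meet the row of the 1. This is why both patterns share the
    condition. *)
Definition hole_pairs_ok (H : seq nat) (x l : nat) : bool :=
  pairwise (fun o1 o2 => ~~ [|| o2 < x, (o1 < x < o2) && (o2 < l)
                              | (x < o1) && (o2 < l)]) H.

(* The conditions on a row of length [l] with its 1 in column [x], where [q] lists
   the columns left of [l] that are used by the rows below, for this row to be the
   topmost non-diamond row of no occurrence. *)
Definition top312 (H : seq nat) (x l : nat) (q : seq nat) : bool :=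
  [&& pairwise (fun y z => ~~ (x < z < y)) q,
      all (fun o => all (fun y =>
        ~~ [|| x < o < y, (x < y < o) && (o < l) | o < y < x]) q) H
    & hole_pairs_ok H x l].

Definition top231 (H : seq nat) (x l : nat) (q : seq nat) : bool :=
  [&& pairwise (fun y z => ~~ (y < x < z)) q,
      all (fun o => all (fun y =>
        ~~ [|| o < x < y, x < o < y | (y < x < o) && (o < l)]) q) H
    & hole_pairs_ok H x l].

(** No 132, respectively 213, begins with [x] and continues in the given word. *)
Definition tok312 (x : nat) := pairwise (fun y z => ~~ (x < z < y)).
Definition tok231 (x : nat) := pairwise (fun y z => ~~ (y < x < z)).

(* [lia] takes very long when such hypotheses are in the context. *)
Ltac order_lia :=
  repeat match goal with
  | X : is_true (all _ _) |- _ => clear X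
  | X : is_true (all_tails _ _) |- _ => clear X
  | X : is_true (pairwise _ _) |- _ => clear X
  | X : is_true (uniq _) |- _ => clear X
  | X : is_true (_ \in _) |- _ => clear X
  | X : is_true (_ \notin _) |- _ => clear X
  | X : is_true (path _ _ _) |- _ => clear X
  | X : is_true (sorted _ _) |- _ => clear X
  | X : is_true (tok312 _ _) |- _ => clear X
  | X : is_true (tok231 _ _) |- _ => clear X
  | X : forall _, _ |- _ => clear X
  | X : @eq (seq _) _ _ |- _ => clear X
  | X : @eq bool (all_tails _ _) _ |- _ => clear X
  | X := _ : _ |- _ => clearbody X
  end; lia.

Fixpoint bits (b : nat -> seq nat -> bool) (q : seq nat) : seq bool :=
  match q with
  | x :: (_ :: _) as q' => b x q' :: bits b q'
  | _ => [::]
  end.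

Definition state b (q : seq nat) : option (seq bool) :=
  if q is [::] then None else Some (bits b q).

Definition bit312 (x : nat) := all (fun y => y < x).
Definition bit231 (x : nat) (q : seq nat) := x < head 0 q.

Lemma size_bits b x q : size (bits b (x :: q)) = size q.
Proof. by elim: q x => //= y q IH x; rewrite (IH y). Qed.

Lemma state_pop b x q :
  match state b (x :: q) with
  | None => False
  | Some [::] => state b q = None
  | Some (_ :: u) => state b q = Some u
  end.
Proof. by case: q. Qed.

(** If [y] tolerates [t], each letter [z] behind [t] is below [y]; as no such [z] lies between [x]
    and [y], it is not above [x] either. So the letter immediately before [t] decides for all
    earlier ones. *)
Lemma insert312_tok x y t s s' :
  s' \in insertions t s -> all (fun z => z < t) s ->  y \notin s ->
  all (fun z => ~~ (x < z < y)) s -> tok312 x s -> tok312 y s' -> tok312 x s'.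
Proof.
elim: s s' => [|w s IH] s' /=; first by rewrite inE => /eqP->.
rewrite inE negb_or => /orP[/eqP->|/mapP[s1 s1i ->]].
  move=> /andP[wt st] /andP[yw ys] /andP[xwy xsy] /= /andP[-> ->] /=.
  case/and3P => /andP[ytw yts] _ _; rewrite andbT; apply/andP; split; first by order_lia.
  apply/allP => z zs; move: (allP st z zs) (allP xsy z zs) (allP yts z zs).
  have : y != z by apply: contraNneq ys => ->.
  order_lia.
move=> /andP[wt st] /andP[yw ys] /andP[xwy xsy] /= /andP[xw xs] /andP[yw1 ys1].
rewrite (IH s1) // andbT (perm_all _ (perm_insertions s1i)) /= xw andbT.
order_lia.
Qed.

(** If [y] tolerates [t], the letters of [s] before [t] exceed [y], hence also the smaller [x]. *)
Lemma insert231_tok x y t s s' :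
  s' \in insertions t s -> all (fun z => z < t) s -> x < y < t -> y \notin s ->
  tok231 x s -> tok231 y s' -> tok231 x s'.
Proof.
elim: s s' => [|w s IH] s' /=; first by rewrite inE => /eqP->.
rewrite inE negb_or => /orP[/eqP->|/mapP[s1 s1i ->]].
  move=> /andP[wt st] xy /andP[yw ys] /= /andP[-> ->] /=.
  case/and3P => /andP[ytw yts] _ _; rewrite andbT; apply/andP; split; first by order_lia.
  apply/allP => z zs; move: (allP st z zs) (allP yts z zs); order_lia.
move=> /andP[wt st] xy /andP[yw ys] /= /andP[xw xs] /andP[yw1 ys1].
rewrite (IH s1) // andbT (perm_all _ (perm_insertions s1i)) /= xw andbT.
move: yw1; rewrite (perm_all _ (perm_insertions s1i)) /= => /andP[]; order_lia.
Qed.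

Lemma tok312_max x q : all (fun y => y < x) q -> tok312 x q.
Proof.
elim: q => //= y q IH /andP[yx qx]; rewrite -/(tok312 x q) IH // andbT.
by apply: sub_all qx => z; order_lia.
Qed.

Lemma tok231_max x q : all (fun y => y < x) q -> tok231 x q.
Proof.
elim: q => //= y q IH /andP[yx qx]; rewrite -/(tok231 x q) IH // andbT.
by apply: sub_all qx => z; order_lia.
Qed.

(** The insertion in front is always admissible and is the operator [A]; the later places, taken
    from left to right, are listed by [clear_above] in the same order. *)
Lemma insert312 t q x : all (fun y => y < t) (x :: q) -> uniq (x :: q) ->
  all_tails tok312 (x :: q) ->
  [seq bits bit312 q' | q' <- insertions t (x :: q) & all_tails tok312 q']
  = (true :: bits bit312 (x :: q)) :: clear_above (bits bit312 (x :: q)).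
Proof.
elim: q x => [|y q IH] x qt ux cx.
  by have /andP[xt _] := qt; rewrite /= xt ltnNge (ltnW xt).
have [qt' ux' cx'] : [/\ all (fun y => y < t) (y :: q), uniq (y :: q) & all_tails tok312 (y :: q)].
  by split; [case/andP: qt | case/andP: ux | case/andP: cx].
move: (IH y qt' ux' cx').
rewrite [insertions t (x :: _)]/= [insertions t (y :: _)]/=.
set r := [seq y :: i | i <- insertions t q].
have xt : x < t by move: qt => /andP[].
have c1 : all_tails tok312 (t :: x :: y :: q) by apply/andP; split; [apply: tok312_max|].
have c2 : all_tails tok312 (t :: y :: q) by apply/andP; split; [apply: tok312_max|].
have fc (z : seq nat) u : filter (all_tails tok312) (z :: u) =
    if all_tails tok312 z then z :: filter (all_tails tok312) u
    else filter (all_tails tok312) u by [].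
have fcT z u : all_tails tok312 z ->
  filter (all_tails tok312) (z :: u) = z :: filter (all_tails tok312) u by move=> /= ->.
rewrite (fcT _ _ c2) map_cons => /(congr1 behead) IHr0.
have {IHr0} IHr : [seq bits bit312 q' | q' <- r & all_tails tok312 q']
  = clear_above (bits bit312 (y :: q)) := IHr0.
rewrite (fcT _ _ c1) map_cons fc.
(* A later letter [z] above [x] would make [x], [t], [z] a 132; without one, [x] is a right-to-left
   maximum. *)
have bt : bit312 x (y :: q) = all_tails tok312 (x :: t :: y :: q).
  have /andP[tx _] := cx.
  rewrite -[RHS]/(tok312 x (t :: y :: q) && all_tails tok312 (t :: y :: q)) c2 andbT.
  rewrite -[RHS]/(all (fun z => ~~ (x < z < t)) (y :: q) && tok312 x (y :: q)) tx andbT.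
  apply: eq_in_all => z zq; have := allP qt' z zq.
  have : z != x by apply: contraTneq zq => ->; case/andP: ux.
  order_lia.
have fr : filter (all_tails tok312) (map (cons x) r) = map (cons x) (filter (all_tails tok312) r).
  rewrite filter_map; congr map; apply: eq_in_filter => _ /mapP[s si ->].
  rewrite [LHS]/= -/(all_tails tok312 (y :: s)).
  have [cs|] := boolP (all_tails tok312 (y :: s)); last by rewrite andbF.
  rewrite andbT; have /andP[yt qt1] := qt'; have /andP[yq uq] := ux'.
  have /andP[/andP[xyq xq] _] := cx.
  have /andP[ty _] := cs.
  rewrite (@insert312_tok x y t q) // andbT (perm_all _ (perm_insertions si)) /= xyq andbT.
  order_lia.
rewrite -bt fr (fun_if (map _)) map_cons -map_comp.
have -> : [seq (bits bit312 \o cons x) i | i <- r & all_tails tok312 i]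
   = [seq false :: bits bit312 i | i <- r & all_tails tok312 i].
  apply/eq_in_map => s0; rewrite mem_filter => /andP[_ /mapP[s si ->{s0}]] /=.
  congr (_ :: _); rewrite /bit312 /= (perm_all _ (perm_insertions si)) /=.
  by rewrite [t < x]ltnNge (ltnW xt) andbF.
rewrite map_comp IHr.
have b1 : bit312 t (x :: y :: q) := qt.
have b2 : bit312 t (y :: q) := qt'.
have b3 : bit312 x (t :: y :: q) = false by rewrite /bit312 /= [t < x]ltnNge (ltnW xt).
have -> : bits bit312 (t :: x :: y :: q) = true :: bits bit312 (x :: y :: q).
  by rewrite -[true]b1.
have -> : bits bit312 (x :: t :: y :: q) = [:: false, true & bits bit312 (y :: q)].
  by rewrite -[true]b2 -[false]b3.
have -> : bits bit312 (x :: y :: q) = bit312 x (y :: q) :: bits bit312 (y :: q) by [].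
by move: (bit312 x (y :: q)) (bits bit312 (y :: q)) => [].
Qed.

(** With [k] leading ascents, [t] can go behind each of the first [k+1] letters. Behind the last of
    them it only adds one leading ascent; behind an earlier one it also turns the ascent there into
    a descent, which after the shift by one is a cleared bit. *)
Lemma insert231 (F : seq bool -> nat) t q x :
  all (fun y => y < t) (x :: q) -> uniq (x :: q) -> all_tails tok231 (x :: q) ->
  \sum_(q' <- map (cons x) (insertions t q) | all_tails tok231 q') F (bits bit231 q')
  = F (true :: bits bit231 (x :: q))
    + \sum_(v <- clear_leading (bits bit231 (x :: q))) F (true :: v).
Proof.
elim: q x F => [|y q IH] x F qt ux cx.
  by have /andP[xt _] := qt; rewrite big_cons big_nil big_nil /= /bit231 /= xt.
have [qt' ux' cx'] : [/\ all (fun y => y < t) (y :: q), uniq (y :: q) & all_tails tok231 (y :: q)].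
  by split; [case/andP: qt | case/andP: ux | case/andP: cx].
have xt : x < t by move: qt => /andP[].
have yt : y < t by move: qt' => /andP[].
have c1 : all_tails tok231 (x :: t :: y :: q).
  apply/andP; split; last by apply/andP; split; [apply: tok231_max|].
  have /andP[tx _] := cx; rewrite /tok231 pairwise_cons [pairwise _ _]tx andbT.
  by apply/allP => z /(allP qt'); order_lia.
rewrite [insertions t _]/= map_cons big_cons c1.
rewrite -[bits _ (x :: t :: _)]/((x < t) :: (t < y) :: bits bit231 (y :: q)).
rewrite -[bits _ (x :: y :: _)]/((x < y) :: bits bit231 (y :: q)).
rewrite xt [t < y]ltnNge (ltnW yt) /=.
have bt s : s \in insertions t q -> all_tails tok231 (x :: y :: s) = (x < y) && all_tails tok231 (y :: s).
  move=> si; rewrite [LHS]/= -/(all_tails tok231 (y :: s)).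
  have [cs|] := boolP (all_tails tok231 (y :: s)); last by rewrite !andbF.
  rewrite !andbT; have /andP[yq uq] := ux'.
  have /andP[/andP[xyq xq] _] := cx.
  have /andP[ty _] := cs.
  rewrite (perm_all _ (perm_insertions si)) /= xyq andbT.
  have : x != y by move: ux; rewrite /= inE negb_or => /andP[/andP[]].
  case: (ltngtP x y) => // xy _.
    have xyt : x < y < t by rewrite xy.
    by have /andP[_ qt1] := qt'; rewrite (insert231_tok si qt1 xyt yq xq ty).
  by rewrite xt.
rewrite !big_map big_seq_cond.
case: ltngtP (bt) => xy {}bt.
- rewrite big_cons addnCA; congr (_ + _).
  transitivity (\sum_(q' <- map (cons y) (insertions t q) | all_tails tok231 q')
     F (true :: bits bit231 q')).
    rewrite big_map [RHS]big_seq_cond; apply: eq_big => s.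
      by case: (boolP (s \in _)) => // /bt ->.
    by case/andP=> si _; rewrite /= /bit231 /= xy.
  by rewrite (IH y (fun v => F (true :: v))) // big_map.
- rewrite big_nil big1 // => s /andP[si]; by rewrite bt.
- by move: ux; rewrite xy /= inE eqxx.
Qed.

Lemma state_sum (F : option (seq bool) -> nat) b t q tok :
  \sum_(q' <- insertions t q | all_tails tok q') F (state b q') =
  \sum_(q' <- insertions t q | all_tails tok q') F (Some (bits b q')).
Proof.
rewrite big_seq_cond [RHS]big_seq_cond; apply: eq_bigr => q' /andP[/perm_insertions pq _].
by case: q' pq => // /perm_size.
Qed.

Lemma state_insert312 (F : option (seq bool) -> nat) t q :
  all (fun y => y < t) q -> uniq q -> all_tails tok312 q ->
  \sum_(q' <- insertions t q | all_tails tok312 q') F (state bit312 q') =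
  if state bit312 q is Some u
  then F (Some (true :: u)) + \sum_(v <- clear_above u) F (Some v)
  else F (Some [::]).
Proof.
case: q => [|x q] qt uq cq; first by rewrite big_cons big_nil addn0.
rewrite state_sum -big_filter.
rewrite -(big_map (bits bit312) xpredT (fun v => F (Some v))) insert312 //.
by rewrite big_cons.
Qed.

(** The term for [A] comes from the insertion at the end of the initial ascending run, while the
    insertion in front, which adds a bit 0, belongs to [leading]. For 132 the roles differ: there
    [A] is the insertion in front. *)
Lemma state_insert231 (F : option (seq bool) -> nat) t q :
  all (fun y => y < t) q -> uniq q -> all_tails tok231 q ->
  \sum_(q' <- insertions t q | all_tails tok231 q') F (state bit231 q') =
  if state bit231 q is Some u
  then F (Some (true :: u)) + \sum_(v <- leading u) F (Some v)
  else F (Some [::]).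
Proof.
case: q => [|x q] qt uq cq; first by rewrite big_cons big_nil addn0.
rewrite state_sum [insertions _ _]/= big_cons ifT; last first.
  by apply/andP; split; [apply: tok231_max|].
rewrite (insert231 (fun v => F (Some v))) // /state.
rewrite /leading [clear_leading (true :: _)]/= big_cons big_map /=.
have /andP[xt _] := qt; rewrite {1}/bit231 /= ltnNge (ltnW xt) /=.
order_lia.
Qed.

(* Whether [x] may stand above [y] in rows that extend beyond the diamond column [o]. *)
Definition rel312 (o x y : nat) := ~~ [|| x < o < y, x < y < o | o < y < x].
Definition rel231 (o x y : nat) := ~~ [|| o < x < y, x < o < y | y < x < o].

(** To the left of [o] the relation [rel312] says that [q] decreases, so that each of its letters is
    a right-to-left maximum. *)
Lemma bits312_all o q : all (fun y => y < o) q -> uniq q ->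
  pairwise (rel312 o) q = all id (bits bit312 q).
Proof.
elim: q => [|x q IH] //= /andP[xo qo] /andP[xq uq].
case: q xq qo uq IH => [|y q] // xq qo uq IH.
rewrite IH //; congr (_ && _); apply: eq_in_all => z zq.
have : z != x by apply: contraNneq xq => <-.
have := allP qo z zq; rewrite /rel312; order_lia.
Qed.

(** To the left of [o] the relation [rel231] says that [q] increases, which its consecutive ascents
    express. *)
Lemma bits231_all o q : all (fun y => y < o) q -> uniq q ->
  pairwise (rel231 o) q = all id (bits bit231 q).
Proof.
elim: q => [|x q IH] //= /andP[xo qo] /andP[xq uq].
case: q xq qo uq IH => [|y q] // xq qo uq IH.
rewrite -[RHS]/(bit231 x (y :: q) && all id (bits bit231 (y :: q))) -IH //.
case pq: (pairwise _ (y :: q)); rewrite ?andbF ?andbT //=.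
have /andP[yo qo'] := qo.
have /andP[yq _] := pq.
have -> : rel231 o x y = (x < y).
  have : x != y by move: xq; rewrite inE => /norP[].
  rewrite /rel231; order_lia.
rewrite /bit231 /=; case: ltnP => //= xy; apply/allP => z zq.
move: (allP yq z zq) (allP qo' z zq); rewrite /rel231.
have : y != z by apply: contraTneq zq => <-; case/andP: uq.
order_lia.
Qed.

(** In an admissible [q] the letters above [o] precede those below [o]. The new [t] must follow the
    former and precede the latter, so its only place is at the boundary. *)
Lemma rel312_insertion o t q : o < t -> all (fun y => y < t) q -> o \notin q ->
  count (pairwise (rel312 o)) (insertions t q) = pairwise (rel312 o) q.
Proof.
move=> ot; elim: q => [|x q IH] //= /andP[xt qt]; rewrite inE negb_or => /andP[ox oq].
rewrite count_map.
case: (ltngtP x o) ox => // xo _.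
- rewrite (eq_in_count (a2 := pred0)) ?count_pred0 ?addn0; last first.
    move=> s si /=; rewrite (perm_all _ (perm_insertions si)) /= /rel312 xo ot /=.
    by [].
  case xq: (all (rel312 o x) q); last by rewrite !andbF.
  rewrite !andTb; case: (pairwise (rel312 o) q); last by rewrite !andbF.
  rewrite !andbT.
  have -> : rel312 o t x by rewrite /rel312; order_lia.
  suff -> : all (rel312 o t) q by [].
  apply/allP => y yq; move: (allP xq y yq) (allP qt y yq).
  have : y != o by apply: contraNneq oq => <-.
  rewrite /rel312; order_lia.
- have -> : rel312 o t x = false by rewrite /rel312; order_lia.
  rewrite /= add0n.
  rewrite (eq_in_count (a2 := fun s => all (rel312 o x) q && pairwise (rel312 o) s)).
    by case: (all _ _) => /=; rewrite ?IH // count_pred0.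
  move=> s si /=; rewrite (perm_all _ (perm_insertions si)) /=.
  have -> // : rel312 o x t by rewrite /rel312; order_lia.
Qed.

(** No letter tolerates a larger [t > o] behind it, whichever side of [o] it lies on, whereas [t] in
    front is always admissible. *)
Lemma rel231_insertion o t q : o < t -> all (fun y => y < t) q -> o \notin q ->
  count (pairwise (rel231 o)) (insertions t q) = pairwise (rel231 o) q.
Proof.
move=> ot; case: q => [|x q] //= /andP[xt qt]; rewrite inE negb_or => /andP[ox oq].
rewrite count_map (eq_in_count (a2 := pred0)) ?count_pred0 ?addn0; last first.
  move=> s si /=; rewrite (perm_all _ (perm_insertions si)) /=.
  have -> // : rel231 o x t = false by rewrite /rel231; order_lia.
have -> : rel231 o t x by rewrite /rel231; order_lia.
suff -> : all (rel231 o t) q by [].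
by apply/allP => y /(allP qt) yt; rewrite /rel231; order_lia.
Qed.

Lemma sorted_split (r : rel nat) o s : transitive r -> sorted r s -> 
  (forall x y, r x y -> o < x -> o < y) ->
  s = [seq x <- s | x <= o] ++ [seq x <- s | o < x].
Proof.
move=> tr; elim: s => //= x s IH px up.
have sx := order_path_min tr px.
case: leqP => xo /=; first by rewrite -IH // (path_sorted px).
rewrite (@eq_in_filter _ _ pred0) ?filter_pred0 /=; last first.
  by move=> y ys; rewrite leqNgt (up x) // (allP sx).
rewrite (@eq_in_filter _ _ predT) ?filter_predT // => y ys; exact: up (allP sx y ys) xo.
Qed.

Lemma top312_before o H x l q : path ltn o H -> l <= o -> x < l ->
  all (fun y => y < l) q -> tok312 x q -> top312 (o :: H) x l q.
Proof.
move=> oH lo xl ql tx.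
have oH' h : h \in o :: H -> o <= h.
  by rewrite inE => /orP[/eqP->//|hH]; apply: ltnW; apply: (allP (order_path_min ltn_trans oH)).
apply/and3P; split=> //.
  apply/allP => h /oH' oh; apply/allP => y /(allP ql) yl; order_lia.
apply/(pairwiseP 0) => i j ih jh ij.
have := oH' _ (mem_nth 0 ih); have := oH' _ (mem_nth 0 jh).
move: (nth _ _ i) (nth _ _ j) => a b /=; order_lia.
Qed.

Lemma top231_before o H x l q : path ltn o H -> l <= o -> x < l ->
  all (fun y => y < l) q -> tok231 x q -> top231 (o :: H) x l q.
Proof.
move=> oH lo xl ql tx.
have oH' h : h \in o :: H -> o <= h.
  by rewrite inE => /orP[/eqP->//|hH]; apply: ltnW; apply: (allP (order_path_min ltn_trans oH)).
apply/and3P; split=> //.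
  apply/allP => h /oH' oh; apply/allP => y /(allP ql) yl; order_lia.
apply/(pairwiseP 0) => i j ih jh ij.
have := oH' _ (mem_nth 0 ih); have := oH' _ (mem_nth 0 jh).
move: (nth _ _ i) (nth _ _ j) => a b /=; order_lia.
Qed.

(** A row that reaches past [o] and a second diamond column contains an occurrence with both,
    wherever its 1 stands. *)
Lemma hole_pairs_after o H x l : size H <= 1 -> path ltn o H -> o < l -> x < l ->
  x \notin o :: H -> hole_pairs_ok (o :: H) x l = all (fun o2 => l <= o2) H.
Proof.
case: H => [|o2 [|? ?]] //= _ /andP[oo2 _] ol xl; rewrite !inE !negb_or => /andP[xo xo2].
rewrite /hole_pairs_ok /= !andbT; order_lia.
Qed.

(** Beyond [o] the condition on three letters follows from the one on pairs: in an occurrence in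
    columns [x < z < y], the diamond can replace [x] if it lies to its left, [z] if it lies between
    [x] and [y], and [y] if it lies further right. *)
Lemma top312_after o H x l q : size H <= 1 -> path ltn o H -> o < l -> x < l ->
  x \notin o :: H -> all (fun y => (y < l) && (y \notin o :: H)) q ->
  pairwise (rel312 o) q ->
  top312 (o :: H) x l q = all (rel312 o x) q && all (fun o2 => l <= o2) H.
Proof.
move=> sH oH ol xl xH qH pq; rewrite /top312 hole_pairs_after //.
have [lH|] := boolP (all (fun o2 => l <= o2) H); last by rewrite !andbF.
rewrite !andbT /=.
have -> : all (fun h => all (fun y => ~~ [|| x < h < y, (x < y < h) && (h < l) | h < y < x]) q) H.
  apply/allP => h hH; have lh := allP lH h hH.
  by apply/allP => y /(allP qH); order_lia.
rewrite andbT.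
have -> : all (fun y => ~~ [|| x < o < y, (x < y < o) && (o < l) | o < y < x]) q = all (rel312 o x) q.
  by apply: eq_all => y; rewrite /rel312 ol andbT.
rewrite andbC; case xq: (all _ _) => //=.
apply/(pairwiseP 0) => i j iq jq ij.
have := allP xq _ (mem_nth 0 iq); have := allP xq _ (mem_nth 0 jq).
have := pairwiseP 0 pq i j iq jq ij.
have := allP qH _ (mem_nth 0 iq); have := allP qH _ (mem_nth 0 jq).
move: (nth _ _ i) (nth _ _ j) => a b /=.
rewrite !inE !negb_or /rel312 => /and3P[_ ? _] /and3P[_ ? _].
move: xH; rewrite inE negb_or => /andP[? _]; order_lia.
Qed.

Lemma top231_after o H x l q : size H <= 1 -> path ltn o H -> o < l -> x < l ->
  x \notin o :: H -> all (fun y => (y < l) && (y \notin o :: H)) q ->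
  pairwise (rel231 o) q ->
  top231 (o :: H) x l q = all (rel231 o x) q && all (fun o2 => l <= o2) H.
Proof.
move=> sH oH ol xl xH qH pq; rewrite /top231 hole_pairs_after //.
have [lH|] := boolP (all (fun o2 => l <= o2) H); last by rewrite !andbF.
rewrite !andbT /=.
have -> : all (fun h => all (fun y => ~~ [|| h < x < y, x < h < y | (y < x < h) && (h < l)]) q) H.
  apply/allP => h hH; have lh := allP lH h hH.
  by apply/allP => y /(allP qH); order_lia.
rewrite andbT.
have -> : all (fun y => ~~ [|| o < x < y, x < o < y | (y < x < o) && (o < l)]) q = all (rel231 o x) q.
  by apply: eq_all => y; rewrite /rel231 ol andbT.
rewrite andbC; case xq: (all _ _) => //=.
apply/(pairwiseP 0) => i j iq jq ij.
have := allP xq _ (mem_nth 0 iq); have := allP xq _ (mem_nth 0 jq).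
have := pairwiseP 0 pq i j iq jq ij.
have := allP qH _ (mem_nth 0 iq); have := allP qH _ (mem_nth 0 jq).
move: (nth _ _ i) (nth _ _ j) => a b /=.
rewrite !inE !negb_or /rel231 => /and3P[_ ? _] /and3P[_ ? _].
move: xH; rewrite inE negb_or => /andP[? _]; order_lia.
Qed.

Lemma good_count_eq (H ls L : seq nat) :
  size H <= 2 -> sorted ltn H -> sorted leq ls -> sorted ltn L ->
  all (fun t => t \notin H) L ->
  count (good (top312 H) ls) (permutations L)
  = count (good (top231 H) ls) (permutations L).
Proof.
move=> sH oH sls sL LH.
suff [B1 B2]: exists w (g : nat -> nat),
    placements (top312 H) [::] L ls = walks g clear_above w None /\
    placements (top231 H) [::] L ls = walks g leading w None.
  case: B2 => g [e1 e2].
  have e top : count (good top ls) (permutations L) = placements top [::] L ls.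
    by apply: eq_count => c /=; rewrite filter_pred0.
  by rewrite !e e1 e2 walks_eq.
have mono312 x (s s' : seq nat) : subseq s' s -> tok312 x s -> tok312 x s'.
  by move=> h; apply: subseq_pairwise.
have mono231 x (s s' : seq nat) : subseq s' s -> tok231 x s -> tok231 x s'.
  by move=> h; apply: subseq_pairwise.
have tt312 x l s : top312 H x l s -> tok312 x s by case/and3P.
have tt231 x l s : top231 H x l s -> tok231 x s by case/and3P.
have uL : uniq L := sorted_uniq ltn_trans ltnn sL.
case: H sH oH LH tt312 tt231 => [|o H] sH oH LH tt312 tt231.
  (* Without diamonds, [o] is a fictitious column beyond all columns and row ends, so that the whole
     board belongs to the first phase; the final weight then accepts only the empty [q]. *)
  pose o := (sumn L + sumn ls).+1.
  have le_sumn x s : x \in s -> x <= sumn s.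
    elim: s => //= y s IH; rewrite inE => /orP[/eqP->|/IH]; order_lia.
  have Lo : all (fun y => y < o) L by apply/allP => y /le_sumn; rewrite /o; order_lia.
  have lso : all (fun y => y <= o) ls by apply/allP => y /le_sumn; rewrite /o; order_lia.
  exists (board_path ls L), (fun m => m == 0).
  have P := @placements_walks _ _ o [::] [::] _ _ (fun m => m == 0).
  split; rewrite -[L in LHS]cats0 -[ls in LHS]cats0.
    apply: (P _ tok312 _ (state bit312)) => //; rewrite ?cats0 //.
    + by move=> x l q _ _ _ _ tx; rewrite /top312 /= -/(tok312 x q) tx.
    + exact: state_insert312.
    + by move=> x q _ _; apply: state_pop.
    move=> q _ _ _; rewrite placements_no_row cats0.
    by case: q => //= x q; rewrite muln0.
  apply: (P _ tok231 _ (state bit231)) => //; rewrite ?cats0 //.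
  + by move=> x l q _ _ _ _ tx; rewrite /top231 /= -/(tok231 x q) tx.
  + exact: state_insert231.
  + by move=> x q _ _; apply: state_pop.
  move=> q _ _ _; rewrite placements_no_row cats0.
  by case: q => //= x q; rewrite muln0.
have oH' h : h \in o :: H -> o <= h.
  by rewrite inE => /orP[/eqP->//|hH]; apply: ltnW; apply: (allP (order_path_min ltn_trans oH)).
have LH' t : t \in L -> (t != o) && (t \notin H) by move/(allP LH); rewrite inE negb_or.
pose ct l := all (fun o2 => l <= o2) H.
pose La := [seq x <- L | x <= o]; pose Lb := [seq x <- L | o < x].
pose lsa := [seq x <- ls | x <= o]; pose lsb := [seq x <- ls | o < x].
have eL : L = La ++ Lb by apply: sorted_split sL _; [apply: ltn_trans | move=> x y; order_lia].
have els : ls = lsa ++ lsb by apply: sorted_split sls _; [apply: leq_trans | move=> x y; order_lia].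
have Lao : all (fun y => y < o) La.
  by apply/allP => y; rewrite mem_filter => /andP[yo /LH'/andP[]]; order_lia.
have lsao : all (fun l => l <= o) lsa by apply: filter_all.
have lsbo : all (fun l => o < l) lsb by apply: filter_all.
have Lbo : all (fun y => o < y) Lb by apply: filter_all.
have LbH : all (fun y => (o < y) && (y \notin o :: H)) Lb.
  by apply/allP => y yL; rewrite (allP Lbo y yL) (allP LH) // eL mem_cat yL orbT.
have sLa : sorted ltn La by apply: sorted_filter sL; apply: ltn_trans.
have sLb : sorted ltn Lb by apply: sorted_filter sL; apply: ltn_trans.
have slsa : sorted leq lsa by apply: sorted_filter sls; apply: leq_trans.
have slsb : sorted leq lsb by apply: sorted_filter sls; apply: leq_trans.
(* [forced] depends on the number of pending columns and not on the pattern, so both walks end with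
   the same weight. *)
exists (board_path lsa La), (forced ct lsb Lb).
have P := @placements_walks _ _ o Lb lsb _ _ (forced ct lsb Lb).
have hok (r : rel nat) q : all_tails (fun x => all (r x)) q = pairwise r q.
  by elim: q => //= x q ->.
have fin (top : nat -> nat -> seq nat -> bool) tok b r q :
    (forall x l q, o < l -> x < l -> x \notin o :: H ->
       all (fun y => (y < l) && (y \notin o :: H)) q -> pairwise (r o) q ->
       top x l q = all (r o x) q && ct l) ->
    (forall t q, o < t -> all (fun y => y < t) q -> o \notin q ->
       count (pairwise (r o)) (insertions t q) = pairwise (r o) q) ->
    (forall q, all (fun y => y < o) q -> uniq q ->
       pairwise (r o) q = all id (bits b q)) ->
    all (fun y => y < o) q -> uniq (q ++ Lb) -> all_tails tok q ->
    placements top q Lb lsb = final (forced ct lsb Lb) (state b q).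
  move=> ta ri ba qo uq cq.
  rewrite (@placements_forced top (fun x => all (r o x)) o (o :: H) ct) //.
  + case: q qo uq cq => [|x q] qo uq cq; first by rewrite /= mul1n.
    have ux : uniq (x :: q) by move: uq; rewrite cat_uniq => /andP[].
    by rewrite hok ba // /state /final size_bits.
  + by move=> x l q' *; rewrite ta // -hok.
  + move=> t q' ot q't uq'; rewrite hok -(ri t q' ot).
    * by apply: eq_count => q''; rewrite hok.
    * by apply: sub_all q't => y /andP[].
    by apply/negP => /(allP q't)/andP[_]; rewrite inE eqxx.
  + apply/allP => y yq; apply/negP => /oH'; have := allP qo y yq; order_lia.
  + by move=> l /(allP lsbo) ol; apply: sub_all qo => y; order_lia.
  by move=> t /(allP Lbo) ot; apply: sub_all qo => y; order_lia.
split; rewrite [in LHS]eL [in LHS]els.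
  apply: (P _ tok312 _ (state bit312)) => //.
  + by move=> x l q lo xl _ ql tx; apply: top312_before.
  + exact: state_insert312.
  + by move=> x q _ _; apply: state_pop.
  + move=> q qo uq cq; apply: (@fin _ tok312 _ rel312) => //.
    * by move=> *; apply: top312_after.
    * by move=> *; apply: rel312_insertion.
    by move=> *; apply: bits312_all.
  by rewrite /= -eL.
apply: (P _ tok231 _ (state bit231)) => //.
+ by move=> x l q lo xl _ ql tx; apply: top231_before.
+ exact: state_insert231.
+ by move=> x q _ _; apply: state_pop.
+ move=> q qo uq cq; apply: (@fin _ tok231 _ rel231) => //.
  * by move=> *; apply: top231_after.
  * by move=> *; apply: rel231_insertion.
  by move=> *; apply: bits231_all.
by rewrite /= -eL.
Qed.

(** * Occurrences among three columns *)

(** [None] stands for the row of a diamond, which can still be chosen and is therefore compatible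
    with every row. *)
Definition lower (s t : option nat) : bool :=
  match s, t with Some a, Some b => a < b | _, _ => true end.

(** All three comparisons are listed because [lower] is not transitive through [None]. *)
Definition pat312 (a b c : option nat) := [&& lower b c, lower c a & lower b a].
Definition pat231 (a b c : option nat) := [&& lower c a, lower a b & lower c b].

Definition fits (D : nat -> nat -> bool) (s : option nat) (k : nat) : bool :=
  if s is Some v then D v k else true.

(** Only the rightmost column is tested against [D]: a row of a Ferrers diagram is an initial
    segment of the columns. *)
Definition occ3 (pat : option nat -> option nat -> option nat -> bool)
    (val : nat -> option nat) (D : nat -> nat -> bool) (k1 k2 k3 : nat) : bool :=
  [&& k1 < k2, k2 < k3, pat (val k1) (val k2) (val k3),
      fits D (val k1) k3, fits D (val k2) k3 & fits D (val k3) k3].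

Definition occurs pat val D (cols : seq nat) : Prop :=
  exists k1 k2 k3, [/\ k1 \in cols, k2 \in cols, k3 \in cols & occ3 pat val D k1 k2 k3].

Lemma pairwise_by (f : nat -> nat) (r : rel nat) q :
  pairwise (fun y z => f z < f y) q ->
  pairwise r q <-> (forall y z, y \in q -> z \in q -> f z < f y -> r y z).
Proof.
elim: q => //= x q IH /andP[xq /IH {}IH]; split.
  case/andP=> rx /IH rq y z; rewrite !inE => /orP[/eqP->|yq] /orP[/eqP->|zq].
  - by rewrite ltnn.
  - by move=> _; apply: (allP rx).
  - by have /= := allP xq y yq; order_lia.
  - exact: rq.
move=> h; apply/andP; split.
  by apply/allP => y yq; apply: h; rewrite ?inE ?eqxx ?yq ?orbT //; apply: (allP xq).
by apply/IH => y z yq zq; apply: h; rewrite inE ?yq ?zq orbT.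
Qed.

Lemma pairwise_sorted_by (r : rel nat) q : sorted ltn q ->
  pairwise r q <-> (forall y z, y \in q -> z \in q -> y < z -> r y z).
Proof.
move=> sq; have : pairwise ltn q by rewrite -sorted_pairwise //; apply: ltn_trans.
elim: q {sq} => //= x q IH /andP[xq /IH {}IH]; split.
  case/andP=> rx /IH rq y z; rewrite !inE => /orP[/eqP->|yq] /orP[/eqP->|zq].
  - by rewrite ltnn.
  - by move=> _; apply: (allP rx).
  - by have /= := allP xq y yq; order_lia.
  - exact: rq.
move=> h; apply/andP; split.
  by apply/allP => y yq; apply: h; rewrite ?inE ?eqxx ?yq ?orbT //; apply: (allP xq).
by apply/IH => y z yq zq; apply: h; rewrite inE ?yq ?zq orbT.
Qed.

Section Step.
Variables (val : nat -> option nat) (D : nat -> nat -> bool).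
Variables (H c : seq nat) (x v l : nat).
Hypothesis H_sorted : sorted ltn H.
Hypothesis val_H : forall o, o \in H -> val o = None.
Hypothesis val_x : val x = Some v.
Hypothesis val_c : forall y, y \in c -> exists2 w, val y = Some w & w < v.
Hypothesis c_sorted : pairwise (fun y z => odflt 0 (val z) < odflt 0 (val y)) c.
Hypothesis D_anti : forall w w' k, w <= w' -> D w' k -> D w k.
Hypothesis D_l : forall k, k \in H ++ x :: c -> D v k = (k < l).
Hypothesis xl : x < l.

Definition meets k1 k2 k3 := [|| k1 == x, k2 == x | k3 == x].

Lemma D_below y k : y \in c -> k \in H ++ x :: c -> k < l -> fits D (val y) k.
Proof.
move=> /val_c[w -> wv] kc kl /=; apply: D_anti (ltnW wv) _; by rewrite D_l.
Qed.

Lemma filter_by (r : rel nat) :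
  pairwise r [seq y <- c | y < l] <->
  (forall y z, y \in c -> z \in c -> y < l -> z < l -> lower (val z) (val y) -> r y z).
Proof.
rewrite (@pairwise_by (fun y => odflt 0 (val y))); last first.
  exact: subseq_pairwise (filter_subseq _ _) c_sorted.
split=> h y z.
  move=> yc zc yl zl lo; apply: h; rewrite ?mem_filter ?yl ?zl //.
  by move: lo; have [? -> _] := val_c yc; have [? -> _] := val_c zc.
rewrite !mem_filter => /andP[yl yc] /andP[zl zc] lo; apply: h => //.
by move: lo; have [? -> _] := val_c yc; have [? -> _] := val_c zc.
Qed.

Lemma mem_rows k : k \in H ++ x :: c -> [\/ k \in H /\ val k = None, k = x |
  k \in c /\ exists2 w, val k = Some w & w < v].
Proof.
rewrite mem_cat inE => /or3P[kH|/eqP->|kc].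
- by constructor 1; rewrite val_H.
- by constructor 2.
- by constructor 3; split=> //; apply: val_c.
Qed.

Let inH o : o \in H -> o \in H ++ x :: c. Proof. by rewrite mem_cat => ->. Qed.
Let inx : x \in H ++ x :: c. Proof. by rewrite mem_cat inE eqxx orbT. Qed.
Let inc y : y \in c -> y \in H ++ x :: c.
Proof. by rewrite mem_cat inE => ->; rewrite !orbT. Qed.

(** The rows of [c] lie below row [v] and are at least as long, so an occurrence meeting [x] fits in
    the diagram exactly when its last column is below [l]. The three parts of [top312] correspond to
    zero, one and two diamonds among the other two columns. *)
Lemma top312P : top312 H x l [seq y <- c | y < l] <->
  (forall k1 k2 k3, k1 \in H ++ x :: c -> k2 \in H ++ x :: c -> k3 \in H ++ x :: c ->
     meets k1 k2 k3 -> ~~ occ3 pat312 val D k1 k2 k3).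
Proof.
split.
  case/and3P=> /filter_by T1 T2 /(pairwise_sorted_by _ H_sorted) T3.
  have {}T2 o y : o \in H -> y \in c -> y < l ->
      ~~ [|| x < o < y, (x < y < o) && (o < l) | o < y < x].
    by move=> oH yc yl; apply: (allP (allP T2 o oH)); rewrite mem_filter yl.
  move=> k1 k2 k3 i1 i2 i3 m; apply/negP => /and5P[k12 k23 p f1 /andP[f2 f3]].
  have l3 : k3 < l.
    by case/or3P: m f1 f2 f3 => /eqP e; subst; rewrite val_x /= D_l.
  case/or3P: m => /eqP e; subst; move: p; rewrite /pat312 val_x.
  - case/mem_rows: (i2) => [[h2 e2]|e2|[h2 [w2 e2 b2]]]; last 2 first.
    + by move: k12; rewrite e2 ltnn.
    + case/mem_rows: (i3) => [[h3 e3]|e3|[h3 [w3 e3 b3]]].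
      * by have := T2 _ _ h3 h2 (ltn_trans k23 l3); rewrite k12 k23 l3 orbT.
      * by move: (ltn_trans k12 k23); rewrite e3 ltnn.
      rewrite e2 e3 => /and3P[w23 _ _].
      by have := T1 _ _ h3 h2 l3 (ltn_trans k23 l3); rewrite e2 e3 k12 k23 => /(_ w23).
    case/mem_rows: (i3) => [[h3 e3]|e3|[h3 [w3 e3 b3]]].
    + by have := T3 _ _ h2 h3 k23; rewrite k12 l3 !orbT.
    + by move: (ltn_trans k12 k23); rewrite e3 ltnn.
    by have := T2 _ _ h2 h3 l3; rewrite k12 k23.
  - case/mem_rows: (i3) => [[h3 e3]|e3|[h3 [w3 e3 b3]]].
    + case/mem_rows: (i1) => [[h1 e1]|e1|[h1 [w1 e1 b1]]].
      * by have := T3 _ _ h1 h3 (ltn_trans k12 k23); rewrite k12 k23 l3 !orbT.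
      * by move: k12; rewrite e1 ltnn.
      by rewrite e1 e3 /= ltnNge (ltnW b1).
    + by move: k23; rewrite e3 ltnn.
    by rewrite e3 /= => /andP[vw _]; move: b3; rewrite ltnNge (ltnW vw).
  case/mem_rows: (i1) => [[h1 e1]|e1|[h1 [w1 e1 b1]]].
  - case/mem_rows: (i2) => [[h2 e2]|e2|[h2 [w2 e2 b2]]].
    + by have := T3 _ _ h1 h2 k12; rewrite k23.
    + by move: k23; rewrite e2 ltnn.
    by have := T2 _ _ h1 h2 (ltn_trans k23 xl); rewrite k12 k23 !orbT.
  - by move: (ltn_trans k12 k23); rewrite e1 ltnn.
  by rewrite e1 /= => /and3P[_ vw _]; move: b1; rewrite ltnNge (ltnW vw).
move=> T; apply/and3P; split.
- apply/filter_by => y z yc zc yl zl lo; apply/negP => /andP[xz zy].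
  have := T x z y inx (inc zc) (inc yc); rewrite /meets eqxx => /(_ isT)/negP; apply.
  rewrite /occ3 xz zy (D_below zc (inc yc) yl) (D_below yc (inc yc) yl) /pat312 lo val_x /=.
  rewrite (D_l (inc yc)) yl.
  have [wy ey yv] := val_c yc; have [wz ez zv] := val_c zc.
  by rewrite ey ez /= yv zv.
- apply/allP => o oH; apply/allP => y; rewrite mem_filter => /andP[yl yc].
  have [wy ey yv] := val_c yc; have eo := val_H oH.
  apply/negP => /or3P[/andP[xo oy]|/andP[/andP[xy yo] ol]|/andP[oy yx]].
  + have := T x o y inx (inH oH) (inc yc); rewrite /meets eqxx => /(_ isT)/negP; apply.
    by rewrite /occ3 xo oy (D_below yc (inc yc) yl) /pat312 eo val_x ey /= yv (D_l (inc yc)) yl.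
  + have := T x y o inx (inc yc) (inH oH); rewrite /meets eqxx => /(_ isT)/negP; apply.
    by rewrite /occ3 xy yo (D_below yc (inH oH) ol) /pat312 eo val_x ey /= yv (D_l (inH oH)) ol.
  have := T o y x (inH oH) (inc yc) inx; rewrite /meets eqxx !orbT => /(_ isT)/negP; apply.
  by rewrite /occ3 oy yx (D_below yc inx xl) /pat312 eo val_x ey /= yv (D_l inx) xl.
apply/(pairwise_sorted_by _ H_sorted) => o1 o2 o1H o2H o12.
have e1 := val_H o1H; have e2 := val_H o2H.
apply/negP => /or3P[o2x|/andP[/andP[o1x xo2] o2l]|/andP[xo1 o2l]].
+ have := T o1 o2 x (inH o1H) (inH o2H) inx; rewrite /meets eqxx !orbT => /(_ isT)/negP; apply.
  by rewrite /occ3 o12 o2x /pat312 e1 e2 val_x /= (D_l inx) xl.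
+ have := T o1 x o2 (inH o1H) inx (inH o2H); rewrite /meets eqxx !orbT => /(_ isT)/negP; apply.
  by rewrite /occ3 o1x xo2 /pat312 e1 e2 val_x /= (D_l (inH o2H)) o2l.
have := T x o1 o2 inx (inH o1H) (inH o2H); rewrite /meets eqxx => /(_ isT)/negP; apply.
by rewrite /occ3 xo1 o12 /pat312 e1 e2 val_x /= (D_l (inH o2H)) o2l.
Qed.

Lemma top231P : top231 H x l [seq y <- c | y < l] <->
  (forall k1 k2 k3, k1 \in H ++ x :: c -> k2 \in H ++ x :: c -> k3 \in H ++ x :: c ->
     meets k1 k2 k3 -> ~~ occ3 pat231 val D k1 k2 k3).
Proof.
split.
  case/and3P=> /filter_by T1 T2 /(pairwise_sorted_by _ H_sorted) T3.
  have {}T2 o y : o \in H -> y \in c -> y < l ->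
      ~~ [|| o < x < y, x < o < y | (y < x < o) && (o < l)].
    by move=> oH yc yl; apply: (allP (allP T2 o oH)); rewrite mem_filter yl.
  move=> k1 k2 k3 i1 i2 i3 m; apply/negP => /and5P[k12 k23 p f1 /andP[f2 f3]].
  have l3 : k3 < l.
    by case/or3P: m f1 f2 f3 => /eqP e; subst; rewrite val_x /= D_l.
  case/or3P: m => /eqP e; subst; move: p; rewrite /pat231 val_x.
  - case/mem_rows: (i2) => [[h2 e2]|e2|[h2 [w2 e2 b2]]]; last 2 first.
    + by move: k12; rewrite e2 ltnn.
    + by rewrite e2 /= => /and3P[_ vw _]; move: b2; rewrite ltnNge (ltnW vw).
    case/mem_rows: (i3) => [[h3 e3]|e3|[h3 [w3 e3 b3]]].
    + by have := T3 _ _ h2 h3 k23; rewrite k12 l3 !orbT.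
    + by move: (ltn_trans k12 k23); rewrite e3 ltnn.
    by have := T2 _ _ h2 h3 l3; rewrite k12 k23 !orbT.
  - case/mem_rows: (i1) => [[h1 e1]|e1|[h1 [w1 e1 b1]]].
    + case/mem_rows: (i3) => [[h3 e3]|e3|[h3 [w3 e3 b3]]].
      * by have := T3 _ _ h1 h3 (ltn_trans k12 k23); rewrite k12 k23 l3 !orbT.
      * by move: k23; rewrite e3 ltnn.
      by have := T2 _ _ h1 h3 l3; rewrite k12 k23.
    + by move: k12; rewrite e1 ltnn.
    case/mem_rows: (i3) => [[h3 e3]|e3|[h3 [w3 e3 b3]]].
    + by have := T2 _ _ h3 h1 (ltn_trans k12 xl); rewrite k12 k23 l3 !orbT.
    + by move: k23; rewrite e3 ltnn.
    rewrite e1 e3 => /and3P[w31 _ _].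
    by have := T1 _ _ h1 h3 (ltn_trans k12 xl) l3; rewrite e1 e3 k12 k23 => /(_ w31).
  case/mem_rows: (i1) => [[h1 e1]|e1|[h1 [w1 e1 b1]]].
  - case/mem_rows: (i2) => [[h2 e2]|e2|[h2 [w2 e2 b2]]].
    + by have := T3 _ _ h1 h2 k12; rewrite k23.
    + by move: k23; rewrite e2 ltnn.
    by rewrite e1 e2 /= ltnNge (ltnW b2).
  - by move: (ltn_trans k12 k23); rewrite e1 ltnn.
  by rewrite e1 /= => /and3P[vw _ _]; move: b1; rewrite ltnNge (ltnW vw).
move=> T; apply/and3P; split.
- apply/filter_by => y z yc zc yl zl lo; apply/negP => /andP[yx xz].
  have := T y x z (inc yc) inx (inc zc); rewrite /meets eqxx orbT => /(_ isT)/negP; apply.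
  rewrite /occ3 yx xz (D_below zc (inc zc) zl) (D_below yc (inc zc) zl) /pat231 lo val_x /=.
  rewrite (D_l (inc zc)) zl.
  have [wy ey yv] := val_c yc; have [wz ez zv] := val_c zc.
  by rewrite ey ez /= yv zv.
- apply/allP => o oH; apply/allP => y; rewrite mem_filter => /andP[yl yc].
  have [wy ey yv] := val_c yc; have eo := val_H oH.
  apply/negP => /or3P[/andP[ox xy]|/andP[xo oy]|/andP[/andP[yx xo] ol]].
  + have := T o x y (inH oH) inx (inc yc); rewrite /meets eqxx orbT => /(_ isT)/negP; apply.
    by rewrite /occ3 ox xy (D_below yc (inc yc) yl) /pat231 eo val_x ey /= yv (D_l (inc yc)) yl.
  + have := T x o y inx (inH oH) (inc yc); rewrite /meets eqxx => /(_ isT)/negP; apply.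
    by rewrite /occ3 xo oy (D_below yc (inc yc) yl) /pat231 eo val_x ey /= yv (D_l (inc yc)) yl.
  have := T y x o (inc yc) inx (inH oH); rewrite /meets eqxx orbT => /(_ isT)/negP; apply.
  by rewrite /occ3 yx xo (D_below yc (inH oH) ol) /pat231 eo val_x ey /= yv (D_l (inH oH)) ol.
apply/(pairwise_sorted_by _ H_sorted) => o1 o2 o1H o2H o12.
have e1 := val_H o1H; have e2 := val_H o2H.
apply/negP => /or3P[o2x|/andP[/andP[o1x xo2] o2l]|/andP[xo1 o2l]].
+ have := T o1 o2 x (inH o1H) (inH o2H) inx; rewrite /meets eqxx !orbT => /(_ isT)/negP; apply.
  by rewrite /occ3 o12 o2x /pat231 e1 e2 val_x /= (D_l inx) xl.
+ have := T o1 x o2 (inH o1H) inx (inH o2H); rewrite /meets eqxx !orbT => /(_ isT)/negP; apply.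
  by rewrite /occ3 o1x xo2 /pat231 e1 e2 val_x /= (D_l (inH o2H)) o2l.
have := T x o1 o2 inx (inH o1H) (inH o2H); rewrite /meets eqxx => /(_ isT)/negP; apply.
by rewrite /occ3 xo1 o12 /pat231 e1 e2 val_x /= (D_l (inH o2H)) o2l.
Qed.
End Step.

Definition top_spec (top : seq nat -> nat -> nat -> seq nat -> bool) pat :=
  forall (val : nat -> option nat) (D : nat -> nat -> bool) (H c : seq nat) (x v l : nat),
  sorted ltn H -> (forall o, o \in H -> val o = None) -> val x = Some v ->
  (forall y, y \in c -> exists2 w, val y = Some w & w < v) ->
  pairwise (fun y z => odflt 0 (val z) < odflt 0 (val y)) c ->
  (forall w w' k, w <= w' -> D w' k -> D w k) ->
  (forall k, k \in H ++ x :: c -> D v k = (k < l)) -> x < l ->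
  top H x l [seq y <- c | y < l] <->
  (forall k1 k2 k3, k1 \in H ++ x :: c -> k2 \in H ++ x :: c -> k3 \in H ++ x :: c ->
     meets x k1 k2 k3 -> ~~ occ3 pat val D k1 k2 k3).

Section Good.
Variables (top : seq nat -> nat -> nat -> seq nat -> bool).
Variable pat : option nat -> option nat -> option nat -> bool.
Hypothesis topP : top_spec top pat.
Variables (val : nat -> option nat) (D : nat -> nat -> bool) (H : seq nat).
Variables (pos len : nat -> nat).
Hypothesis H_sorted : sorted ltn H.
Hypothesis size_H : size H <= 2.
Hypothesis val_H : forall o, o \in H -> val o = None.
Hypothesis D_anti : forall w w' k, w <= w' -> D w' k -> D w k.

(** Rows are removed from the top: an occurrence either meets the column of the top row, which [top]
    decides, or survives the removal. In the end at most two diamond columns are left, too few for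
    an occurrence. *)
Lemma goodP vs : sorted gtn vs -> (forall v, v \in vs -> val (pos v) = Some v) ->
  (forall v k, v \in vs -> k \in H ++ map pos vs -> D v k = (k < len v)) ->
  good (top H) (map len vs) (map pos vs) <->
  (forall v, v \in vs -> D v (pos v)) /\ ~ occurs pat val D (H ++ map pos vs).
Proof.
elim: vs => [|v vs IH] svs hval hD.
  split=> // _; split=> // -[k1 [k2 [k3 [i1 i2 i3 /and3P[k12 k23 _]]]]].
  have u : uniq [:: k1; k2; k3] by rewrite /= !inE; lia.
  suff : size [:: k1; k2; k3] <= 2 by [].
  apply: leq_trans size_H; apply: uniq_leq_size => // k.
  by rewrite !inE => /or3P[] /eqP->; rewrite -[H]cats0.
have vvs w : w \in vs -> w < v.
  by move=> wvs; apply: (allP (order_path_min _ svs)) => // a b d; rewrite /gtn /=; lia.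
have hval' w : w \in vs -> val (pos w) = Some w by move=> h; apply: hval; rewrite inE h orbT.
have hv : val (pos v) = Some v by apply: hval; rewrite inE eqxx.
have sub k : k \in H ++ map pos vs -> k \in H ++ map pos (v :: vs).
  by rewrite !mem_cat inE => /orP[->//|->]; rewrite !orbT.
have hD' w k : w \in vs -> k \in H ++ map pos vs -> D w k = (k < len w).
  by move=> wvs /sub h; apply: hD => //; rewrite inE wvs orbT.
have {}IH := IH (path_sorted svs) hval' hD'.
have Dl k : k \in H ++ map pos (v :: vs) -> D v k = (k < len v).
  by apply: hD; rewrite inE eqxx.
have pin : pos v \in H ++ map pos (v :: vs) by rewrite mem_cat inE eqxx orbT.
have hc y : y \in map pos vs -> exists2 w, val y = Some w & w < v.
  by case/mapP=> w wvs ->; exists w; [apply: hval'|apply: vvs].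
have cs : pairwise (fun y z => odflt 0 (val z) < odflt 0 (val y)) (map pos vs).
  rewrite pairwise_map; move: (path_sorted svs); rewrite sorted_pairwise; last by move=> a b d; rewrite /gtn /=; lia.
  apply: (@sub_in_pairwise _ (mem vs)) => [a b avs bvs /=|]; last exact/allP.
  by rewrite !hval'.
have TP := @topP val D H (map pos vs) (pos v) v (len v) H_sorted val_H hv hc cs D_anti Dl.
rewrite [map len _]/= [map pos _]/= /=; split.
  case/and3P=> vl tv /IH[hv1 no]; split.
    by move=> w; rewrite inE => /orP[/eqP->|/hv1//]; rewrite Dl.
  case=> k1 [k2 [k3 [i1 i2 i3 oc]]].
  have [m|m] := boolP (meets (pos v) k1 k2 k3).
    have /(TP vl) T := tv.
    by move: (T _ _ _ i1 i2 i3 m); rewrite oc.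
  apply: no; exists k1, k2, k3.
  by move: i1 i2 i3 m; rewrite !mem_cat !inE /meets => /orP[->|/orP[->|->]]; rewrite ?orbT //=;
     move=> /orP[->|/orP[->|->]]; rewrite ?orbT //=;
     move=> /orP[->|/orP[->|->]]; rewrite ?orbT //=.
case=> hv1 no.
have vl : pos v < len v by rewrite -Dl //; apply: hv1; rewrite inE eqxx.
rewrite vl andTb; apply/andP; split.
  apply/(TP vl) => k1 k2 k3 i1 i2 i3 m.
  by apply/negP => oc; apply: no; exists k1, k2, k3.
apply/IH; split; first by move=> w wvs; apply: hv1; rewrite inE wvs orbT.
by case=> k1 [k2 [k3 [i1 i2 i3 oc]]]; apply: no; exists k1, k2, k3; split=> //; apply: sub.
Qed.
End Good.

Lemma good_valid top ls c : good top ls c ->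
  size c = size ls /\ forall i, i < size c -> nth 0 c i < nth 0 ls i.
Proof.
elim: ls c => [|l ls IH] [|x c] //= /and3P[xl _ /IH[-> h]]; split=> // -[|i] //=.
exact: h.
Qed.

Lemma occurs_mem pat val D s t : s =i t -> occurs pat val D s -> occurs pat val D t.
Proof.
by move=> st [k1 [k2 [k3 [i1 i2 i3 o]]]]; exists k1, k2, k3; rewrite -!st.
Qed.

(** * Families of objects parametrized by placements on a Ferrers board *)

Section Class.
Variables (T : finType) (S : {set T}) (vs : seq nat) (len : nat -> nat) (H L : seq nat).
Variables (D : nat -> nat -> bool) (val : T -> nat -> option nat) (pos : T -> nat -> nat).
Hypotheses (vs_sorted : sorted gtn vs) (len_sorted : sorted leq (map len vs)).
Hypotheses (H_sorted : sorted ltn H) (L_sorted : sorted ltn L).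
Hypothesis LH : all (fun k => k \notin H) L.
Hypothesis D_anti : forall w w' k, w <= w' -> D w' k -> D w k.
Hypothesis D_len : forall v k, v \in vs -> k \in H ++ L -> D v k = (k < len v).
Hypothesis pos_perm : forall t, t \in S -> perm_eq (map (pos t) vs) L.
Hypothesis pos_D : forall t v, t \in S -> v \in vs -> D v (pos t v).
Hypothesis val_pos : forall t v, t \in S -> v \in vs -> val t (pos t v) = Some v.
Hypothesis val_H : forall t o, t \in S -> o \in H -> val t o = None.
Hypothesis pos_inj : forall t t', t \in S -> t' \in S ->
  map (pos t) vs = map (pos t') vs -> t = t'.
Hypothesis pos_surj : forall c, perm_eq c L -> size c = size vs ->
  (forall i, i < size c -> D (nth 0 vs i) (nth 0 c i)) ->
  exists2 t, t \in S & map (pos t) vs = c.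

(** [pos_inj] and [pos_surj] make the reading of columns from the top row down a bijection between
    [S] and the words that fit the board; [goodP] singles out the avoiding ones. *)
Lemma class_card top pat (A : pred T) : top_spec top pat -> size H <= 2 ->
  (forall t, t \in S -> A t <-> ~ occurs pat (val t) D (H ++ L)) ->
  #|[set t in S | A t]| = count (good (top H) (map len vs)) (permutations L).
Proof.
move=> topP sH hA.
have mem_cols t : t \in S -> H ++ map (pos t) vs =i H ++ L.
  by move=> tS k; rewrite !mem_cat (perm_mem (pos_perm tS)).
have gP t : t \in S -> good (top H) (map len vs) (map (pos t) vs) <-> A t.
  move=> tS; rewrite (@goodP _ _ topP (val t) D) //.
  - split=> [[_ no]|/(hA _ tS) no].
      by apply/(hA _ tS) => oc; apply: no; apply: occurs_mem oc => k; rewrite mem_cols.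
    split; first by move=> v; apply: pos_D.
    by move=> oc; apply: no; apply: occurs_mem oc; apply: mem_cols.
  - by move=> o; apply: val_H.
  - by move=> v; apply: val_pos.
  by move=> v k vvs; rewrite mem_cols //; apply: D_len.
rewrite cardE -size_filter -(size_map (fun t => map (pos t) vs)).
apply/perm_size/uniq_perm.
- rewrite map_inj_in_uniq ?enum_uniq // => t t'; rewrite !mem_enum !inE.
  by move=> /andP[tS _] /andP[tS' _]; apply: pos_inj.
- by rewrite filter_uniq ?permutations_uniq.
move=> c; rewrite mem_filter mem_permutations; apply/mapP/andP.
  case=> t; rewrite mem_enum inE => /andP[tS At] ->.
  by rewrite pos_perm //; split=> //; apply/gP.
case=> gc pc; have [sc vc] := good_valid gc; rewrite size_map in sc.
have [i il|t tS tc] := pos_surj pc sc.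
  rewrite D_len ?mem_nth -?sc //; last by rewrite mem_cat -(perm_mem pc) mem_nth // orbT.
  by have := vc i il; rewrite (nth_map 0) -?sc.
exists t; rewrite ?tc // mem_enum inE tS; apply/gP => //; by rewrite tc.
Qed.

Lemma class_card_eq (A B : pred T) :
  (forall t, t \in S -> A t <-> ~ occurs pat312 (val t) D (H ++ L)) ->
  (forall t, t \in S -> B t <-> ~ occurs pat231 (val t) D (H ++ L)) ->
  #|[set t in S | A t]| = #|[set t in S | B t]|.
Proof.
move=> hA hB; have [sH|sH] := leqP (size H) 2.
  rewrite (class_card (@top312P) sH hA) (class_card (@top231P) sH hB).
  exact: good_count_eq.
have [o1 [o2 [o3 [h1 h2 h3 o12 o23]]]] : exists o1 o2 o3,
    [/\ o1 \in H, o2 \in H, o3 \in H, o1 < o2 & o2 < o3].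
  case: H H_sorted sH => [|o1 [|o2 [|o3 H']]] //= /and3P[o12 o23 _] _.
  by exists o1, o2, o3; rewrite !inE !eqxx !orbT.
have no (pat : option nat -> option nat -> option nat -> bool) :
    pat None None None -> forall t, t \in S -> occurs pat (val t) D (H ++ L).
  move=> p t tS; exists o1, o2, o3; rewrite !mem_cat h1 h2 h3; split=> //.
  by rewrite /occ3 o12 o23 !val_H // p.
suff e (P : pred T) : (forall t, t \in S -> ~ P t) -> [set t in S | P t] = set0.
  rewrite !e // => t tS; first by move/(hB t tS); apply; apply: no.
  by move/(hA t tS); apply; apply: no.
move=> h; apply/setP => t; rewrite !inE; apply/negP => /andP[tS]; exact: h.
Qed.
End Class.

(** * Substitutions and partial occurrences *)

Lemma card_ord_lt c b : b <= c -> #|[set j : 'I_c | j < b]| = b.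
Proof.
move=> bc; rewrite -sum1_card -[RHS]card_ord -sum1_card.
rewrite (big_ord_widen _ (fun=> 1) bc); apply: eq_bigl => j; by rewrite inE.
Qed.

Lemma row_lengthP c (F : prefilling c) i (b : 'I_c) : ferrers (height F) ->
  (b < row_length F i) = (i < height F b).
Proof.
move=> fF; rewrite /row_length; apply/idP/idP => [|ib].
  apply: contraTT; rewrite -!leqNgt => bi.
  rewrite -[X in _ <= X](card_ord_lt (ltnW (ltn_ord b))); apply/subset_leq_card/subsetP => j.
  rewrite !inE; apply: contraTT; rewrite -!leqNgt => bj.
  exact: leq_trans (fF _ _ bj) bi.
rewrite -[X in X <= _](card_ord_lt (ltn_ord b)); apply/subset_leq_card/subsetP => j.
rewrite !inE ltnS => jb; exact: leq_trans ib (fF _ _ jb).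
Qed.

Lemma nth_insert (T : Type) (x0 : T) i x s m : i <= size s ->
  nth x0 (insert i x s) m = if m == i then x else nth x0 s (unbump i m).
Proof.
move=> si; rewrite /insert nth_cat size_takel // /unbump.
case: (ltngtP m i) => [mi|mi|->].
- by rewrite nth_take // subn0.
- rewrite -subn_gt0 in mi; case E: (m - i) mi => [|d] // _ /=.
  by rewrite nth_drop; congr nth; lia.
by rewrite subnn.
Qed.

Lemma size_insert (T : Type) i (x : T) s : size (insert i x s) = (size s).+1.
Proof. by rewrite /insert size_cat /= addnS -size_cat cat_take_drop. Qed.

Section Substitution.
Variable c : nat.
Implicit Types F G : prefilling c.

(** The invariant kept by substitutions. With at most one 1 in each row and column, an occurrence is
    determined by its 1's, the required 0's coming for free. *)
Record sparse_filling F : Prop := SparseFilling {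
  sparse_ferrers : ferrers (height F);
  sparse_dcols : forall j x, x \in col F j -> (x == None) = (j \in dcols F);
  sparse_row : forall i j j',
    entry F i j = Some true -> entry F i j' = Some true -> j = j';
  sparse_col : forall i i' j,
    entry F i j = Some true -> entry F i' j = Some true -> i = i'
}.

Section Step.
Variables (F : prefilling c) (j : 'I_c) (i L : nat).
Hypothesis sF : sparse_filling F.
Hypothesis sub : can_substitute F j i L.

Let F' := substitute F j i L.

Lemma le_height_sub (b : 'I_c) : b < L -> i <= height F b.
Proof.
have [_ _ _ _] := sub; case: (i) => // i' Li bL.
by rewrite -(row_lengthP _ _ (sparse_ferrers sF)); apply: leq_trans bL Li.
Qed.

Lemma height_le_sub (b : 'I_c) : L <= b -> height F b <= i.
Proof.
have [_ _ _ iL _] := sub; move=> Lb; rewrite leqNgt -(row_lengthP _ _ (sparse_ferrers sF)).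
by rewrite -leqNgt (leq_trans iL).
Qed.

Lemma height_substitute (b : 'I_c) : height F' b = height F b + (b < L).
Proof.
have [_ _ jL _ _] := sub.
rewrite /F' /height /=; case: eqP => [->|_].
  by rewrite size_insert size_nseq jL addn1.
by case: ifP => _; rewrite ?size_insert ?addn1 ?addn0.
Qed.

Lemma ltn_height_substitute (b : 'I_c) m : m != i ->
  (m < height F' b) = (unbump i m < height F b).
Proof.
move=> mi; rewrite height_substitute /unbump; case: (ltnP b L) => bL.
  by have := le_height_sub bL; lia.
by have := height_le_sub bL; lia.
Qed.

Lemma new_row_substitute (b : 'I_c) : (i < height F' b) = (b < L).
Proof.
rewrite height_substitute; case: (ltnP b L) => bL.
  by have := le_height_sub bL; lia.
by have := height_le_sub bL; lia.
Qed.

Lemma entry_substitute_new m : entry F' m j = Some (m == i).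
Proof.
have [_ ih _ _ _] := sub.
rewrite /entry /= eqxx nth_insert ?size_nseq //; case: eqP => // _.
by rewrite nth_nseq; case: ifP.
Qed.

Lemma entry_substitute (b : 'I_c) m : b != j ->
  (entry F' m b == Some true) = (m != i) && (entry F (unbump i m) b == Some true).
Proof.
move=> bj; rewrite /entry /= (negPf bj); case: (ltnP b L) => bL.
  by rewrite nth_insert ?le_height_sub //; case: (eqVneq m i) => // _; case: (b \in dcols F).
have hb := height_le_sub bL.
have [->|mi] := eqVneq m i; first by rewrite nth_default.
rewrite /unbump; have [im|] := ltnP i m; last by rewrite subn0.
by rewrite !nth_default //; rewrite /height in hb; lia.
Qed.

Lemma sparse_substitute : sparse_filling F'.
Proof.
have [jd ih jL _ _] := sub.
split.
- move=> a b ab; rewrite !height_substitute; have := sparse_ferrers sF ab.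
  by case: (ltnP b L) => bL; [rewrite (leq_ltn_trans ab bL)|]; lia.
- move=> b x; rewrite /F' /= !inE; case: eqP => [->|/eqP bj] /=.
    rewrite mem_cat inE => /or3P[|/eqP->//|].
      by move/mem_take; rewrite mem_nseq => /andP[_ /eqP->].
    by move/mem_drop; rewrite mem_nseq => /andP[_ /eqP->].
  case: ifP => _; last exact: sparse_dcols.
  rewrite mem_cat inE => /or3P[/mem_take|/eqP->|/mem_drop]; try exact: sparse_dcols.
  by case: (b \in dcols F).
- move=> m a b /eqP ea /eqP eb.
  case: (eqVneq a j) ea => [->|aj].
    rewrite entry_substitute_new => /eqP[/eqP mi].
    by case: (eqVneq b j) eb => // bj; rewrite entry_substitute // mi eqxx.
  rewrite entry_substitute // => /andP[mi /eqP ea].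
  case: (eqVneq b j) eb => [->|bj].
    by rewrite entry_substitute_new (negPf mi).
  by rewrite entry_substitute // mi => /eqP; apply: sparse_row ea.
move=> m m' a /eqP e /eqP e'.
case: (eqVneq a j) e e' => [->|aj].
  by rewrite !entry_substitute_new => /eqP[/eqP->] /eqP[/eqP->].
rewrite !entry_substitute // => /andP[mi /eqP e] /andP[mi' /eqP e'].
by have := sparse_col sF e e'; rewrite /unbump; lia.
Qed.
End Step.

Variable p : seq nat.
Hypothesis p_perm : perm_eq p (iota 1 (size p)).

(* In diamond columns [r] is irrelevant; the other columns and their rows must
   form the corresponding part of the pattern inside the diagram. *)
Definition partially_contains F : Prop :=
  exists (r : 'I_(size p) -> nat) (k : 'I_(size p) -> 'I_c),
    [/\ forall a b : 'I_(size p), a < b -> k a < k b,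
        forall a b, k a \notin dcols F ->
          entry F (r a) (k a) = Some true /\ r a < height F (k b)
      & forall a b, k a \notin dcols F -> k b \notin dcols F ->
          nth 0 p a < nth 0 p b -> r a < r b].

Lemma pull_substitute F j i L : sparse_filling F -> can_substitute F j i L ->
  partially_contains (substitute F j i L) -> partially_contains F.
Proof.
move=> sF sub [r [k [hk he ho]]]; exists (fun a => unbump i (r a)), k.
have [jd _ _ _ _] := sub.
have nd a : k a \notin dcols F -> (k a != j) /\ (k a \notin dcols (substitute F j i L)).
  by move=> ka; rewrite /= !inE (negPf ka) andbF; split=> //; apply: contraNneq ka => ->.
have ri a : k a \notin dcols F -> r a != i.
  move=> /nd[kj kd]; have [/eqP e _] := he a a kd.
  by move: e; rewrite entry_substitute // => /andP[].
split=> // [a b ka|a b ka kb pab].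
  have [kj kd] := nd a ka; have [/eqP e h] := he a b kd.
  move: e; rewrite entry_substitute // => /andP[_ /eqP ->]; split=> //.
  by rewrite -(ltn_height_substitute sF sub) ?ri.
have := ho a b (nd a ka).2 (nd b kb).2 pab; have := ri a ka; have := ri b kb.
rewrite /unbump; lia.
Qed.

(** The new row is placed so that its 1 continues the partial occurrence; the height of the diamond
    column is no obstacle, as every column of the occurrence meets all its rows. *)
Lemma push_substitute F j : sparse_filling F -> j \in dcols F ->
  partially_contains F -> exists i L,
    can_substitute F j i L /\ partially_contains (substitute F j i L).
Proof.
move=> sF jd [r [k [hk he ho]]].
have k_inj (a b : 'I_(size p)) : k a = k b -> a = b.
  by move=> e; apply/val_inj; case: (ltngtP a b) => // /hk; rewrite e ltnn.
have nd' i L b : k b \notin dcols (substitute F j i L) -> k b != j -> k b \notin dcols F.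
  by rewrite /= !inE => + bj; rewrite bj.
have unbumpK i m : unbump i (bump i m) = m by rewrite /unbump /bump; lia.
have bump_neq i m : bump i m != i by rewrite /bump; lia.
have [[b0 kb0]|nj] := pselect (exists b, k b = j); last first.
  have kj a : k a != j by apply/eqP => e; apply: nj; exists a.
  (* If the occurrence does not use column [j], a new bottom row of full length only shifts the
     other rows up. *)
  have sub : can_substitute F j 0 c.
    by split=> //; rewrite -[X in _ <= X]card_ord max_card.
  exists 0, c; split=> //; exists (fun a => bump 0 (r a)), k.
  split=> // [a b /nd'/(_ (kj a)) ka|a b /nd'/(_ (kj a)) ka /nd'/(_ (kj b)) kb pab].
    have [e h] := he a b ka; split.
      by apply/eqP; rewrite entry_substitute // unbumpK e bump_neq eqxx.
    by rewrite (ltn_height_substitute sF sub) // unbumpK.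
  by have := ho a b ka kb pab; rewrite /bump; lia.
(* The lowest place above all rows that carry smaller letters of the pattern; it is 0 if there are
   none. *)
pose i := \max_(a | (k a \notin dcols F) && (nth 0 p a < nth 0 p b0)) (r a).+1.
(* The greatest length allowed, so that the new row reaches every column of the occurrence. *)
pose L := if i is i'.+1 then row_length F i' else c.
have ih b : i <= height F (k b).
  by apply/bigmax_leqP => a /andP[ka _]; have [] := he a b ka.
have iL b : k b < L.
  rewrite /L; have := ih b; case: (i) => [|i'] ib //.
  by rewrite row_lengthP //; apply: sparse_ferrers.
have sub : can_substitute F j i L.
  split=> //; rewrite -?kb0 ?ih ?iL // /L; case: (i) => [|i'] //.
    by rewrite -[X in _ <= X]card_ord max_card.
  by apply/subset_leq_card/subsetP => b; rewrite !inE; apply: ltnW.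
exists i, L; split=> //.
exists (fun a => if a == b0 then i else bump i (r a)), k.
have kj a : a != b0 -> k a != j.
  by apply: contraNneq => e; apply/eqP/k_inj; rewrite e.
split=> // [a b ka|a b ka kb pab].
  case: (eqVneq a b0) ka => [->|ab] ka.
    by rewrite kb0 entry_substitute_new // eqxx new_row_substitute.
  have ka' := nd' _ _ _ ka (kj a ab); have [e h] := he a b ka'; split.
    by apply/eqP; rewrite entry_substitute ?kj // unbumpK e bump_neq eqxx.
  by rewrite (ltn_height_substitute sF sub) // unbumpK.
case: (eqVneq a b0) ka pab => [->|ab] ka pab.
  case: (eqVneq b b0) kb pab => [->|bb] kb pab; first by rewrite ltnn in pab.
  have kb' := nd' _ _ _ kb (kj b bb).
  suff : i <= r b by rewrite /bump; lia.
  apply/bigmax_leqP => d /andP[kd pd]; apply: ho => //; exact: ltn_trans pd pab.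
have ka' := nd' _ _ _ ka (kj a ab).
case: (eqVneq b b0) kb pab => [->|bb] kb pab.
  have : (r a).+1 <= i by rewrite /i (bigD1 a) /= ?ka' // leq_maxl.
  by rewrite /bump; lia.
have kb' := nd' _ _ _ kb (kj b bb).
by have := ho a b ka' kb' pab; rewrite /bump; lia.
Qed.

Lemma substitutions_pull n F G : substitutions n F G -> sparse_filling F ->
  sparse_filling G /\ (partially_contains G -> partially_contains F).
Proof.
elim=> [{}F|{}n {}F j i L {}G sub _ IH] sF //.
have [sG h] := IH (sparse_substitute sF sub); split=> // /h.
exact: pull_substitute.
Qed.

Lemma substitutions_push n F : #|dcols F| = n -> sparse_filling F ->
  partially_contains F -> exists G,
    [/\ substitutions n F G, dcols G = set0 & partially_contains G].
Proof.
elim: n F => [|n IH] F dF sF cF.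
  by exists F; split; [constructor | apply/eqP; rewrite -cards_eq0 dF | ].
have /card_gt0P[j jd] : 0 < #|dcols F| by rewrite dF.
have [i [L [sub cF']]] := push_substitute sF jd cF.
have [|G [sG dG cG]] := IH _ _ (sparse_substitute sF sub) cF'.
  by move: dF; rewrite (cardsD1 j) jd => -[].
by exists G; split=> //; apply: SubstitutionsS sub sG.
Qed.

Lemma p_bound (a : 'I_(size p)) : 0 < nth 0 p a <= size p.
Proof.
have : nth 0 p a \in iota 1 (size p) by rewrite -(perm_mem p_perm) mem_nth.
by rewrite mem_iota; lia.
Qed.

Lemma p_uniq : uniq p.
Proof. by rewrite (perm_uniq p_perm) iota_uniq. Qed.

(** In [contains] the rows are numbered from the bottom, in [partially_contains] by the columns of
    their 1's; [nth] and [index] in [p] translate. A second 1 in a column would contradict sparsity,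
    which gives the 0's. *)
Lemma contains_partially G : sparse_filling G -> dcols G = set0 ->
  contains G p <-> partially_contains G.
Proof.
move=> sG dG; split=> [[r [k [hr hk he]]]|[r [k [hk he ho]]]].
  have lt (a : 'I_(size p)) : (nth 0 p a).-1 < size p by have := p_bound a; lia.
  exists (fun a => r (Ordinal (lt a))), k; split=> // [a b _|a b _ _ pab].
    have [h e] := he (Ordinal (lt a)) a; split; last by have [] := he (Ordinal (lt a)) b.
    by rewrite e /= prednK ?eqxx //; have := p_bound a; lia.
  by apply: hr => /=; have := p_bound a; lia.
have lt (a : 'I_(size p)) : index a.+1 p < size p.
  rewrite index_mem (perm_mem p_perm) mem_iota; have := ltn_ord a; lia.
have nthE (a : 'I_(size p)) : nth 0 p (Ordinal (lt a)) = a.+1 by rewrite nth_index -?index_mem ?lt.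
have nd a : k a \notin dcols G by rewrite dG inE.
exists (fun a => r (Ordinal (lt a))), k; split=> // [a b ab|a b].
  by apply: ho => //; rewrite !nthE.
have [_ h] := he (Ordinal (lt a)) b (nd _); split=> //.
have [e|ne] := eqVneq (nth 0 p b) a.+1.
  have -> : Ordinal (lt a) = b by apply/val_inj; rewrite /= -e index_uniq ?p_uniq.
  by have [] := he b b (nd b).
have : entry G (r (Ordinal (lt a))) (k b) != None.
  by rewrite (sparse_dcols sG (mem_nth _ h)) dG inE.
have [eb _] := he b b (nd b).
case E: (entry G _ _) => [[]|] // _.
have rr := sparse_col sG eb E.
case: (ltngtP (nth 0 p b) a.+1) ne => // pl _.
  by have := ho b (Ordinal (lt a)) (nd _) (nd _); rewrite nthE rr ltnn => /(_ pl).
by have := ho (Ordinal (lt a)) b (nd _) (nd _); rewrite nthE rr ltnn => /(_ pl).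
Qed.

Lemma avoids_partially F : sparse_filling F ->
  avoids F p <-> ~ partially_contains F.
Proof.
move=> sF; split=> [av cF|ncF G [sG dG] cG].
  have [G [sG dG cG]] := substitutions_push erefl sF cF.
  apply: (av G) => //; apply/contains_partially => //.
  by have [] := substitutions_pull sG sF.
have [spG h] := substitutions_pull sG sF.
by apply/ncF/h/contains_partially.
Qed.
End Substitution.

(** * Partial transversals of a Ferrers diagram *)

Definition pattern_spec (p : seq nat)
    (pat : option nat -> option nat -> option nat -> bool) : Prop :=
  forall s1 s2 s3, pat s1 s2 s3 <->
    forall a b, a < 3 -> b < 3 -> nth 0 p a < nth 0 p b ->
      lower (nth None [:: s1; s2; s3] a) (nth None [:: s1; s2; s3] b).

Lemma pattern_spec312 X : pattern_spec ([:: 3; 1; 2] ++ X) pat312.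
Proof.
move=> s1 s2 s3; split=> [/and3P[l1 l2 l3] [|[|[|a]]] [|[|[|b]]] //|h].
by apply/and3P; split; [apply: (h 1 2)|apply: (h 2 0)|apply: (h 1 0)].
Qed.

Lemma pattern_spec231 X : pattern_spec ([:: 2; 3; 1] ++ X) pat231.
Proof.
move=> s1 s2 s3; split=> [/and3P[l1 l2 l3] [|[|[|a]]] [|[|[|b]]] //|h].
by apply/and3P; split; [apply: (h 2 0)|apply: (h 0 1)|apply: (h 2 1)].
Qed.

Lemma sorted_enum_ord c (A : {set 'I_c}) : sorted ltn (map val (enum A)).
Proof.
rewrite sorted_map /enum_mem -enumT; apply: sorted_filter.
  by move=> x y z; apply: ltn_trans.
by rewrite -sorted_map val_enum_ord iota_ltn_sorted.
Qed.

Section Transversals.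
Variables (c : nat) (lam : 'I_c -> nat) (H : {set 'I_c}).
Hypothesis lamF : ferrers lam.

Notation filling := {dffun forall j : 'I_c, (lam j).-tuple symbol}.
Implicit Types f : filling.

Definition prefill f : prefilling c := Prefilling H (fun j => f j : seq symbol).

Let S : {set filling} := [set f | `[< partial_transversal (prefill f) >]].
Let n := \max_j lam j.
Let vs := rev (iota 0 n).
Let len v := #|[set j | v < lam j]|.
Let hs := map val (enum H).
Let L := map val (enum (~: H)).
Let D v k := k < len v.

Definition col_row f (k : nat) : option nat :=
  if insub k is Some j then
    if j \in H then None else Some (index (Some true) (f j)) else None.

Definition row_col f (v : nat) : nat :=
  if [pick j | entry (prefill f) v j == Some true] is Some j then j : nat else 0.

Lemma height_prefill f j : height (prefill f) j = lam j.
Proof. by rewrite /height /= size_tuple. Qed.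

Lemma len_prefill f v : len v = row_length (prefill f) v.
Proof. by apply: eq_card => j; rewrite !inE height_prefill. Qed.

Lemma ltn_len v (j : 'I_c) : (j < len v) = (v < lam j).
Proof.
(* A filling of shape [lam] is needed only to invoke [row_lengthP]. *)
pose f : filling := finfun (fun j => nseq_tuple (lam j) None).
rewrite (len_prefill f) row_lengthP ?height_prefill // => a b ab.
by rewrite !height_prefill; apply: lamF.
Qed.

Section Member.
Variable f : filling.
Hypothesis fS : f \in S.

Lemma transversal_sparse : sparse_filling (prefill f).
Proof.
move: fS; rewrite inE => /asboolP[[fF fd] fr fc].
have ev i j : entry (prefill f) i j = Some true -> i < height (prefill f) j.
  by move=> e; rewrite ltnNge; apply/negP => h; move: e; rewrite /entry nth_default.
split=> // [i j j' e e'|i i' j e e'].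
  have lt : 0 < row_length (prefill f) i.
    by apply/card_gt0P; exists j; rewrite inE ev.
  move/eqP: (fr i lt) => /cards1P[x ex].
  have : j \in [set x] by rewrite -ex inE ev // e eqxx.
  have : j' \in [set x] by rewrite -ex inE ev // e' eqxx.
  by rewrite !inE => /eqP-> /eqP->.
have jH : j \notin H.
  by have := fd j _ (mem_nth (Some false) (ev _ _ e)); rewrite [nth _ _ _]e => <-.
have l1 := ev _ _ e; have l2 := ev _ _ e'.
move: (fc j jH) l1 l2 e e'; rewrite /entry /height.
elim: (col _ j) i i' => //= x s IH [|i] [|i'] //=; rewrite ?ltnS.
- move=> h _ il ex e'; move: h; rewrite ex eqxx add1n => -[] /eqP.
  by rewrite -leqn0 leqNgt -has_count has_pred1 -e' mem_nth.
- move=> h il _ e' ex; move: h; rewrite ex eqxx add1n => -[] /eqP.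
  by rewrite -leqn0 leqNgt -has_count has_pred1 -e' mem_nth.
move=> h il il' e1 e2; apply/(congr1 succn)/IH => //.
move: h; case: (x == Some true) => //; rewrite add1n => -[] /eqP.
by rewrite -leqn0 leqNgt -has_count has_pred1 -e1 mem_nth.
Qed.

Lemma entry_row_col v : v < n ->
  exists2 j : 'I_c, row_col f v = j & entry (prefill f) v j = Some true.
Proof.
move=> vn; have [j0 vj0] : exists j, v < lam j.
  have [c0|c0] := posnP c.
    by move: vn; rewrite /n big1 // => j; have := ltn_ord j; rewrite {2}c0.
  have [j e] := eq_bigmax lam (eq_ind_r (fun k => 0 < k) c0 (card_ord c)).
  by exists j; rewrite -e.
move: fS; rewrite inE => /asboolP[_ fr _].
have : 0 < row_length (prefill f) v.
  by apply/card_gt0P; exists j0; rewrite inE height_prefill.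
move/fr/eqP/cards1P => [x ex].
have : x \in [set x] by rewrite inE.
rewrite -ex inE => /andP[_ /eqP e].
rewrite /row_col; case: pickP => [j /eqP ej|/(_ x)]; last by rewrite e eqxx.
by exists j.
Qed.

Lemma row_colE v (j : 'I_c) : entry (prefill f) v j = Some true -> row_col f v = j.
Proof.
move=> e; rewrite /row_col; case: pickP => [j' /eqP ej|/(_ j)]; last by rewrite e eqxx.
by rewrite (sparse_row transversal_sparse ej e).
Qed.

Lemma entry_lt v (j : 'I_c) : entry (prefill f) v j = Some true -> v < lam j /\ j \notin H.
Proof.
move=> e; have lt : v < lam j.
  rewrite ltnNge; apply/negP => h; move: e.
  by rewrite /entry nth_default //= size_tuple.
split=> //; have := sparse_dcols transversal_sparse (mem_nth (Some false) (_ : v < size (col (prefill f) j))).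
by rewrite [nth _ _ _]e /= size_tuple lt => /(_ isT) <-.
Qed.

Lemma col_rowE v (j : 'I_c) : entry (prefill f) v j = Some true -> col_row f j = Some v.
Proof.
move=> e; have [vj jH] := entry_lt e.
rewrite /col_row valK (negPf jH); congr Some.
apply: (sparse_col transversal_sparse _ e); rewrite /entry /= nth_index //.
by rewrite -[Some true]e mem_nth //= size_tuple.
Qed.

Lemma col_row_standard (j : 'I_c) : j \notin H ->
  exists2 v, col_row f j = Some v & entry (prefill f) v j = Some true.
Proof.
move=> jH; exists (index (Some true) (f j)); first by rewrite /col_row valK (negPf jH).
move: fS; rewrite inE => /asboolP[_ _ /(_ j jH) h].
by rewrite /entry /= nth_index // -has_pred1 has_count h.
Qed.

Lemma col_row_hole (j : 'I_c) : j \in H -> col_row f j = None.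
Proof. by move=> jH; rewrite /col_row valK jH. Qed.

Lemma lam_le_n (j : 'I_c) : lam j <= n.
Proof. exact: leq_bigmax. Qed.

Lemma mem_vs v : (v \in vs) = (v < n).
Proof. by rewrite mem_rev mem_iota add0n. Qed.

Lemma row_col_perm : perm_eq (map (row_col f) vs) L.
Proof.
have vu : uniq vs by rewrite rev_uniq iota_uniq.
apply: uniq_perm.
- rewrite map_inj_in_uniq // => v w; rewrite !mem_vs => /entry_row_col[j -> e] /entry_row_col[j' -> e'].
  by move/val_inj => jj; rewrite -jj in e'; apply: (sparse_col transversal_sparse e e').
- by rewrite map_inj_uniq ?enum_uniq //; apply: val_inj.
move=> k; apply/mapP/mapP => [[v]|[j]].
  rewrite mem_vs => /entry_row_col[j -> e] ->; exists j => //.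
  by rewrite mem_enum inE; have [] := entry_lt e.
rewrite mem_enum inE => jH ->; have [v _ e] := col_row_standard jH.
exists v; last by rewrite (row_colE e).
by rewrite mem_vs; apply: leq_trans (entry_lt e).1 (lam_le_n j).
Qed.

(** Recovers the filling from the columns of its 1's, which yields injectivity of the
    parametrization. *)
Lemma entryE i (j : 'I_c) : i < lam j ->
  entry (prefill f) i j = if j \in H then None else Some (row_col f i == j).
Proof.
move=> ij; have il : i < size (col (prefill f) j) by rewrite /= size_tuple.
have := sparse_dcols transversal_sparse (mem_nth (Some false) il).
rewrite -/(entry _ i j) [dcols _]/=.
have [j0 e0 e1] := entry_row_col (leq_trans ij (lam_le_n j)).
case: ifP => _ e; first by apply/eqP; rewrite e.
case E: (entry _ i j) e => [b|] // _; congr Some; rewrite e0.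
case: b E => E; first by rewrite -(row_colE E) e0 eqxx.
by apply/esym/negbTE/eqP => /val_inj jj; move: E; rewrite -jj e1.
Qed.

Lemma mem_cols k : (k \in hs ++ L) = (k < c).
Proof.
rewrite mem_cat; apply/orP/idP => [|kc].
  by case=> /mapP[j _ ->]; apply: ltn_ord.
have [kH|kH] := boolP (Ordinal kc \in H).
  by left; apply/mapP; exists (Ordinal kc); rewrite // mem_enum.
by right; apply/mapP; exists (Ordinal kc); rewrite // mem_enum inE.
Qed.

Lemma partially_containsE p pat : size p = 3 -> pattern_spec p pat ->
  partially_contains p (prefill f) <-> occurs pat (col_row f) D (hs ++ L).
Proof.
move=> sp spec; split.
  case=> r [k [hk he ho]].
  have lt i : i < 3 -> i < size p by rewrite sp.
  pose o i (h : i < 3) := Ordinal (lt i h).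
  have vE a : k a \notin H -> col_row f (k a) = Some (r a).
    by move=> ka; apply: col_rowE; have [] := he a a ka.
  exists (k (o 0 isT) : nat), (k (o 1 isT) : nat), (k (o 2 isT) : nat); rewrite !mem_cols !ltn_ord; split=> //.
  have fit a : fits D (col_row f (k a)) (k (o 2 isT)).
    have [ka|ka] := boolP (k a \in H); first by rewrite col_row_hole.
    by rewrite vE //= /D ltn_len; have [_] := he a (o 2 isT) ka; rewrite height_prefill.
  apply/and5P; split; rewrite ?fit ?hk //.
  apply/spec => a b a3 b3 pab.
  have nE i (h : i < 3) : nth None [:: col_row f (k (o 0 isT)); col_row f (k (o 1 isT));
        col_row f (k (o 2 isT))] i = col_row f (k (o i h)).
    by case: i h => [|[|[|i]]] h //=; congr (col_row _ (val (k _))); apply/val_inj.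
  rewrite (nE a a3) (nE b b3).
  have [ka|ka] := boolP (k (o a a3) \in H); first by rewrite (col_row_hole ka).
  have [kb|kb] := boolP (k (o b b3) \in H).
    by rewrite (col_row_hole kb); case: col_row.
  by rewrite !vE //=; apply: ho.
case=> k1 [k2 [k3 []]]; rewrite !mem_cols => l1 l2 l3 /and5P[k12 k23 hp f1 /andP[f2 f3]].
pose o := [:: Ordinal l1; Ordinal l2; Ordinal l3].
pose k (a : 'I_(size p)) := nth (Ordinal l3) o a.
have k_le a : k a <= k3.
  rewrite /k; move: (val a) (ltn_ord a); rewrite sp => -[|[|[|//]]] _ /=; lia.
have kE (a : 'I_(size p)) : nth None [:: col_row f k1; col_row f k2; col_row f k3] a = col_row f (k a).
  by rewrite /k; move: (val a) (ltn_ord a); rewrite sp => -[|[|[|]]].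
have fit a : fits D (col_row f (k a)) k3.
  by rewrite -kE; move: (val a) (ltn_ord a); rewrite sp => -[|[|[|]]].
exists (fun a => odflt 0 (col_row f (k a))), k; split.
- move=> a b; rewrite /k; move: (val a) (val b) (ltn_ord a) (ltn_ord b); rewrite sp.
  by move=> [|[|[|?]]] [|[|[|?]]] //= _ _ _; apply: ltn_trans k12 k23.
- move=> a b ka; have [v ev e] := col_row_standard ka; rewrite ev /=; split=> //.
  have := fit a; rewrite ev /= /D height_prefill -[k3]/(val (Ordinal l3)) ltn_len => vl.
  by apply: leq_trans vl (lamF _); apply: k_le.
move=> a b ka kb pab; have a3 : a < 3 by rewrite -sp.
have b3 : b < 3 by rewrite -sp.
have := (spec _ _ _).1 hp a b a3 b3 pab; rewrite !kE.
by have [v -> _] := col_row_standard ka; have [w -> _] := col_row_standard kb.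
Qed.

Lemma avoids_occurs p pat : perm_eq p (iota 1 (size p)) -> size p = 3 ->
  pattern_spec p pat ->
  avoids (prefill f) p <-> ~ occurs pat (col_row f) D (hs ++ L).
Proof.
move=> pp sp spec; rewrite avoids_partially //; last exact: transversal_sparse.
by rewrite (partially_containsE sp spec).
Qed.
End Member.

Section Surjective.
Variable s : seq nat.
Hypothesis s_perm : perm_eq s L.
Hypothesis size_s : size s = size vs.
Hypothesis s_valid : forall i, i < size s -> D (nth 0 vs i) (nth 0 s i).

Let column i := nth 0 s (index i vs).

Definition filling_of : filling :=
  finfun (fun j : 'I_c => mktuple (fun i : 'I_(lam j) =>
    if j \in H then None else Some (column i == j)) : (lam j).-tuple symbol).

Lemma vs_uniq : uniq vs. Proof. by rewrite rev_uniq iota_uniq. Qed.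

Lemma s_uniq : uniq s.
Proof. by rewrite (perm_uniq s_perm) map_inj_uniq ?enum_uniq //; apply: val_inj. Qed.

Lemma index_vs v : v < n -> index v vs < size s.
Proof. by move=> vn; rewrite size_s index_mem mem_vs. Qed.

Lemma column_inj v w : v < n -> w < n -> column v = column w -> v = w.
Proof.
move=> vn wn /eqP; rewrite nth_uniq ?index_vs ?s_uniq // => /eqP e.
by rewrite -(nth_index 0 (_ : v \in vs)) ?mem_vs // e nth_index ?mem_vs.
Qed.

Lemma entry_filling_of v (j : 'I_c) : v < lam j ->
  entry (prefill filling_of) v j = if j \in H then None else Some (column v == j).
Proof.
move=> vj; rewrite /entry /= ffunE -[v]/(val (Ordinal vj)) -tnth_nth tnth_mktuple //.
Qed.

Lemma column_spec v : v < n ->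
  exists j : 'I_c, [/\ column v = j, j \notin H & v < lam j].
Proof.
move=> vn; have : column v \in L by rewrite -(perm_mem s_perm) mem_nth ?index_vs.
case/mapP=> j; rewrite mem_enum inE => jH e; exists j; split=> //.
have := s_valid (index_vs vn); rewrite nth_index ?mem_vs // -/(column v) e /D.
by rewrite ltn_len.
Qed.

Lemma column_surj (j : 'I_c) : j \notin H -> exists v, [/\ v < n, v < lam j & column v = j].
Proof.
move=> jH; have js : (j : nat) \in s.
  by rewrite (perm_mem s_perm); apply/mapP; exists j; rewrite // mem_enum inE.
have il : index (j : nat) s < size vs by rewrite -size_s index_mem.
have vn : nth 0 vs (index (j : nat) s) < n by rewrite -mem_vs mem_nth.
have e : column (nth 0 vs (index (j : nat) s)) = j.
  by rewrite /column index_uniq ?vs_uniq // nth_index.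
exists (nth 0 vs (index (j : nat) s)); split=> //.
by have [j' [e' _ ]] := column_spec vn; rewrite (_ : j = j') //; apply/val_inj; rewrite /= -e' e.
Qed.

Lemma filling_of_transversal : filling_of \in S.
Proof.
rewrite inE; apply/asboolP; split.
- split=> [a b ab|j x]; first by rewrite !height_prefill; apply: lamF.
  rewrite /= ffunE => /mapP[i _ ->]; by case: ifP.
- move=> i /card_gt0P[j0]; rewrite inE height_prefill => ij0.
  have iN : i < n := leq_trans ij0 (lam_le_n j0).
  have [j [e jH ij]] := column_spec iN.
  apply/eqP/cards1P; exists j; apply/setP => j'; rewrite !inE height_prefill.
  have [ij'|ij'] /= := ltnP i (lam j'); last first.
    by apply/esym/negbTE; apply: contraTneq ij' => ->; rewrite -ltnNge.
  rewrite entry_filling_of // e; case: ifP => [j'H|_].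
    by apply/esym/negbTE; apply: contraNneq jH => <-.
  by rewrite [RHS]eq_sym -val_eqE /=; case: (val j == val j').
move=> j jH; have [v [vn vj e]] := column_surj jH.
rewrite /= ffunE count_map.
rewrite (eq_count (a2 := preim val (pred1 v))); last first.
  move=> i /=; rewrite (negPf jH).
  have iN := leq_trans (ltn_ord i) (lam_le_n j).
  apply/eqP/eqP => [[/eqP ei]|ei]; last by rewrite ei e eqxx.
  by apply: column_inj => //; rewrite ei.
by rewrite -count_map val_enum_ord count_uniq_mem ?iota_uniq // mem_iota vj.
Qed.

Lemma row_col_filling_of : map (row_col filling_of) vs = s.
Proof.
have -> : map (row_col filling_of) vs = map column vs.
  apply/eq_in_map => v; rewrite mem_vs => vn.
  have [j [e jH vj]] := column_spec vn.
  rewrite e; apply: row_colE; first exact: filling_of_transversal.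
  by rewrite entry_filling_of // (negPf jH) e eqxx.
apply: (@eq_from_nth _ 0); rewrite size_map // => i il.
by rewrite (nth_map 0) // /column index_uniq ?vs_uniq.
Qed.
End Surjective.

Lemma num_avoiding_eq : num_avoiding_transversals lam H [:: 3; 1; 2]
  = num_avoiding_transversals lam H [:: 2; 3; 1].
Proof.
have split_set p : num_avoiding_transversals lam H p
    = #|[set f in S | `[< avoids (prefill f) p >] ]|.
  rewrite /num_avoiding_transversals; apply: eq_card => f; rewrite !inE.
  by apply/asboolP/andP => [[h1 h2]|[/asboolP h1 /asboolP h2]]; split=> //; apply/asboolP.
rewrite !split_set.
apply: (@class_card_eq _ S vs len hs L D col_row row_col).
- by rewrite /vs rev_sorted; apply: iota_ltn_sorted.
- rewrite /vs sorted_map rev_sorted.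
  apply: (@sub_sorted _ ltn) (iota_ltn_sorted 0 n) => v w vw /=.
  by apply/subset_leq_card/subsetP => j; rewrite !inE; apply: ltn_trans.
- exact: sorted_enum_ord.
- exact: sorted_enum_ord.
- apply/allP => _ /mapP[j + ->]; rewrite mem_enum inE => jH.
  by apply/negP => /mapP[j' + /val_inj e]; rewrite mem_enum -e (negPf jH).
- move=> v w k vw; rewrite /D => /leq_trans; apply.
  by apply/subset_leq_card/subsetP => j; rewrite !inE; apply: leq_ltn_trans.
- by [].
- exact: row_col_perm.
- move=> f v fS; rewrite mem_vs => /(entry_row_col fS)[j -> e].
  by rewrite /D ltn_len; have [] := entry_lt fS e.
- move=> f v fS; rewrite mem_vs => /(entry_row_col fS)[j -> e].
  exact: col_rowE.
- by move=> f o fS /mapP[j + ->]; rewrite mem_enum => /col_row_hole.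
- move=> f f' fS f'S e.
  have e' v : v < n -> row_col f v = row_col f' v.
    by move=> vn; move/eq_in_map: e; apply; rewrite mem_vs.
  apply/ffunP => j; apply/val_inj/(@eq_from_nth _ (Some false)); rewrite !size_tuple // => i ij.
  rewrite -[nth _ (f j) i]/(entry (prefill f) i j) -[nth _ (f' j) i]/(entry (prefill f') i j).
  by rewrite !entryE // e' //; apply: leq_trans ij (lam_le_n j).
- by move=> s ps ss vls; exists (filling_of s); [apply: filling_of_transversal|apply: row_col_filling_of].
- move=> f fS; have pp : perm_eq [:: 3; 1; 2] (iota 1 (size [:: 3; 1; 2])) by [].
  have e := avoids_occurs fS pp erefl (pattern_spec312 [::]).
  by split=> [/asboolP/e|/e h] //; apply/asboolP.
- move=> f fS; have pp : perm_eq [:: 2; 3; 1] (iota 1 (size [:: 2; 3; 1])) by [].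
  have e := avoids_occurs fS pp erefl (pattern_spec231 [::]).
  by split=> [/asboolP/e|/e h] //; apply/asboolP.
Qed.
End Transversals.

(** * Patterns in partial permutations *)

Lemma count_nth (a : pred nat) s :
  count a s = count (fun i => a (nth 0 s i)) (iota 0 (size s)).
Proof. by rewrite -[in LHS](mkseq_nth 0 s) /mkseq count_map. Qed.

Lemma size_standardization s : size (standardization s) = size s.
Proof. exact: size_map. Qed.

Lemma standardization_lt s i j : i < size s -> j < size s ->
  (nth 0 (standardization s) i < nth 0 (standardization s) j) = (nth 0 s i < nth 0 s j).
Proof.
move=> il jl; rewrite !(nth_map 0) //.
have mono x y : x <= y -> count (fun z => z <= x) s <= count (fun z => z <= y) s.
  by move=> xy; apply: sub_count => z /= zx; apply: leq_trans zx xy.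
have [ij|ji] := ltnP (nth 0 s i) (nth 0 s j); last by rewrite ltnNge mono.
set x := nth 0 s i in ij *; set y := nth 0 s j in ij *.
have -> : count (fun z => z <= y) s =
    count (fun z => z <= x) s + count (fun z => x < z <= y) s.
  rewrite -count_predUI [X in _ + X](eq_count (a2 := pred0)); last by move=> z /=; lia.
  by rewrite count_pred0 addn0; apply: eq_count => z /=; lia.
rewrite -[X in X < _]addn0 ltn_add2l -has_count; apply/hasP; exists y; first exact: mem_nth.
by rewrite ij leqnn.
Qed.

Lemma standardization_iso s t : size s = size t ->
  (forall i j, i < size s -> j < size s ->
    (nth 0 s i < nth 0 s j) = (nth 0 t i < nth 0 t j)) ->
  standardization s = standardization t.
Proof.
move=> st h; apply: (@eq_from_nth _ 0); rewrite !size_standardization // => i il.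
have il' : i < size t by rewrite -st.
rewrite (nth_map 0 _ _ il) (nth_map 0 _ _ il') count_nth [RHS]count_nth -st.
apply: eq_in_count => j; rewrite mem_iota add0n => /andP[_ jl] /=.
by rewrite leqNgt (h i j il jl) -leqNgt.
Qed.

Lemma standardization_id p : perm_eq p (iota 1 (size p)) -> standardization p = p.
Proof.
move=> pp; apply: (@eq_from_nth _ 0); rewrite size_standardization // => i il.
rewrite (nth_map 0) // (seq.permP pp).
have : nth 0 p i \in iota 1 (size p) by rewrite -(perm_mem pp) mem_nth.
rewrite mem_iota; move: (nth 0 p i) (size p) => x m xm.
have -> : iota 1 m = iota 1 x ++ iota x.+1 (m - x).
  by rewrite -[x.+1]addn1 addnC -iotaD subnKC //; lia.
rewrite count_cat (eq_in_count (a2 := predT)); last by move=> y; rewrite mem_iota /=; lia.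
rewrite count_predT size_iota (eq_in_count (a2 := pred0)) ?count_pred0 ?addn0 //.
by move=> y; rewrite mem_iota /=; lia.
Qed.

Lemma standardizationP s p : perm_eq p (iota 1 (size p)) ->
  standardization s = p <-> size s = size p /\
  forall i j, i < size s -> j < size s ->
    (nth 0 s i < nth 0 s j) = (nth 0 p i < nth 0 p j).
Proof.
move=> pp; split=> [<-|[sp h]].
  by rewrite size_standardization; split=> // i j il jl; rewrite standardization_lt.
by rewrite -[RHS](standardization_id pp); apply: standardization_iso.
Qed.

Definition order_iso (val : nat -> option nat) (ks p : seq nat) : Prop :=
  forall a b x y, a < size p -> b < size p ->
    val (nth 0 ks a) = Some x -> val (nth 0 ks b) = Some y ->
    (x < y) = (nth 0 p a < nth 0 p b).

Section PartialPermutations.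
Variable n : nat.
Implicit Types pi : n.-tuple (option 'I_n.+1).

Definition letter pi (k : nat) : option nat :=
  if insub k is Some j then omap (@nat_of_ord _) (tnth pi (j : 'I_n)) else None.

Definition has_pattern pi (p : seq nat) : Prop :=
  exists ks : seq nat, [/\ sorted ltn ks, all (fun k => k < n) ks,
    size ks = size p & order_iso (letter pi) ks p].

Lemma letterE pi (j : 'I_n) : letter pi j = omap (@nat_of_ord _) (tnth pi j).
Proof. by rewrite /letter valK. Qed.

Lemma letter_lt pi k x : letter pi k = Some x -> k < n /\ x <= n.
Proof.
rewrite /letter; case: insubP => // j kn _; case: (tnth pi j) => [v|] //= vx.
by split=> //; rewrite -ltnS; have := ltn_ord v; rewrite (Some_inj vx).
Qed.

Lemma letter_hole pi (j : 'I_n) : (letter pi j == None) = (j \in holes pi).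
Proof. by rewrite letterE inE; case: (tnth pi j). Qed.

Definition standard pi : seq 'I_n := [seq j <- enum 'I_n | j \notin holes pi].

Lemma nonholesE pi : nonholes pi = [seq odflt 0 (letter pi j) | j : 'I_n <- standard pi].
Proof.
rewrite /nonholes /standard -[in LHS](map_tnth_enum pi).
elim: (enum 'I_n) => //= j s IH; have := letterE pi j.
by rewrite inE; case E: (tnth pi j) => [v|] //= e; rewrite IH e.
Qed.

Lemma mem_standard pi j : (j \in standard pi) = (j \notin holes pi).
Proof. by rewrite mem_filter mem_enum andbT. Qed.

Lemma size_standard pi : size (standard pi) = n - #|holes pi|.
Proof.
have e := cardsC (holes pi); rewrite card_ord in e.
have -> : n - #|holes pi| = #|~: holes pi| by lia.
rewrite cardE.
congr size; rewrite /standard [in RHS]/enum_mem -enumT; apply: eq_filter => j.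
by rewrite /= !inE.
Qed.

Lemma partial_permP pi : partial_perm pi <->
  (forall j x, letter pi j = Some x -> 0 < x <= n - #|holes pi|) /\
  (forall j j' x, letter pi j = Some x -> letter pi j' = Some x -> j = j').
Proof.
have us : uniq (standard pi) by rewrite filter_uniq ?enum_uniq.
have st j x : letter pi j = Some x -> exists2 i : 'I_n, i \in standard pi & j = i.
  move=> e; have [jn _] := letter_lt e; exists (Ordinal jn) => //.
  by rewrite mem_standard -letter_hole e.
rewrite /partial_perm nonholesE; split.
  move=> pp; have u : uniq [seq odflt 0 (letter pi j) | j : 'I_n <- standard pi].
    by rewrite (perm_uniq pp) iota_uniq.
  split=> [j x e|j j' x e e'].
    have [i iS ji] := st j x e.
    have : x \in iota 1 (n - #|holes pi|).
      by rewrite -(perm_mem pp); apply/mapP; exists i; rewrite // -ji e.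
    by rewrite mem_iota; lia.
  have [i is_ ji] := st _ _ e; have [i' is' ji'] := st _ _ e'.
  have l1 : index i (standard pi) < size (standard pi) by rewrite index_mem.
  have l2 : index i' (standard pi) < size (standard pi) by rewrite index_mem.
  have := nth_uniq 0 (s := [seq odflt 0 (letter pi j) | j : 'I_n <- standard pi])
    (i := index i (standard pi)) (j := index i' (standard pi)).
  rewrite size_map l1 l2 u !(nth_map i) // !nth_index // -ji -ji' e e' eqxx => /(_ isT isT isT).
  move/esym/eqP => ii.
  by rewrite ji ji' -(nth_index i is_) ii nth_index.
case=> rng inj; apply: uniq_perm; rewrite ?iota_uniq //.
  rewrite map_inj_in_uniq // => i j; rewrite !mem_standard -!letter_hole.
  case Ei: (letter pi i) => [x|] // _; case Ej: (letter pi j) => [y|] // _ /= xy.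
  by apply/val_inj; apply: inj Ei _; rewrite xy.
have u : uniq [seq odflt 0 (letter pi j) | j : 'I_n <- standard pi].
  rewrite map_inj_in_uniq // => i j; rewrite !mem_standard -!letter_hole.
  case Ei: (letter pi i) => [x|] // _; case Ej: (letter pi j) => [y|] // _ /= xy.
  by apply/val_inj; apply: inj Ei _; rewrite xy.
have sub : {subset [seq odflt 0 (letter pi j) | j : 'I_n <- standard pi] <= iota 1 (n - #|holes pi|)}.
  move=> x /mapP[j]; rewrite mem_standard -letter_hole.
  case Ej: (letter pi j) => [y|] // _ -> /=; rewrite mem_iota add1n ltnS.
  exact: rng _ _ Ej.
have [|_ e] := uniq_min_size u sub; first by rewrite size_iota size_map size_standard.
exact: e.
Qed.
Lemma perm_extensionP pi (s : 'S_n) : partial_perm pi ->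
  perm_extension pi s <-> forall (i j : 'I_n) x y,
    letter pi i = Some x -> letter pi j = Some y -> (x < y) = (s i < s j).
Proof.
move=> pp; rewrite /perm_extension nonholesE -/(standard pi).
have pv : perm_eq [seq odflt 0 (letter pi j) | j : 'I_n <- standard pi]
    (iota 1 (size [seq odflt 0 (letter pi j) | j : 'I_n <- standard pi])).
  by rewrite size_map size_standard -nonholesE.
rewrite (standardizationP _ pv) !size_map; split.
  case=> _ h i j x y ei ej.
  have iS : i \in standard pi by rewrite mem_standard -letter_hole ei.
  have jS : j \in standard pi by rewrite mem_standard -letter_hole ej.
  have := h (index i (standard pi)) (index j (standard pi)).
  rewrite !index_mem => /(_ iS jS).
  by rewrite !(nth_map i) ?index_mem // !nth_index // ei ej /= ltnS => <-.
move=> h; split=> // a b al bl.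
have [i0 _] : exists i0 : 'I_n, True by case: (standard pi) al => // i0 *; exists i0.
rewrite !(nth_map i0) // ltnS.
have := mem_nth i0 al; have := mem_nth i0 bl; rewrite !mem_standard -!letter_hole.
case Ea: (letter pi (nth i0 _ a)) => [x|] //; case Eb: (letter pi (nth i0 _ b)) => [y|] // _ _ /=.
by rewrite (h _ _ _ _ Ea Eb).
Qed.

Lemma classically_containsP (s : 'S_n) p : perm_eq p (iota 1 (size p)) ->
  classically_contains (perm_word s) p <-> exists js : seq 'I_n,
    [/\ sorted ltn (map val js), size js = size p &
       forall j0 a b, a < size p -> b < size p ->
         (s (nth j0 js a) < s (nth j0 js b)) = (nth 0 p a < nth 0 p b)].
Proof.
move=> pp; split.
  case=> t /subseqP[m _ ->] /(standardizationP _ pp).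
  rewrite /perm_word -map_mask size_map => -[sp h]; exists (mask m (enum 'I_n)); split=> //.
    rewrite map_mask val_enum_ord; apply: (subseq_sorted ltn_trans (mask_subseq _ _)).
    exact: iota_ltn_sorted.
  move=> j0 a b; rewrite -sp => al bl; rewrite -h // !(nth_map j0) //.
case=> js [sj sz h]; exists [seq (s j).+1 | j <- js].
  rewrite /perm_word; apply: map_subseq.
  suff -> : js = [seq j <- enum 'I_n | j \in js] by apply: filter_subseq.
  apply: (inj_map val_inj); apply: (irr_sorted_eq ltn_trans ltnn) => //.
    apply: (subseq_sorted ltn_trans (map_subseq _ (filter_subseq _ _))).
    by rewrite val_enum_ord iota_ltn_sorted.
  by apply: eq_mem_map => j; rewrite mem_filter mem_enum andbT.
apply/(standardizationP _ pp); rewrite size_map; split=> // a b al bl.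
have [j0 _] : exists j0 : 'I_n, True by case: (js) al => // i0 *; exists i0.
by rewrite !(nth_map j0) // ltnS h -?sz.
Qed.
Lemma rank_perm (key : 'I_n -> nat) : injective key ->
  exists s : 'S_n, forall i j, (s i < s j) = (key i < key j).
Proof.
move=> key_inj.
pose below i := [set j | key j < key i].
have mono i j : (#|below i| < #|below j|) = (key i < key j).
  have [ij|ji] := ltnP (key i) (key j).
    apply/proper_card/properP; split.
      by apply/subsetP => k; rewrite !inE => /ltn_trans; apply.
    by exists i; rewrite !inE ?ij ?ltnn.
  rewrite ltnNge; apply/negbTE/negPn/subset_leq_card/subsetP => k; rewrite !inE.
  by move/leq_trans; apply.
have lt i : #|below i| < n.
  rewrite -[X in _ < X]card_ord; apply/proper_card/properP; split; first exact/subsetP.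
  by exists i; rewrite // inE ltnn.
have inj : injective (fun i => Ordinal (lt i)).
  move=> i j [e]; apply: key_inj.
  by case: (ltngtP (key i) (key j)) => // h; [have := mono i j | have := mono j i]; rewrite h e ltnn.
by exists (perm inj) => i j; rewrite !permE /= mono.
Qed.

(** * An extension that realizes a given occurrence *)

Section Keys.
Variables (pi : n.-tuple (option 'I_n.+1)) (ks p : seq nat).
Hypothesis ppi : partial_perm pi.
Hypothesis pp : perm_eq p (iota 1 (size p)).
Hypothesis ks_sorted : sorted ltn ks.
Hypothesis size_ks : size ks = size p.
Hypothesis ks_iso : order_iso (letter pi) ks p.

(** [M] exceeds every letter of [p], so the letter of [p] added to a multiple of [M] in a key is a
    remainder and can be read off modulo [M]. *)
Let M := (size p).+1.

(** The largest letter of the occurrence that plays a role smaller than [x]; a hole counts as 0. *)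
Definition base (x : nat) : nat :=
  \max_(b < size p | nth 0 p b < x) odflt 0 (letter pi (nth 0 ks b)).

(* Multiples of [M] are the keys of the letters of [pi]; the holes in the
   occurrence are placed just above the letters playing smaller roles. *)
Definition key (j : nat) : nat :=
  if letter pi j is Some x then x * M
  else if j \in ks then base (nth 0 p (index j ks)) * M + nth 0 p (index j ks)
  else n.+1 * M + j.

Lemma p_range a : a < size p -> 0 < nth 0 p a < M.
Proof.
move=> al; have : nth 0 p a \in iota 1 (size p) by rewrite -(perm_mem pp) mem_nth.
by rewrite mem_iota add1n.
Qed.

Lemma base_le x : base x <= n.
Proof.
apply/bigmax_leqP => b _; case e: (letter _ _) => [y|] //=.
by have [] := letter_lt e.
Qed.

Lemma letter_pos j x : letter pi j = Some x -> 0 < x.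
Proof. by have [h _] := (partial_permP pi).1 ppi => /h/andP[]. Qed.

Lemma ks_uniq : uniq ks.
Proof. exact: sorted_uniq ltn_trans ltnn _ ks_sorted. Qed.

(** [base] grows with the role, is at least every letter of smaller role and less than every letter
    of larger role; holes with equal [base] are separated by their roles. *)
Lemma key_mono a b : a < size p -> b < size p -> nth 0 p a < nth 0 p b ->
  key (nth 0 ks a) < key (nth 0 ks b).
Proof.
move=> al bl ab; rewrite /key !mem_nth ?size_ks // !index_uniq ?size_ks ?ks_uniq //.
have /andP[a0 aM] := p_range al; have /andP[b0 bM] := p_range bl.
case ea: (letter pi (nth 0 ks a)) => [x|]; case eb: (letter pi (nth 0 ks b)) => [y|].
- by rewrite ltn_pmul2r // (ks_iso al bl ea eb).
- have : x <= base (nth 0 p b).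
    rewrite /base (bigD1 (Ordinal al)) //= ea /=; exact: leq_maxl.
  move=> xb; apply: leq_ltn_trans (leq_mul xb (leqnn M)) _.
  by rewrite -[X in X < _]addn0 ltn_add2l.
- have : base (nth 0 p a) < y.
    rewrite ltnNge; apply/negP; rewrite leqNgt => /negP; apply.
    have y0 := letter_pos eb.
    rewrite -(prednK y0) ltnS; apply/bigmax_leqP => d pd.
    case ed: (letter pi (nth 0 ks d)) => [z|] //=.
    by rewrite -ltnS prednK // (ks_iso _ bl ed eb) //; apply: ltn_trans pd ab.
  move=> ba; apply: leq_trans (leq_mul ba (leqnn M)).
  by rewrite mulSn addnC ltn_add2r.
have : base (nth 0 p a) <= base (nth 0 p b).
  apply/bigmax_leqP => d pd; rewrite [X in _ <= X]/base (bigD1 d) /=; first exact: leq_maxl.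
  exact: ltn_trans pd ab.
move=> bb; apply: leq_ltn_trans (_ : _ <= base (nth 0 p b) * M + nth 0 p a) _.
  by rewrite leq_add2r leq_mul.
by rewrite ltn_add2l.
Qed.

Lemma key_other j : letter pi j = None -> j \notin ks -> n.+1 * M <= key j.
Proof. by move=> e jk; rewrite /key e (negPf jk) leq_addr. Qed.

Lemma key_small j : (letter pi j != None) || (j \in ks) -> key j < n.+1 * M.
Proof.
rewrite /key; case e: (letter pi j) => [x|] /=.
  by move=> _; rewrite ltn_pmul2r // ltnS; have [] := letter_lt e.
move=> jk; rewrite jk; have jl : index j ks < size p by rewrite -size_ks index_mem.
have /andP[_ h] := p_range jl.
apply: leq_trans (_ : (base (nth 0 p (index j ks))).+1 * M <= _).
  by rewrite mulSn addnC ltn_add2r.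
by rewrite leq_mul // ltnS base_le.
Qed.

Lemma key_inj j j' : key j = key j' -> j = j'.
Proof.
have case_small i : (letter pi i != None) || (i \in ks) \/ letter pi i = None /\ i \notin ks.
  case: (letter pi i) => [x|] /=; first by left.
  by case: (boolP (i \in ks)); [left|right].
case: (case_small j) => [sj|[ej nj]]; case: (case_small j') => [sj'|[ej' nj']].
- move: sj sj'; rewrite /key.
  have kidx i : i \in ks -> nth 0 ks (index i ks) = i by apply: nth_index.
  have kM i : i \in ks -> 0 < nth 0 p (index i ks) < M.
    by move=> ik; apply: p_range; rewrite -size_ks index_mem.
  case ej: (letter pi j) => [x|]; case ej': (letter pi j') => [y|] //=.
  + move=> _ _ /eqP; rewrite eqn_pmul2r // => /eqP xy.
    by have [_ h] := (partial_permP pi).1 ppi; apply: h ej _; rewrite xy.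
  + move=> _ jk; rewrite jk => /(congr1 (modn^~ M)).
    have /andP[h1 h2] := kM _ jk.
    by rewrite modnMl modnMDl modn_small // => e; rewrite -e in h1.
  + move=> jk _; rewrite jk => /(congr1 (modn^~ M)).
    have /andP[h1 h2] := kM _ jk.
    by rewrite modnMl modnMDl modn_small // => e; rewrite e in h1.
  move=> jk jk'; rewrite jk jk' => /(congr1 (modn^~ M)).
  have /andP[_ h] := kM _ jk; have /andP[_ h'] := kM _ jk'.
  rewrite !modnMDl !modn_small // => /eqP.
  rewrite nth_uniq -?size_ks ?index_mem ?(perm_uniq pp) ?iota_uniq // => /eqP e.
  by rewrite -(kidx _ jk) e kidx.
- by move=> e; have := key_small sj; rewrite e ltnNge key_other.
- by move=> e; have := key_small sj'; rewrite -e ltnNge key_other.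
by rewrite /key ej ej' (negPf nj) (negPf nj') => /addnI.
Qed.
End Keys.

Lemma ord_seq ks : all (fun k => k < n) ks -> exists js : seq 'I_n, map val js = ks.
Proof.
elim: ks => [|k ks IH] /=; first by exists [::].
by case/andP=> kn /IH[js <-]; exists (Ordinal kn :: js).
Qed.

Lemma avoids_has_pattern pi p : partial_perm pi -> perm_eq p (iota 1 (size p)) ->
  partial_perm_avoids pi p <-> ~ has_pattern pi p.
Proof.
move=> ppi pp; split.
  move=> av [ks [sks ksn sz iso]].
  have [|s hs] := @rank_perm (fun j => key pi ks p j).
    by move=> i j /(key_inj ppi pp sz) /val_inj.
  apply: (av s).
    apply/perm_extensionP => // i j x y ei ej; rewrite hs /key ei ej ltn_pmul2r //.
  apply/classically_containsP => //.
  have [js ejs] := ord_seq ksn; have sjs : size js = size p by rewrite -sz -ejs size_map.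
  exists js; split; rewrite ?ejs // => j0 a b al bl; rewrite hs.
  have vE i : i < size p -> nat_of_ord (nth j0 js i) = nth 0 ks i.
    by move=> il; rewrite -ejs (nth_map j0) // sjs.
  rewrite !vE //.
  have mono := key_mono ppi pp sks sz iso.
  have [lt|le] := ltnP (nth 0 p a) (nth 0 p b); first exact: mono.
  apply/negbTE; rewrite -leqNgt leq_eqVlt; move: le; rewrite leq_eqVlt => /orP[|h].
    by rewrite nth_uniq ?(perm_uniq pp) ?iota_uniq // => /eqP->; rewrite eqxx.
  by rewrite mono // orbT.
move=> no s /(perm_extensionP _ ppi) ext /(classically_containsP _ pp) [js [sj sz h]].
apply: no; exists (map val js); split=> //.
- by apply/allP => _ /mapP[j _ ->]; apply: ltn_ord.
- by rewrite size_map.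
move=> a b x y al bl.
have [j0 _] : exists j0 : 'I_n, True by case: (js) sz al => [<-|i0 *] //; exists i0.
rewrite !(nth_map j0) ?sz // => ea eb.
by rewrite (ext _ _ _ _ ea eb) h.
Qed.
End PartialPermutations.

(** * Patterns with a suffix *)

Section Suffix.
Variables (n : nat) (X : seq nat).
Hypothesis X_big : all (fun x => 3 < x) X.
Implicit Types pi : n.-tuple (option 'I_n.+1).

(* The cell in row [v] and column [j] has an occurrence of [X] strictly above it
   and to its right, once the holes are suitably filled. *)
Definition suffix_above pi (v j : nat) : bool :=
  `[< j < n /\ exists ks, [/\ path ltn j ks, all (fun k => k < n) ks,
       size ks = size X, order_iso (letter pi) ks X &
       forall k x, k \in ks -> letter pi k = Some x -> v < x] >].

Lemma suffix_above_lt pi v j : suffix_above pi v j -> j < n.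
Proof. by case/asboolP. Qed.

Lemma suffix_above_anti pi v v' j j' : v <= v' -> j <= j' ->
  suffix_above pi v' j' -> suffix_above pi v j.
Proof.
move=> vv jj /asboolP[jn [ks [pk kn sk ik hk]]]; apply/asboolP; split.
  exact: leq_ltn_trans jj jn.
exists ks; split=> //.
  case: ks pk {kn sk ik hk} => //= k ks /andP[jk ->]; rewrite andbT.
  exact: leq_ltn_trans jj jk.
by move=> k x kk e; apply: leq_ltn_trans vv _; apply: hk e.
Qed.

(** The condition [suffix_above pi 0 k3] is stated separately because [occ3] requires no cell when
    all three positions are holes. *)
Lemma has_patternP pi p pat : size p = 3 -> pattern_spec p pat -> uniq p ->
  all (fun x => x <= 3) p -> partial_perm pi ->
  has_pattern pi (p ++ X) <-> exists k1 k2 k3,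
    occ3 pat (letter pi) (suffix_above pi) k1 k2 k3 /\ suffix_above pi 0 k3.
Proof.
move=> sp spec up p_small ppi.
have cross a b : a < 3 -> b < size X -> nth 0 p a < nth 0 X b.
  move=> a3 bX; have := all_nthP 0 p_small a; rewrite sp => /(_ a3).
  by have := all_nthP 0 X_big b bX; lia.
have cL a : a < 3 -> nth 0 (p ++ X) a = nth 0 p a by move=> a3; rewrite nth_cat sp a3.
have cR b : nth 0 (p ++ X) (3 + b) = nth 0 X b by rewrite nth_cat sp ltnNge leq_addr /= addKn.
split.
  case=> -[|k1 [|k2 [|k3 ks]]]; [by case; rewrite size_cat sp | by case; rewrite size_cat sp
    | by case; rewrite size_cat sp |].
  case; rewrite [sorted _ _]/= => /and3P[k12 k23 pk] /and4P[n1 n2 n3 kn].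
  rewrite size_cat sp => -[sk0] iso; exists k1, k2, k3.
  have sk : size ks = size X := sk0.
  have isoX : order_iso (letter pi) ks X.
    move=> a b x y aX bX ea eb; rewrite -!cR; apply: iso => //;
    by rewrite size_cat sp ltn_add2l.
  have fit a v : a < 3 -> letter pi (nth 0 [:: k1; k2; k3] a) = Some v ->
      suffix_above pi v k3.
    move=> a3 ea; apply/asboolP; split=> //; exists ks; split=> // k x kk ex.
    have kl : index k ks < size X by rewrite -sk index_mem.
    rewrite (iso a (3 + index k ks) v x) ?size_cat ?sp ?ltn_add2l //.
    - by rewrite cL // cR cross.
    - exact: leq_trans a3 (leq_addr _ _).
    - by case: a a3 ea => [|[|[|]]].
    by rewrite /= nth_index.
  split; last first.
    apply/asboolP; split=> //; exists ks; split=> // k x _; exact: letter_pos.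
  apply/and5P; split=> //.
    apply/spec => a b a3 b3 pab.
    have nE i : i < 3 -> nth None [:: letter pi k1; letter pi k2; letter pi k3] i =
        letter pi (nth 0 [:: k1; k2; k3] i) by case: i => [|[|[|]]].
    rewrite !nE // /lower.
    case ea: (letter pi (nth 0 _ a)) => [x|] //; case eb: (letter pi (nth 0 _ b)) => [y|] //.
    rewrite (iso a b x y) ?cL ?size_cat ?sp //.
    - exact: leq_trans a3 (leq_addr _ _).
    - exact: leq_trans b3 (leq_addr _ _).
    - by case: a a3 ea {pab} => [|[|[|]]].
    by case: b b3 eb {pab} => [|[|[|]]].
  - by rewrite /fits; case e: (letter pi k1) => [v|] //; apply: (fit 0).
  - rewrite /fits; apply/andP; split.
      by case e: (letter pi k2) => [v|] //; apply: (fit 1).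
    by case e: (letter pi k3) => [v|] //; apply: (fit 2).
case=> k1 [k2 [k3 [/and5P[k12 k23 hp f1 /andP[f2 f3]] f0]]].
pose ks0 := [:: k1; k2; k3].
(* Each of the three letters comes with its own occurrence of [X]; the one for the largest letter
   lies above all three. *)
have [v fv vmax] : exists2 v, suffix_above pi v k3 &
    forall a x, a < 3 -> letter pi (nth 0 ks0 a) = Some x -> x <= v.
  pose w k := odflt 0 (letter pi k).
  have fw k : fits (suffix_above pi) (letter pi k) k3 -> suffix_above pi (w k) k3.
    by rewrite /w; case: (letter pi k).
  exists (maxn (w k1) (maxn (w k2) (w k3))).
    by rewrite /maxn; case: ifP => _; [case: ifP => _|]; apply: fw.
  move=> [|[|[|]]] //= x _ e; rewrite !leq_max /w e leqnn ?orbT //.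
have [k3n [ks [pk kn sk ik hk]]] := asboolP _ fv.
exists (ks0 ++ ks); split.
- by rewrite /= k12 k23.
- by rewrite /= kn k3n (ltn_trans k23 k3n) (ltn_trans k12 (ltn_trans k23 k3n)).
- by rewrite !size_cat sp sk.
have c0 a : a < 3 -> nth 0 (ks0 ++ ks) a = nth 0 ks0 a by move=> a3; rewrite nth_cat a3.
have c1 b : nth 0 (ks0 ++ ks) (3 + b) = nth 0 ks b.
  by rewrite nth_cat (_ : size ks0 = 3) // ltnNge leq_addr addKn.
have lowerP a b x y : a < 3 -> b < 3 -> nth 0 p a < nth 0 p b ->
    letter pi (nth 0 ks0 a) = Some x -> letter pi (nth 0 ks0 b) = Some y -> x < y.
  move=> a3 b3 pab ea eb; have := (spec _ _ _).1 hp a b a3 b3 pab.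
  have nE i : i < 3 -> nth None [:: letter pi k1; letter pi k2; letter pi k3] i =
      letter pi (nth 0 ks0 i) by case: i => [|[|[|]]].
  by rewrite !nE // ea eb.
have small a x b y : a < 3 -> letter pi (nth 0 ks0 a) = Some x -> b < size X ->
    letter pi (nth 0 ks b) = Some y -> x < y.
  move=> a3 ea bX eb; apply: leq_ltn_trans (vmax a x a3 ea) _.
  by apply: hk eb; rewrite mem_nth ?sk.
have cases a : a < size (p ++ X) -> a < 3 \/ exists2 b, b < size X & a = 3 + b.
  rewrite size_cat sp; have [a3|a3] := ltnP a 3; first by left.
  by right; exists (a - 3); rewrite -1?(ltn_add2l 3) subnKC.
move=> a b x y /cases[a3|[a' aX ->]] /cases[b3|[b' bX ->]].
- rewrite (c0 a a3) (c0 b b3) (cL a a3) (cL b b3) => ea eb.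
  have [lt|le] := ltnP (nth 0 p a) (nth 0 p b); first exact: lowerP ea eb.
  move: le; rewrite leq_eqVlt nth_uniq ?sp // => /orP[/eqP ab|lt].
    by move: eb; rewrite ab ea => -[->]; rewrite ltnn.
  by apply/negbTE; rewrite -leqNgt ltnW //; apply: lowerP eb ea.
- rewrite (c0 a a3) c1 (cL a a3) cR => ea eb.
  by rewrite (small a x b' y) // cross.
- rewrite (c0 b b3) c1 (cL b b3) cR => ea eb.
  have xy := small b y a' x b3 eb aX ea; have pp := cross b a' b3 aX.
  by rewrite ltnNge (ltnW xy) ltnNge (ltnW pp).
by rewrite !c1 !cR; apply: ik.
Qed.
End Suffix.

Lemma card_by_key (T K : finType) (U : {set T}) (A B : pred T) (key : T -> K) :
  (forall t0, t0 \in U ->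
     #|[set t in [set t in U | key t == key t0] | A t]|
     = #|[set t in [set t in U | key t == key t0] | B t]|) ->
  #|[set t in U | A t]| = #|[set t in U | B t]|.
Proof.
move=> h.
have e (P : pred T) : #|[set t in U | P t]| =
    \sum_k #|[set t in [set t in U | key t == k] | P t]|.
  rewrite -sum1_card (partition_big key predT) //=; apply: eq_bigr => k _.
  by rewrite -sum1_card; apply: eq_bigl => t; rewrite !inE andbAC.
rewrite !e; apply: eq_bigr => k _.
have [[t0 /andP[t0U /eqP <-]]|no] := pselect (exists t, (t \in U) && (key t == k)).
  exact: h.
by rewrite !eq_card0 // => t; rewrite !inE; apply/negP => /andP[tU _]; apply: no; exists t.
Qed.

(** * Rearranging the letters inside the diagram of cells below an occurrence of the suffix *)

Section Classes.
Variables (n : nat) (X : seq nat).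
Implicit Types pi : n.-tuple (option 'I_n.+1).

(** A live letter in the occurrence of [X] has an occurrence of [X] above it and to its right, which
    can be used instead. It starts further right, so the exchange ends with an occurrence made of
    positions that are not rearranged. *)
Lemma suffix_above_avoiding pi (live : pred nat) :
  (forall k, live k -> exists2 x, letter pi k = Some x & suffix_above X pi x k) ->
  forall v j, suffix_above X pi v j -> exists ks,
    [/\ path ltn j ks, all (fun k => k < n) ks, size ks = size X,
        order_iso (letter pi) ks X
      & (forall k x, k \in ks -> letter pi k = Some x -> v < x) /\
        forall k, k \in ks -> ~~ live k].
Proof.
move=> hl v j; move: {2}(n - j) (leqnn (n - j)) => m.
elim: m v j => [|m IH] v j nj; move=> sa; have jn := suffix_above_lt sa.
  by move: nj; rewrite leqn0 subn_eq0 leqNgt jn.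
move: sa => /asboolP[_ [ks [pk kn sk ik hk]]].
have [/hasP[k kk lk]|/hasPn no] := boolP (has live ks); last first.
  by exists ks; split=> //; split=> // k kk; apply: no.
have [x ex sx] := hl k lk.
have jk : j < k by apply: (allP (order_path_min ltn_trans pk)).
have [|ks' [pk' kn' sk' ik' [hk' nk']]] := IH x k _ sx; first by lia.
exists ks'; split=> //.
  case: ks' pk' {kn' sk' ik' hk' nk'} => //= k' ks' /andP[kk' ->].
  by rewrite (ltn_trans jk kk').
split=> // k' y k'k ey; apply: ltn_trans (hk k x kk ex) _; exact: hk' ey.
Qed.

(** Occurrences of [X] without live positions are common to [pi] and [pi']. One in [pi'] with a live
    position adds no cell: the cell of the letter there is already in the diagram of [pi], hence so
    are all cells below it and to its left. *)
Lemma suffix_above_eq pi pi' (live : pred nat) :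
  (forall k, ~~ live k -> letter pi k = letter pi' k) ->
  (forall k, live k -> exists2 x, letter pi k = Some x & suffix_above X pi x k) ->
  (forall k, live k -> exists2 x, letter pi' k = Some x & suffix_above X pi x k) ->
  forall v j, suffix_above X pi v j = suffix_above X pi' v j.
Proof.
have iso_eq (f g : nat -> option nat) ks : size ks = size X ->
    (forall k, k \in ks -> f k = g k) ->
    order_iso f ks X -> order_iso g ks X.
  by move=> sk fg iso a b x y aX bX; rewrite -!fg ?mem_nth ?sk //; apply: iso.
move=> off on on' v j; apply/idP/idP => [sa|/asboolP[jn [ks [pk kn sk ik hk]]]].
  have jn := suffix_above_lt sa.
  have [ks [pk kn sk ik [hk nk]]] := suffix_above_avoiding on sa.
  apply/asboolP; split=> //; exists ks; split=> //.
    by apply: iso_eq ik => // k /nk; apply: off.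
  by move=> k x kk; rewrite -(off _ (nk k kk)); apply: hk.
have [/hasP[k kk lk]|/hasPn no] := boolP (has live ks).
  have [x ex sx] := on' k lk.
  have jk : j < k by apply: (allP (order_path_min ltn_trans pk)).
  apply: suffix_above_anti sx; [exact: ltnW (hk k x kk ex) | exact: ltnW].
apply/asboolP; split=> //; exists ks; split=> //.
  by apply: iso_eq ik => // k /no; move/off.
by move=> k x kk; rewrite (off _ (no k kk)); apply: hk.
Qed.

Definition live pi (k : nat) : bool :=
  if letter pi k is Some x then suffix_above X pi x k else false.

Definition class_key pi :
    {ffun 'I_n.+1 * 'I_n -> bool} * {ffun 'I_n -> option (option 'I_n.+1)} :=
  ([ffun c : 'I_n.+1 * 'I_n => suffix_above X pi c.1 c.2],
   [ffun j : 'I_n => if live pi j then None else Some (tnth pi j)]).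

Variable H : {set 'I_n}.
Let U : {set n.-tuple (option 'I_n.+1)} := [set pi | partial_perm pi && (holes pi == H)].

Section OneClass.
Variable pi0 : n.-tuple (option 'I_n.+1).
Hypothesis pi0U : pi0 \in U.

Let S : {set n.-tuple (option 'I_n.+1)} := [set pi in U | class_key pi == class_key pi0].
Let D v k := suffix_above X pi0 v k.
Let len v := #|[set j : 'I_n | D v j]|.
(** The holes whose column meets the diagram; letters are positive, so row 0 is below all of
    them. *)
Let hs := map val (enum [set j in H | D 0 j]).
Let L := map val (enum [set j : 'I_n | live pi0 j]).
Let vs := rev [seq v <- iota 1 n |
  has (fun k => live pi0 k && (letter pi0 k == Some v)) (iota 0 n)].

Definition position pi (v : nat) : nat :=
  if [pick j : 'I_n | letter pi j == Some v] is Some j then j : nat else 0.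

Lemma live_letter pi k : live pi k -> exists2 x, letter pi k = Some x & suffix_above X pi x k.
Proof. by rewrite /live; case: (letter pi k) => // x; exists x. Qed.

Lemma mem_vs_live v : v \in vs -> exists2 k, live pi0 k & letter pi0 k = Some v.
Proof.
by rewrite mem_rev mem_filter => /andP[/hasP[k _ /andP[lk /eqP e]] _]; exists k.
Qed.

Lemma U_partial pi : pi \in U -> partial_perm pi.
Proof. by rewrite inE => /andP[]. Qed.

Lemma live_mem_vs k v : live pi0 k -> letter pi0 k = Some v -> v \in vs.
Proof.
move=> lk e; have [kn vn] := letter_lt e.
rewrite mem_rev mem_filter mem_iota add1n ltnS vn (letter_pos (U_partial pi0U) e) !andbT.
by apply/hasP; exists k; rewrite ?mem_iota // lk e eqxx.
Qed.

Lemma D_len v k : k < n -> D v k = (k < len v).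
Proof.
move=> kn; rewrite -[k]/(val (Ordinal kn)) /len; apply/idP/idP => [dk|].
  rewrite -[X in X <= _](card_ord_lt kn); apply/subset_leq_card/subsetP => j.
  by rewrite !inE ltnS => jk; apply: suffix_above_anti dk.
apply: contraTT => nd; rewrite -leqNgt -[X in _ <= X](card_ord_lt (ltnW kn)).
apply/subset_leq_card/subsetP => j; rewrite !inE; apply: contraTT; rewrite -leqNgt => kj.
by apply: contra nd; apply: suffix_above_anti.
Qed.

Section InClass.
Variable pi : n.-tuple (option 'I_n.+1).
Hypothesis piS : pi \in S.

Lemma class_U : pi \in U. Proof. by move: piS; rewrite inE => /andP[]. Qed.

Lemma class_D v k : v <= n -> suffix_above X pi v k = D v k.
Proof.
move=> vn; have [kn|kn] := ltnP k n; last first.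
  by rewrite /D; apply/idP/idP => /suffix_above_lt; rewrite ltnNge kn.
move: piS; rewrite inE => /andP[_ /eqP[/ffunP/(_ (inord v, Ordinal kn)) + _]].
by rewrite !ffunE /= inordK.
Qed.

Lemma class_live k : live pi k = live pi0 k.
Proof.
have [kn|kn] := ltnP k n; last first.
  by rewrite /live; case e: (letter pi k) => [x|]; case e': (letter pi0 k) => [y|] //;
    [have [] := letter_lt e|have [] := letter_lt e|have [] := letter_lt e'];
    rewrite ltnNge kn.
move: piS; rewrite inE => /andP[_ /eqP[_ /ffunP/(_ (Ordinal kn))]].
by rewrite !ffunE /=; case: (live pi k); case: (live pi0 k).
Qed.

Lemma class_dead k : ~~ live pi0 k -> letter pi k = letter pi0 k.
Proof.
move=> dk; have [kn|kn] := ltnP k n; last first.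
  by case e: (letter pi k) => [x|]; case e': (letter pi0 k) => [y|] //;
    [have [] := letter_lt e|have [] := letter_lt e|have [] := letter_lt e'];
    rewrite ltnNge kn.
move: piS; rewrite inE => /andP[_ /eqP[_ /ffunP/(_ (Ordinal kn))]].
rewrite !ffunE /= class_live (negPf dk) => -[e].
by rewrite -[k]/(val (Ordinal kn)) !letterE e.
Qed.

Lemma class_inj j j' x : letter pi j = Some x -> letter pi j' = Some x -> j = j'.
Proof. by have [_ h] := (partial_permP pi).1 (U_partial class_U); apply: h. Qed.

Lemma positionE (k : nat) v : letter pi k = Some v -> position pi v = k.
Proof.
move=> e; have [kn _] := letter_lt e; rewrite /position.
case: pickP => [j /eqP ej|/(_ (Ordinal kn))]; first exact: class_inj ej e.
by rewrite /= e eqxx.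
Qed.
End InClass.

Lemma pi0S : pi0 \in S. Proof. by rewrite inE pi0U eqxx. Qed.

Lemma letter_exists pi v : pi \in U -> 0 < v <= n - #|H| -> exists k, letter pi k = Some v.
Proof.
rewrite inE => /andP[pp /eqP hH] vn.
have : v \in nonholes pi.
  by rewrite (perm_mem pp) mem_iota hH add1n ltnS.
rewrite nonholesE => /mapP[j]; rewrite mem_standard -letter_hole.
by case e: (letter pi j) => [x|] // _ ->; exists j.
Qed.

Lemma letter_range pi k v : pi \in U -> letter pi k = Some v -> 0 < v <= n - #|H|.
Proof.
rewrite inE => /andP[pp /eqP <-] e; have [h _] := (partial_permP pi).1 pp; exact: h e.
Qed.

(** Members of a class use the same set of values and agree outside the diagram, so the live
    positions also carry the same values. *)
Lemma class_value pi v : pi \in S -> v \in vs ->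
  exists2 k, live pi0 k & letter pi k = Some v.
Proof.
move=> piS /mem_vs_live[k lk e].
have [k' e'] := letter_exists (class_U piS) (letter_range pi0U e).
exists k' => //; apply: contraT => dk.
have := class_dead piS dk; rewrite e' => /esym e0.
by move: dk; rewrite (class_inj pi0S e0 e) lk.
Qed.

Lemma class_value_live pi k v : pi \in S -> live pi0 k -> letter pi k = Some v -> v \in vs.
Proof.
move=> piS lk e.
have [k' e'] := letter_exists pi0U (letter_range (class_U piS) e).
have [lk'|dk] := boolP (live pi0 k'); first exact: live_mem_vs e'.
have := class_dead piS dk; rewrite e' => e0.
by move: dk; rewrite (class_inj piS e0 e) lk.
Qed.
Lemma mem_L k : (k \in L) = live pi0 k.
Proof.
apply/mapP/idP => [[j]|lk]; first by rewrite mem_enum inE => lj ->.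
have [x e _] := live_letter lk; have [kn _] := letter_lt e.
by exists (Ordinal kn); rewrite // mem_enum inE.
Qed.

Lemma mem_hs k : (k \in hs) = (letter pi0 k == None) && D 0 k.
Proof.
have hH : holes pi0 = H by move: pi0U; rewrite inE => /andP[_ /eqP].
apply/mapP/andP => [[j]|[hk dk]].
  by rewrite mem_enum inE => /andP[jH dj] ->; rewrite letter_hole hH.
have kn := suffix_above_lt dk; exists (Ordinal kn) => //.
by rewrite mem_enum inE dk andbT -hH -letter_hole.
Qed.

Lemma class_hole pi k : pi \in S -> k < n -> (letter pi k == None) = (letter pi0 k == None).
Proof.
move=> piS kn; rewrite -[k]/(val (Ordinal kn)) !letter_hole.
have := class_U piS; have := pi0U; rewrite !inE => /andP[_ /eqP e] /andP[_ /eqP e'].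
by move: e e' => <- /setP/(_ (Ordinal kn)); rewrite !inE.
Qed.

Lemma avoids_occ pi p pat : size p = 3 -> pattern_spec p pat -> uniq p ->
  all (fun x => x <= 3) p -> all (fun x => 3 < x) X ->
  perm_eq (p ++ X) (iota 1 (size (p ++ X))) -> pi \in S ->
  partial_perm_avoids pi (p ++ X) <-> ~ occurs pat (letter pi) D (hs ++ L).
Proof.
move=> sp spec up ps Xb pp piS; have ppi := U_partial (class_U piS).
rewrite (avoids_has_pattern ppi pp) (has_patternP Xb sp spec up ps ppi).
have fitE k k3 : fits (suffix_above X pi) (letter pi k) k3 = fits D (letter pi k) k3.
  by case e: (letter pi k) => [v|] //=; apply: class_D => //; have [] := letter_lt e.
have occE k1 k2 k3 : occ3 pat (letter pi) (suffix_above X pi) k1 k2 k3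
    = occ3 pat (letter pi) D k1 k2 k3 by rewrite /occ3 !fitE.
suff iff : (exists k1 k2 k3, occ3 pat (letter pi) (suffix_above X pi) k1 k2 k3 /\
    suffix_above X pi 0 k3) <-> occurs pat (letter pi) D (hs ++ L) by rewrite iff.
split=> [[k1 [k2 [k3 []]]]|[k1 [k2 [k3 [i1 i2 i3 oc]]]]]; last first.
  exists k1, k2, k3; rewrite occE; split=> //; rewrite class_D //.
  move: i3; rewrite mem_cat mem_hs mem_L => /orP[/andP[]//|].
  by move/live_letter => [x _]; apply: suffix_above_anti.
rewrite occE => oc d3; exists k1, k2, k3.
have /and5P[k12 k23 _ f1 /andP[f2 f3]] := oc.
(* The cell of a letter of the occurrence is to the left of, or in, column [k3] in a row that
   reaches [k3] inside the diagram, so the letter is live; likewise the column of a hole meets the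
   diagram. *)
have inc k : k <= k3 -> fits D (letter pi k) k3 -> k \in hs ++ L.
  move=> kk3; have dk := suffix_above_anti (leqnn 0) kk3 d3.
  have kn := suffix_above_lt dk.
  rewrite mem_cat mem_hs mem_L -(class_hole piS kn) -(class_live piS) /live.
  case e: (letter pi k) => [v|] /=; last by rewrite -(class_D piS) // dk.
  by rewrite -(class_D piS); [apply: suffix_above_anti|have [] := letter_lt e].
split=> //; apply: inc => //; last exact: ltnW.
exact: ltnW (ltn_trans k12 k23).
Qed.

Lemma position_perm pi : pi \in S -> perm_eq (map (position pi) vs) L.
Proof.
move=> piS; apply: uniq_perm.
- rewrite map_inj_in_uniq ?rev_uniq ?filter_uniq ?iota_uniq //.
  move=> v w /(class_value piS)[k _ e] /(class_value piS)[k' _ e'].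
  by rewrite (positionE piS e) (positionE piS e') => kk; move: e'; rewrite -kk e => -[].
- by rewrite map_inj_uniq ?enum_uniq //; apply: val_inj.
move=> k; rewrite mem_L; apply/mapP/idP => [[v /(class_value piS)[k' lk e] ->]|lk].
  by rewrite (positionE piS e).
have [v e _] : exists2 v, letter pi k = Some v & suffix_above X pi v k.
  by apply: live_letter; rewrite class_live.
exists v; last by rewrite (positionE piS e).
exact: class_value_live piS lk e.
Qed.

Section Fill.
Variable c : seq nat.
Hypothesis c_perm : perm_eq c L.
Hypothesis size_c : size c = size vs.
Hypothesis c_D : forall i, i < size c -> D (nth 0 vs i) (nth 0 c i).

Definition fill : n.-tuple (option 'I_n.+1) :=
  [tuple if live pi0 j then Some (inord (nth 0 vs (index (val j) c)))
         else tnth pi0 j | j < n].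

Lemma mem_c k : (k \in c) = live pi0 k.
Proof. by rewrite (perm_mem c_perm) mem_L. Qed.

Lemma c_value k : live pi0 k -> nth 0 vs (index k c) \in vs.
Proof. by move=> lk; rewrite mem_nth // -size_c index_mem mem_c. Qed.

Lemma vs_le v : v \in vs -> v <= n.
Proof. by case/mem_vs_live=> k _ e; have [] := letter_lt e. Qed.

Lemma letter_fill k : letter fill k =
  if live pi0 k then Some (nth 0 vs (index k c)) else letter pi0 k.
Proof.
have [kn|kn] := ltnP k n; last first.
  have none pi : letter pi k = None.
    by case e: (letter pi k) => [x|] //; have [] := letter_lt e; rewrite ltnNge kn.
  by rewrite /live !none.
rewrite -[k]/(val (Ordinal kn)) letterE tnth_mktuple letterE /=.
case: ifP => //= lk; rewrite inordK // ltnS; apply: vs_le; exact: c_value.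
Qed.

(** By [c_D] every moved letter lands inside the old diagram, which is what [suffix_above_eq] asks
    for. *)
Lemma suffix_above_fill v k : suffix_above X fill v k = D v k.
Proof.
apply/esym; apply: (@suffix_above_eq _ _ (live pi0)) => {v}k.
- by move=> dk; rewrite letter_fill (negPf dk).
- exact: live_letter.
move=> lk; rewrite letter_fill lk; exists (nth 0 vs (index k c)) => //.
have il : index k c < size c by rewrite index_mem mem_c.
by have := c_D il; rewrite nth_index ?mem_c.
Qed.

Lemma fill_class : fill \in S.
Proof.
have hH : holes pi0 = H by move: pi0U; rewrite inE => /andP[_ /eqP].
have hf : holes fill = H.
  rewrite -hH; apply/setP => j; rewrite -!letter_hole letter_fill.
  by case: ifP => // /live_letter[x -> _].
have lf k : live fill k = live pi0 k.
  rewrite {1}/live letter_fill; case lk: (live pi0 k).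
    have il : index k c < size c by rewrite index_mem mem_c.
    by rewrite suffix_above_fill; have := c_D il; rewrite nth_index ?mem_c.
  case e: (letter pi0 k) => [x|] //; rewrite suffix_above_fill.
  by move: lk; rewrite /live e.
have vu : uniq vs by rewrite rev_uniq filter_uniq ?iota_uniq.
have cu : uniq c.
  by rewrite (perm_uniq c_perm) map_inj_uniq ?enum_uniq //; apply: val_inj.
rewrite inE [fill \in U]inE hf eqxx andbT; apply/andP; split; last first.
  apply/eqP; congr pair; apply/ffunP => j; rewrite !ffunE.
    exact: suffix_above_fill.
  by rewrite lf tnth_mktuple; case: (live pi0 j).
apply/partial_permP; rewrite hf; split.
  move=> k x; rewrite letter_fill; case: ifP => lk; last exact: letter_range.
  by case=> <-; have [k' _ e] := mem_vs_live (c_value lk); apply: letter_range e.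
have mixed k k' x : live pi0 k -> nth 0 vs (index k c) = x ->
    ~~ live pi0 k' -> letter pi0 k' = Some x -> False.
  move=> lk e dk' e'; have [k1 l1 e1] := mem_vs_live (c_value lk).
  by move: dk'; rewrite e in e1; rewrite -(class_inj pi0S e1 e') l1.
move=> k k' x; rewrite !letter_fill.
case: ifP => lk; case: ifP => lk'.
- move=> -[e] -[e']; move: e; rewrite -e' => /eqP.
  rewrite nth_uniq -?size_c ?index_mem ?mem_c // => /eqP ii.
  by rewrite -(nth_index 0 (_ : k \in c)) ?mem_c // ii nth_index ?mem_c.
- by move=> -[e] e'; case: (mixed k k' x lk e) => //; rewrite lk'.
- by move=> e' -[e]; case: (mixed k' k x lk' e) => //; rewrite lk.
by move=> a b; apply: (class_inj pi0S a b).
Qed.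

Lemma position_fill : map (position fill) vs = c.
Proof.
have vu : uniq vs by rewrite rev_uniq filter_uniq ?iota_uniq.
have cu : uniq c.
  by rewrite (perm_uniq c_perm) map_inj_uniq ?enum_uniq //; apply: val_inj.
apply: (@eq_from_nth _ 0); rewrite size_map // => i il.
rewrite (nth_map 0) //; apply: (positionE fill_class).
have ic : i < size c by rewrite size_c.
by rewrite letter_fill -mem_c mem_nth // index_uniq.
Qed.
End Fill.

Lemma class_avoiding_eq : perm_eq X (iota 4 (size X)) ->
  #|[set pi in S | `[< partial_perm_avoids pi ([:: 3; 1; 2] ++ X) >] ]|
  = #|[set pi in S | `[< partial_perm_avoids pi ([:: 2; 3; 1] ++ X) >] ]|.
Proof.
move=> pX.
have Xb : all (fun x => 3 < x) X.
  by apply/allP => x; rewrite (perm_mem pX) mem_iota => /andP[].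
have pp p : size p = 3 -> perm_eq p (iota 1 3) -> perm_eq (p ++ X) (iota 1 (size (p ++ X))).
  by move=> sp p3; rewrite size_cat sp iotaD perm_cat.
apply: (@class_card_eq _ S vs len hs L D (fun pi => letter pi) position).
- rewrite /vs rev_sorted; apply: sorted_filter (iota_ltn_sorted _ _).
  by move=> a b d; apply: ltn_trans.
- rewrite /vs sorted_map rev_sorted.
  have : sorted ltn [seq v <- iota 1 n |
      has (fun k => live pi0 k && (letter pi0 k == Some v)) (iota 0 n)].
    by apply: sorted_filter (iota_ltn_sorted _ _); apply: ltn_trans.
  apply: sub_sorted => v w vw /=.
  by apply/subset_leq_card/subsetP => j; rewrite !inE; apply: suffix_above_anti; rewrite // ltnW.
- exact: sorted_enum_ord.
- exact: sorted_enum_ord.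
- apply/allP => k; rewrite mem_L mem_hs => /live_letter[x -> _] //.
- by move=> v w k vw; apply: suffix_above_anti.
- move=> v k _; rewrite mem_cat mem_hs mem_L => /orP[/andP[_]|/live_letter[x _]];
    move/suffix_above_lt; exact: D_len.
- exact: position_perm.
- move=> pi v piS vv; have [k lk e] := class_value piS vv.
  rewrite (positionE piS e) -(class_D piS) ?(vs_le vv) //.
  by move: lk; rewrite -(class_live piS) /live e.
- by move=> pi v piS vv; have [k lk e] := class_value piS vv; rewrite (positionE piS e).
- move=> pi o piS; rewrite mem_hs => /andP[h /suffix_above_lt on].
  by apply/eqP; rewrite (class_hole piS on).
- move=> pi pi' piS pi'S e; apply: eq_from_tnth => j.
  have [lj|dj] := boolP (live pi0 j).
    have [x ex _] : exists2 x, letter pi j = Some x & suffix_above X pi x j.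
      by apply: live_letter; rewrite class_live.
    have xv := class_value_live piS lj ex.
    have [k' _ e'] := class_value pi'S xv.
    have : position pi x = position pi' x by move/eq_in_map: e; apply.
    rewrite (positionE piS ex) (positionE pi'S e') => jk; rewrite -jk in e'.
    move: ex e'; rewrite !letterE.
    case: (tnth pi j) => [a|] //= [<-]; case: (tnth pi' j) => [b|] //= [/val_inj ->] //.
  have := class_dead piS dj; rewrite -(class_dead pi'S dj) !letterE.
  by case: (tnth pi j) => [a|] /=; case: (tnth pi' j) => [b|] //= [/val_inj->].
- move=> c pc sc dc; exists (fill c); [exact: fill_class | exact: position_fill].
- move=> pi piS.
  have e := @avoids_occ pi [:: 3; 1; 2] _ erefl (pattern_spec312 [::]) isT isT Xb (pp [:: 3; 1; 2] erefl isT) piS.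
  by split=> [/asboolP/e|/e h] //; apply/asboolP.
- move=> pi piS.
  have e := @avoids_occ pi [:: 2; 3; 1] _ erefl (pattern_spec231 [::]) isT isT Xb (pp [:: 2; 3; 1] erefl isT) piS.
  by split=> [/asboolP/e|/e h] //; apply/asboolP.
Qed.
End OneClass.

Lemma num_avoiding_partial_eq : perm_eq X (iota 4 (size X)) ->
  num_avoiding_partial_perms H ([:: 3; 1; 2] ++ X)
  = num_avoiding_partial_perms H ([:: 2; 3; 1] ++ X).
Proof.
move=> pX.
have e p : num_avoiding_partial_perms H p = #|[set pi in U | `[< partial_perm_avoids pi p >] ]|.
  by apply: eq_card => pi; rewrite !inE andbA.
rewrite !e; apply: (@card_by_key _ _ U _ _ class_key) => pi0 pi0U.
exact: class_avoiding_eq.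
Qed.
End Classes.

Theorem theorem7 :
  shape_star_Wilf_equivalent [:: 3; 1; 2] [:: 2; 3; 1] /\
  (forall (m : nat) (X : seq nat),
     3 <= m -> perm_eq X (iota 4 (m - 3)) ->
     strongly_star_Wilf_equivalent ([:: 3; 1; 2] ++ X) ([:: 2; 3; 1] ++ X)).
Proof.
split=> [c lam H|m X _ pX n H]; first exact: num_avoiding_eq.
by apply: num_avoiding_partial_eq; rewrite (perm_size pX) size_iota.
Qed.
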